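(* Let $\Omega$ be a convex domain in $\mathbb{R}^d$, let $F\in C^2(\bar\Omega)$ with $e^{-F}\in L^1(\Omega)$, and let $d\gamma=e^{-F}dx$. Let $p\in[1,2]$, and let $v$ be a smooth positive solution of $$v_t=\Delta_g v\quad\text{in }\Omega\times\mathbb{R}^+,\qquad \nabla v\cdot n=0\quad\text{on }\partial\Omega\times\mathbb{R}^+,$$ with initial datum $v_0\in L^1_+(\Omega)$ such that $\mathcal{E}_p(0)$ is finite. If $\lambda_1(p)>0$, then for every $t\ge 0$, $$\mathcal{I}_p(t)\le \mathcal{I}_p(0)\,e^{-2\lambda_1(p)\,t},\qquad \mathcal{E}_p(t)\le \mathcal{E}_p(0)\,e^{-2\lambda_1(p)\,t}.$$
   Context: Here $g=e^{-F}$, $\Delta_g v:=\Delta v-\mathrm{D}F\cdot \mathrm{D}v$, and $n=n(x)$ is the unit outgoing normal vector at $x\in\partial\Omega$; $\partial\Omega$ is assumed to be of class $C^1$ (if $\Omega=\mathbb{R}^d$ there is no boundary condition). $L^1_+(\Omega)$ denotes the nonnegative functions on $\Omega$ that are integrable with respect to $d\gamma$. For a solution $v$, the entropy is $$\mathcal{E}_p(t):=\frac1{p-1}\int_\Omega\big[v^p-1-p(v-1)\big]\,d\gamma\quad\text{for }p\in(1,2],\qquad \mathcal{E}_1(t):=\int_\Omega\big[v\log v-(v-1)\big]\,d\gamma,$$ and, with $s:=v^{p/2}$, $\mathcal{I}_p(t):=\frac4p\int_\Omega|\mathrm{D}s|^2\,d\gamma$ for $p\in[1,2]$; all are evaluated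 with $v=v(\cdot,t)$, and the value at $t=0$ corresponds to $v_0$. Let $V(x):=\inf_{\xi\in S^{d-1}}(\mathrm{D}^2F(x)\xi,\xi)$ and $$\lambda_1(p):=\inf_{w\in H^1(\Omega,d\gamma)\setminus\{0\}}\frac{\int_\Omega\left(2\,\frac{p-1}{p}\,|\mathrm{D}w|^2+V\,|w|^2\right)d\gamma}{\int_\Omega|w|^2\,d\gamma},$$ where $H^1(\Omega,d\gamma)$ is the space of $w\in W^{1,1}_{\rm loc}(\Omega)\cap L^2(\Omega,d\gamma)$ with $\|\mathrm{D}w\|_{L^2(\Omega,d\gamma)}<\infty$. Standing convention: questions of regularity and well-posedness are not addressed; solutions are assumed to be positive, smooth (up to the boundary), and to behave adequately under integrations by parts, i.e. they have enough regularity and integrability at infinity that all integrations by parts with respect to $d\gamma$ involving $v$, its powers and their derivatives, and all differentiations in $t$ under the integral sign, are justified, and all integral quantities involved are well defined.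
   Formalization: The entropy estimate is proved for initial data with ∫v_0 dγ = γ(Ω); without this normalization it fails (for F=|x|²/2 on R^d, v=2 is a solution with constant positive entropy). The Fisher information estimate needs no such condition. *)

(* Defs.v *)
From HB Require Import structures.
From mathcomp Require Import all_boot all_order all_algebra.
From mathcomp Require Import all_classical all_reals all_analysis.
Set Implicit Arguments.
Unset Strict Implicit.
Unset Printing Implicit Defensive.
Import Order.TTheory GRing.Theory Num.Theory.
Import numFieldNormedType.Exports.
Local Open Scope classical_set_scope.
Local Open Scope ring_scope.

(* The sigma-algebra on matrices generated by the entries; on 'rV[R]_d it is
   the Borel sigma-algebra of R^d. *)
Definition mx_cylinder (dT : measure_display) (T : measurableType dT) (m n : nat)
    : set (set 'M[T]_(m, n)) :=
  [set A | exists (i : 'I_m) (j : 'I_n) (B : set T),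
     measurable B /\ A = [set M : 'M[T]_(m, n) | B (M i j)]].

Definition measure_mx_display : measure_display -> measure_display.
Proof. exact. Qed.

Section measurable_mx.
Context (dT : measure_display) (T : measurableType dT) (m n : nat).

Let mx_set0 : <<s @mx_cylinder dT T m n >> set0.
Proof. exact: sigma_algebra0. Qed.

Let mx_setC A : <<s @mx_cylinder dT T m n >> A ->
  <<s @mx_cylinder dT T m n >> (~` A).
Proof. exact: sigma_algebraC. Qed.

Let mx_bigcup (F : (set 'M[T]_(m, n))^nat) :
  (forall i, <<s @mx_cylinder dT T m n >> (F i)) ->
  <<s @mx_cylinder dT T m n >> (\bigcup_i (F i)).
Proof. exact: sigma_algebra_bigcup. Qed.

HB.instance Definition _ := @isMeasurable.Build (measure_mx_display dT)
  'M[T]_(m, n) <<s @mx_cylinder dT T m n >> mx_set0 mx_setC mx_bigcup.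

Lemma measurable_mx_coord (i : 'I_m) (j : 'I_n) :
  measurable_fun [set: 'M[T]_(m, n)] (fun M : 'M[T]_(m, n) => M i j).
Proof.
move=> _ B mB; rewrite setTI; apply: sub_sigma_algebra.
by exists i, j, B.
Qed.

Lemma measurable_fun_mx (d' : measure_display) (S : measurableType d')
    (f : S -> 'M[T]_(m, n)) :
  (forall i j, measurable_fun [set: S] (fun x => f x i j)) ->
  measurable_fun [set: S] f.
Proof.
move=> mf; apply: (@measurability _ _ _ _ _ _ (@mx_cylinder dT T m n)) => //.
move=> _ [_ [i [j [B [mB ->]]]] <-].
exact: (mf i j measurableT B mB).
Qed.
End measurable_mx.

(* Lebesgue measure on R^d, as the iterated product of the Lebesgue measure of
   R along R x R^n ~ R^(n+1). *)
Section lebesgue_rV.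
Context (R : realType).

Definition cons_rV (n : nat) (z : measurableTypeR R * 'rV[R]_n)
    : 'rV[R]_n.+1 :=
  row_mx ((z.1 : R)%:M : 'M[R]_1) z.2 : 'rV[R]_(1 + n).

Definition uncons_rV (n : nat) (x : 'rV[R]_n.+1)
    : measurableTypeR R * 'rV[R]_n :=
  (x 0 0, rsubmx (x : 'rV[R]_(1 + n))).

Lemma cons_rVK (n : nat) : cancel (@cons_rV n) (@uncons_rV n).
Proof.
case=> a x; rewrite /uncons_rV /cons_rV /= row_mxKr; congr (_, _).
have -> : (0 : 'I_n.+1) = lshift n (0 : 'I_1) by apply/val_inj.
by rewrite (row_mxEl (a : R)%:M x) mxE eqxx mulr1n.
Qed.

Lemma measurable_cons_rV (n : nat) :
  measurable_fun [set: measurableTypeR R * 'rV[R]_n] (@cons_rV n).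
Proof.
apply: measurable_fun_mx => i j.
case: (@split_ordP 1 n j) => k ->.
- rewrite (_ : (fun x => _) = fst); first exact: measurable_fst.
  apply/funext => z.
  by rewrite /cons_rV (row_mxEl ((z.1 : R)%:M : 'M[R]_1) z.2) !ord1 mxE eqxx mulr1n.
- rewrite (_ : (fun x => _) = (fun M : 'rV[R]_n => M i k) \o snd).
    exact: measurableT_comp (measurable_mx_coord _ _) measurable_snd.
  by apply/funext => z; rewrite /cons_rV (row_mxEr ((z.1 : R)%:M : 'M[R]_1) z.2).
Qed.

Lemma measurable_uncons_rV (n : nat) :
  measurable_fun [set: 'rV[R]_n.+1] (@uncons_rV n).
Proof.
apply/measurable_fun_pairP; split; first exact: measurable_mx_coord.
apply: measurable_fun_mx => i j.
rewrite (_ : (fun x => _) = fun M : 'rV[R]_(1 + n) => M i (rshift 1 j)).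
  exact: measurable_mx_coord.
by apply/funext => x; rewrite /= mxE.
Qed.

Section succ.
Context (n : nat) (mu : {sigma_finite_measure set 'rV[R]_n -> \bar R}).

Definition lebesgue_succ : set 'rV[R]_n.+1 -> \bar R :=
  pushforward (@lebesgue_measure R \x mu)%E (@cons_rV n).

Let pf : {measure set 'rV[R]_n.+1 -> \bar R} :=
  measure_function_pushforward__canonical__measure_function_Measure
    (@lebesgue_measure R \x mu)%E (@measurable_cons_rV n).

HB.instance Definition _ := isMeasure.Build _ _ _ lebesgue_succ
  (measure0 pf) (measure_ge0 pf) (@measure_semi_sigma_additive _ _ _ pf).

Let lebesgue_succ_sigma_finite : sigma_finite setT lebesgue_succ.
Proof.
have /sigma_finiteP[F [TF ndF Foo]] := sigma_finiteT (@lebesgue_measure R).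
have /sigma_finiteP[G [TG ndG Goo]] := sigma_finiteT mu.
exists (fun i => @uncons_rV n @^-1` (F i `*` G i)).
  rewrite -preimage_bigcup (_ : \bigcup_i _ = setT) ?preimage_setT//.
  rewrite -setXTT TF TG predeqE => -[x y]; split.
    by move=> [i _ []/= ? ?]; split; exists i.
  move=> [/= [i _ Fix] [k _ Gky]]; exists (maxn i k) => //; split.
  - by move: x Fix; exact/subsetPset/ndF/leq_maxl.
  - by move: y Gky; exact/subsetPset/ndG/leq_maxr.
move=> i; have [mFi Fioo] := Foo i; have [mGi Gioo] := Goo i; split.
  by rewrite -[X in measurable X]setTI; apply: measurable_uncons_rV => //;
    exact: measurableX.
rewrite /lebesgue_succ /pushforward -comp_preimage.
rewrite (_ : _ \o _ = id) ?preimage_id; last exact/funext/cons_rVK.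
by rewrite product_measure1E// lte_mul_pinfty// ge0_fin_numE.
Qed.

HB.instance Definition _ := Measure_isSigmaFinite.Build _ _ _ lebesgue_succ
  lebesgue_succ_sigma_finite.
End succ.

Fixpoint lebesgue_rV (n : nat) : {sigma_finite_measure set 'rV[R]_n -> \bar R} :=
  match n with
  | 0 => (\d_(0%R : 'rV[R]_0))%E
  | n'.+1 => lebesgue_succ (lebesgue_rV n')
  end.
End lebesgue_rV.

Section calculus.
Context (R : realType) (d : nat).
Implicit Types (f h F : 'rV[R]_d -> R) (x : 'rV[R]_d) (Omega : set 'rV[R]_d).

(* The library norm of 'rV[R]_d is the sup norm; Euclidean lengths are written
   with dot. *)
Definition dot (x y : 'rV[R]_d) : R := \sum_(i < d) x 0 i * y 0 i.

Definition pd (i : 'I_d) f x : R := 'D_(delta_mx 0 i) f x.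
Definition grad f x : 'rV[R]_d := \row_i pd i f x.
Definition hess f x : 'M[R]_d := \matrix_(i, j) pd j (pd i f) x.
Definition divergence (X : 'rV[R]_d -> 'rV[R]_d) x : R :=
  \sum_(i < d) pd i (fun y => X y 0 i) x.
Definition laplacian_g F h x : R :=
  \sum_(i < d) pd i (pd i h) x - dot (grad F x) (grad h x).

Definition quad (A : 'M[R]_d) (xi : 'rV[R]_d) : R :=
  \sum_(i < d) \sum_(j < d) A i j * xi 0 i * xi 0 j.

Definition boundary Omega : set 'rV[R]_d := closure Omega `\` Omega.

(* Value at a point of the closure of Omega of the continuous extension of a
   function given in Omega. *)
Definition trace Omega f x : R := lim (f @ within Omega (nbhs x)).

Definition continuous_bar Omega f : Prop :=
  forall x, closure Omega x -> cvg (f @ within Omega (nbhs x)).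

Fixpoint Ck_bar (k : nat) Omega f : Prop :=
  continuous_bar Omega f /\
  if k is k'.+1 then
    forall i : 'I_d, (forall x, Omega x -> derivable f x (delta_mx 0 i)) /\
      Ck_bar k' Omega (pd i f)
  else True.

Definition C1_on (U : set 'rV[R]_d) f : Prop :=
  forall (i : 'I_d) x, U x ->
    derivable f x (delta_mx 0 i) /\ {for x, continuous (pd i f)}.

Definition C1_compact_support (U : set 'rV[R]_d) f : Prop :=
  C1_on setT f /\
  exists K : set 'rV[R]_d,
    [/\ compact K, K `<=` U & forall x, ~ K x -> f x = 0].

(* The boundary is of class C^1 and n is the unit outgoing normal: locally Omega
   is {rho < 0} with rho of class C^1, D rho <> 0, and n = D rho / |D rho|. *)
Definition C1_boundary_normal Omega (n : 'rV[R]_d -> 'rV[R]_d) : Prop :=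
  forall x, boundary Omega x ->
    exists (U : set 'rV[R]_d) (rho : 'rV[R]_d -> R),
      [/\ open U /\ U x, C1_on U rho,
          (forall y, U y -> (Omega y <-> rho y < 0)),
          grad rho x != 0 &
          n x = (Num.sqrt (dot (grad rho x) (grad rho x)))^-1 *: grad rho x].

(* Surface measure on the boundary, characterized (uniquely, among locally
   finite Borel measures on the boundary) by the divergence theorem. *)
Definition surface_measure Omega (n : 'rV[R]_d -> 'rV[R]_d)
    (sigma : {measure set 'rV[R]_d -> \bar R}) : Prop :=
  (forall K : set 'rV[R]_d, compact K ->
     (sigma (K `&` boundary Omega) < +oo)%E) /\
  (forall X : 'rV[R]_d -> 'rV[R]_d,
     (forall i, C1_compact_support setT (fun x => X x 0 i)) ->
     (\int[lebesgue_rV R d]_(x in Omega) (divergence X x)%:E =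
      \int[sigma]_(x in boundary Omega) (dot (X x) (n x))%:E)%E).

End calculus.

Section weighted.
Context (R : realType) (d : nat) (Omega : set 'rV[R]_d) (F : 'rV[R]_d -> R).
Implicit Types (f h w : 'rV[R]_d -> R) (G : 'rV[R]_d -> 'rV[R]_d) (p : R).

(* Integration against d gamma = e^{-F} dx on Omega. *)
Definition gint f : \bar R :=
  (\int[lebesgue_rV R d]_(x in Omega) (f x * expR (- F x))%:E)%E.
Definition gintegrable f : Prop :=
  (lebesgue_rV R d).-integrable Omega (fun x => (f x * expR (- F x))%:E).
(* The integral makes sense in [-oo, +oo]. *)
Definition gint_defined f : Prop :=
  measurable_fun Omega f /\
  (gint (fun x => Num.max (f x) 0) != +oo%E \/
   gint (fun x => Num.max (- f x) 0) != +oo%E).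

Definition L1_plus w : Prop := (forall x, Omega x -> 0 <= w x) /\ gintegrable w.

Definition L1_loc f : Prop :=
  measurable_fun Omega f /\
  forall K : set 'rV[R]_d, compact K -> K `<=` Omega ->
    (lebesgue_rV R d).-integrable K (EFin \o f).

Definition weak_grad w G : Prop :=
  [/\ L1_loc w, (forall i, L1_loc (fun x => G x 0 i)) &
      forall (i : 'I_d) (phi : 'rV[R]_d -> R), C1_compact_support Omega phi ->
        (\int[lebesgue_rV R d]_(x in Omega) (w x * pd i phi x)%:E =
         - \int[lebesgue_rV R d]_(x in Omega) (G x 0 i * phi x)%:E)%E].

(* w belongs to H^1(Omega, d gamma) and D w = G. *)
Definition H1 w G : Prop :=
  [/\ weak_grad w G, gintegrable (fun x => w x ^+ 2) &
      gintegrable (fun x => dot (G x) (G x))].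

Definition V (x : 'rV[R]_d) : R :=
  inf [set q : R | exists xi : 'rV[R]_d, dot xi xi = 1 /\ q = quad (hess F x) xi].

Definition lambda1 p : \bar R :=
  ereal_inf [set q : \bar R | exists w G,
    let numerator x := 2 * ((p - 1) / p) * dot (G x) (G x) + V x * w x ^+ 2 in
    let denominator := gint (fun x => w x ^+ 2) in
    [/\ H1 w G, denominator != 0%E, gint_defined numerator &
        q = (gint numerator * ((fine denominator)^-1)%:E)%E]].

Definition entropy p w : \bar R :=
  if p == 1 then gint (fun x => w x * ln (w x) - (w x - 1))
  else gint (fun x => (p - 1)^-1 * (w x `^ p - 1 - p * (w x - 1))).

(* (4/p) \int |D s|^2 d gamma with s = w^(p/2), and +oo if s has no weak
   gradient; weak gradients being unique almost everywhere, the infimum is over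
   at most one value. *)
Definition fisher p w : \bar R :=
  ereal_inf [set q : \bar R | exists G,
    weak_grad (fun x => w x `^ (p / 2)) G /\
    q = ((4 / p)%:E * gint (fun x => dot (G x) (G x)))%E].

End weighted.

Section evolution.
Context (R : realType) (d : nat) (Omega : set 'rV[R]_d) (F : 'rV[R]_d -> R).
Context (n : 'rV[R]_d -> 'rV[R]_d) (sigma : {measure set 'rV[R]_d -> \bar R}).
Implicit Types (u v : R -> 'rV[R]_d -> R) (f h : 'rV[R]_d -> R) (p : R).

Definition dt u (t : R) (x : 'rV[R]_d) : R := derive1 (fun tau => u tau x) t.

(* Space derivatives of order at most k, continuous on ]0, +oo[ x closure Omega
   as functions of (t, x). *)
Fixpoint Ck_bar_evol (k : nat) u : Prop :=
  (forall (t : R) (x : 'rV[R]_d), 0 < t -> closure Omega x ->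
     cvg ((fun z : R * 'rV[R]_d => u z.1 z.2) @
          within [set z | Omega z.2] (nbhs (t, x)))) /\
  if k is k'.+1 then
    forall i : 'I_d,
      (forall t x, 0 < t -> Omega x -> derivable (u t) x (delta_mx 0 i)) /\
      Ck_bar_evol k' (fun t => pd i (u t))
  else True.

(* Implied by C^oo on ]0, +oo[ x closure Omega, which would be too much to ask
   of a solution when F is only C^2. *)
Definition smooth_evol v : Prop :=
  [/\ Ck_bar_evol 3 v,
      (forall t x, 0 < t -> Omega x -> derivable (fun tau => v tau x) t 1) &
      Ck_bar_evol 1 (dt v)].

Definition smooth_positive_solution v : Prop :=
  [/\ smooth_evol v,
      (forall t x, 0 < t -> Omega x -> 0 < v t x) /\
      (forall t x, 0 < t -> boundary Omega x -> 0 < trace Omega (v t) x),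
      (forall t x, 0 < t -> Omega x -> dt v t x = laplacian_g F (v t) x) &
      (forall t x, 0 < t -> boundary Omega x ->
         trace Omega (fun y => dot (grad (v t) y) (n x)) x = 0)].

(* e^{-F} f D h . n on the boundary *)
Definition boundary_flux f h (x : 'rV[R]_d) : R :=
  trace Omega (fun y => f y * dot (grad h y) (n x) * expR (- F y)) x.

(* \int f (Delta_g h) = - \int D f . D h + \int_{boundary} f (D h . n), all
   integrals being absolutely convergent. *)
Definition green f h : Prop :=
  [/\ gintegrable Omega F (fun x => f x * laplacian_g F h x),
      gintegrable Omega F (fun x => dot (grad f x) (grad h x)),
      sigma.-integrable (boundary Omega) (EFin \o boundary_flux f h) &
      (gint Omega F (fun x => (f x * laplacian_g F h x)%R) =
       - gint Omega F (fun x => dot (grad f x) (grad h x)) +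
       \int[sigma]_(x in boundary Omega) (boundary_flux f h x)%:E)%E].

Definition diff_under_int u : Prop :=
  forall t, 0 < t ->
    [/\ gintegrable Omega F (u t), gintegrable Omega F (dt u t) &
        is_derive t 1 (fun tau => fine (gint Omega F (u tau)))
          (fine (gint Omega F (dt u t)))].

(* phi of class C^2 on ]0, +oo[ with phi''(r) = O(r^(p-2)): the density of the
   entropy itself, affine functions, truncations of the former, ... *)
Definition subordinate_density p (phi : R -> R) : Prop :=
  [/\ (forall r, 0 < r -> derivable phi r 1),
      (forall r, 0 < r -> derivable (derive1 phi) r 1),
      (forall r, 0 < r -> {for r, continuous (derive1 (derive1 phi))}) &
      exists C : R, forall r, 0 < r -> `| derive1 (derive1 phi) r | <= C * r `^ (p - 2)].

(* Differentiations under the integral sign and integrations by parts are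
   licit in \int phi(v), phi as above, and in \int |D s|^2, s = v^(p/2), for all
   t > 0, and the quadratic and quartic integrals of D s, D^2 s arising from
   them are finite. *)
Definition adequate p v : Prop :=
  let s t x := v t x `^ (p / 2) in
  let Ds2 t x := dot (grad (s t) x) (grad (s t) x) in
  [/\ (forall phi, subordinate_density p phi ->
         diff_under_int (fun t x => phi (v t x)) /\
         forall t, 0 < t -> green (fun x => derive1 phi (v t x)) (v t)),
      diff_under_int Ds2,
      (forall t, 0 < t ->
         [/\ green (dt s t) (s t),
             green (laplacian_g F (s t)) (s t),
             green (fun x => Ds2 t x / s t x) (s t) &
             green (cst 1) (Ds2 t)]) &
      (forall t, 0 < t ->
         [/\ gintegrable Omega F (fun x => \sum_i \sum_j hess (s t) x i j ^+ 2),
             gintegrable Omega F (fun x => quad (hess F x) (grad (s t) x)) &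
             gintegrable Omega F (fun x => Ds2 t x ^+ 2 / s t x ^+ 2)])].

(* v(0) = v0 in L^1, and the entropy and the Fisher information take the values
   given by v0 at t = 0+. *)
Definition initial_datum p v (v0 : 'rV[R]_d -> R) : Prop :=
  [/\ v 0 = v0,
      gint Omega F (fun x => `| v t x - v0 x |) @[t --> 0^'+] --> 0%E,
      entropy Omega F p (v t) @[t --> 0^'+] --> entropy Omega F p v0 &
      fisher Omega F p (v t) @[t --> 0^'+] --> fisher Omega F p v0].

End evolution.

(* Main.v *)
Require Import Defs.
From mathcomp Require Import all_boot all_order all_algebra.
From mathcomp Require Import all_classical all_reals all_analysis.
From mathcomp Require Import measurable_realfun.
From mathcomp Require Import ring lra.
Set Implicit Arguments.
Unset Strict Implicit.
Unset Printing Implicit Defensive.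
Import Order.TTheory GRing.Theory Num.Theory.
Import numFieldNormedType.Exports.
Local Open Scope classical_set_scope.
Local Open Scope ring_scope.

(** In terms of [s = v^(p/2)] the equation reads [s_t = Delta_g s + (2/p - 1) |Ds|^2 / s], so that
    [J = \int |Ds|^2] satisfies [J' = - 2 \int s_t Delta_g s]. Integrating by parts, Bochner's formula
    and the sign of [D|Ds|^2 . n] on the boundary of a convex domain bound this by
    [- 2 \int ((2 - 2/p) |D^2 s|^2 + (D^2 F Ds, Ds))], and testing the definition of [lambda1] with
    every partial derivative of [s] gives [J' <= - 2 lambda1 J].

    Since [E' = - I] with [I = 4/p J], the function [I - 2 lambda1 E] is nonincreasing, whence
    [I >= 2 lambda1 E] and the decay of [E], as soon as [E] tends to [0]. The latter holds because
    [J] tends to [0]: Poincare's inequality on compact convex subsets exhausting Omega gives [v -> 1]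
    in [L^1], and the integrals of convex truncations of the entropy density, which vanish on
    [v <= M], are nonincreasing in time, so that no entropy escapes to large values of [v]. *)

(** * Differential calculus *)

(** The coefficient in [lambda1] is what survives of the Hessian. The term [(2/p - 1) |Ds|^2 / s] is
    absorbed by the square of [D^2 s - Ds Ds^T / s], at the price of a fraction [2/p - 1] of
    [|D^2 s|^2], nonnegative because [p <= 2]; what remains is [2 - 2/p = 2 (p - 1) / p]. That [E]
    tends to 0 cannot be read off [I >= 2 lambda1 E], which is the very inequality to be proved, and
    Omega may be unbounded, without any global Poincare inequality or compactness at hand. Local
    convergence in [L^1] and tightness replace them. As the entropy density is superlinear, large
    values of [v] need their own argument, and the truncations used there must stay among the
    densities for which differentiation under the integral is granted: of class [C^2], with second
    derivative [O(r^(p-2))]. [V] may be unbounded below, so the integrability of the numerators in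
    [lambda1] is a result and not an assumption. The initial Fisher information may be infinite, so
    estimates are proved between positive times and then carried to [t = 0+] in the extended
    reals. *)

Section directional.
Context {R : realType} {V : normedModType R}.
Implicit Types (f : V -> R) (x v : V).

(** The difference quotients of [f] along [v] and of its restriction to the line are the same
    function of [h], so one-variable theorems apply to partial derivatives. *)
Lemma is_derive_line f x v (t l : R) :
  is_derive (t *: v + x) v f l <-> is_derive t 1 (fun tau : R => f (tau *: v + x)) l.
Proof.
have E : (fun h : R => h^-1 *: ((f \o shift (t *: v + x)) (h *: v) - f (t *: v + x))) =
  (fun h : R => h^-1 *: (((fun tau : R => f (tau *: v + x)) \o shift t) (h *: 1) - f (t *: v + x))).
  apply/funext => h; congr (_ *: (f _ - _)).
  by rewrite /= addrA [h%:A]mulr1 scalerDl.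
split=> -[D1 D2]; split.
- by rewrite /derivable -E.
- by rewrite -D2 /derive E.
- by move: D1; rewrite /derivable -E.
- by rewrite -D2 /derive E.
Qed.

Lemma is_derive_comp_real f (g : R -> R) x v (df dg : R) :
  is_derive x v f df -> is_derive (f x) 1 g dg ->
  is_derive x v (fun y => g (f y)) (dg * df).
Proof.
move=> Hf Hg.
have -> : x = (0 : R) *: v + x by rewrite scale0r add0r.
apply/is_derive_line.
apply: (@is_derive1_comp _ g (fun tau : R => f (tau *: v + x)) 0).
  by rewrite scale0r add0r.
by apply/is_derive_line; rewrite scale0r add0r.
Qed.

(** The [o(h)] form avoids dividing by [h]; being trivial at [h = 0], it can be stated on a full
    neighbourhood of 0. *)
Lemma is_derive_cvg f x v (l : R) :
  (forall e : R, 0 < e -> \forall h \near (0 : R), `|f (h *: v + x) - f x - h * l| <= e * `|h|) ->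
  is_derive x v f l.
Proof.
move=> H.
have C : (fun h : R => h^-1 *: ((f \o shift x) (h *: v) - f x)) @ 0^' --> l.
  apply/cvgrPdist_le => e e0.
  have := H _ e0 => He.
  near=> h.
  have h0 : h != 0 by near: h; exact: nbhs_dnbhs_neq.
  have Hh : `|f (h *: v + x) - f x - h * l| <= e * `|h| by near: h; apply: nbhs_dnbhs.
  have -> : l - h^-1 *: ((f \o shift x) (h *: v) - f x) =
    - h^-1 * (f (h *: v + x) - f x - h * l).
    by rewrite /GRing.scale /=; field.
  rewrite normrM normrN normfV mulrC ler_pdivrMr ?normr_gt0 //.
split; last exact: cvg_lim.
by apply/cvg_ex; exists l.
Unshelve. all: by end_near. Qed.

Lemma is_derive_near f g x v (l : R) :
  (\forall y \near x, f y = g y) -> is_derive x v f l -> is_derive x v g l.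
Proof. exact: near_eq_is_derive. Qed.

End directional.

(** * Mean value theorem and mixed derivatives *)

Section mean_value.
Context {R : realType}.

Lemma near0_norm_lt (r : R) : 0 < r -> \forall h \near (0 : R), `|h| < r.
Proof.
move=> r0; near=> h; near: h.
by apply/nbhs_ballP; exists r => // h /=; rewrite -ball_normE /= sub0r normrN.
Unshelve. all: by end_near. Qed.

Lemma mean_value (phi dphi : R -> R) (h : R) :
  (forall t : R, `|t| <= `|h| -> is_derive t 1 phi (dphi t)) ->
  exists2 xi, `|xi| <= `|h| & phi h - phi 0 = h * dphi xi.
Proof.
move=> D.
have C (a b : R) : (forall t, a <= t <= b -> `|t| <= `|h|) -> {within `[a, b], continuous phi}.
  move=> ab; apply: derivable_within_continuous => t.
  by rewrite in_itv /= => /ab /D [].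
have [h0|h0] := leP 0 h.
- have [] := @MVT_segment _ phi dphi 0 h h0.
  + move=> t; rewrite in_itv /= => /andP[t0 th]; apply: D.
    by rewrite !ger0_norm// ltW.
  + by apply: C => t /andP[t0 th]; rewrite !ger0_norm.
  move=> c; rewrite in_itv /= => /andP[c0 ch] ->; exists c.
    by rewrite !ger0_norm.
  by rewrite subr0 mulrC.
- have [] := @MVT_segment _ phi dphi h 0 (ltW h0).
  + move=> t; rewrite in_itv /= => /andP[t0 th]; apply: D.
    by rewrite !ler0_norm ?lerN2// ltW.
  + by apply: C => t /andP[t0 th]; rewrite !ler0_norm ?lerN2// ltW.
  move=> c; rewrite in_itv /= => /andP[c0 ch] E; exists c.
    by rewrite !ler0_norm ?lerN2// ltW.
  by rewrite -opprB E sub0r; ring.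
Qed.

Lemma nonincreasing_derive (f df : R -> R) (a : R) :
  (forall t, a < t -> is_derive t 1 f (df t)) -> (forall t, a < t -> df t <= 0) ->
  forall s t, a < s -> s <= t -> f t <= f s.
Proof.
move=> D D0 s t a_s st.
have [] := @MVT_segment _ f df s t st.
- move=> x; rewrite in_itv /= => /andP[sx _]; apply: D; exact: lt_trans sx.
- apply: derivable_within_continuous => x; rewrite in_itv /= => /andP[sx _].
  by have [] := D x (lt_le_trans a_s sx).
move=> c; rewrite in_itv /= => /andP[sc _] E.
by rewrite -subr_le0 E mulr_le0_ge0 ?subr_ge0// D0// (lt_le_trans a_s).
Qed.

(* The mixed difference quotient of [f] is, by the mean value theorem, a value of [fyx]. *)
Lemma mixed_derivative (f fx fy fyx : R -> R -> R) (x y : R) :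
  (\forall z \near ((x, y) : R * R), is_derive (z.1 : R) 1 (f^~ z.2) (fx z.1 z.2)) ->
  (\forall z \near ((x, y) : R * R), is_derive (z.2 : R) 1 (f z.1) (fy z.1 z.2)) ->
  (\forall z \near ((x, y) : R * R), is_derive (z.1 : R) 1 (fy^~ z.2) (fyx z.1 z.2)) ->
  {for (x, y), continuous (fun z => fyx z.1 z.2)} ->
  is_derive y 1 (fx x) (fyx x y).
Proof.
move=> Hx Hy Hyx Hc; apply: is_derive_cvg => e e0.
have Hc' : \forall z \near (x, y), `|fyx x y - fyx z.1 z.2| <= e.
  by move/cvgrPdist_le: Hc => /(_ e e0).
have [r r0 Hr] : exists2 r : R, 0 < r & forall z : R * R, ball (x, y) r z ->
    (is_derive (z.1 : R) 1 (f^~ z.2) (fx z.1 z.2) /\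
     is_derive (z.2 : R) 1 (f z.1) (fy z.1 z.2)) /\
    (is_derive (z.1 : R) 1 (fy^~ z.2) (fyx z.1 z.2) /\
     `|fyx x y - fyx z.1 z.2| <= e).
  apply/nbhs_ballP; apply: filterI; exact: filterI.
have inb h k : `|h| < r -> `|k| < r -> ball (x, y) r (h + x, k + y).
  by move=> hr kr; split; rewrite /ball/= opprD addrCA subrr addr0 normrN.
(* For fixed [k] the bound does not depend on [h]: letting [h] tend to 0 turns the two quotients
   into values of [fx x] and leaves the wanted increment estimate. *)
have key k : `|k| < r -> \forall h \near 0^', `|h^-1 * (f (h + x) (k + y) - f x (k + y)) - h^-1 * (f (h + x) y - f x y) - k * fyx x y| <= e * `|k|.
  move=> kr; near=> h.
  have h0 : h != 0 by near: h; exact: nbhs_dnbhs_neq.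
  have hr : `|h| < r.
    by near: h; apply: nbhs_dnbhs; apply: near0_norm_lt.
  have lift (g dg : R -> R) (z t : R) : is_derive (t + z) 1 g (dg (t + z)) ->
      is_derive t 1 (fun t => g (t + z)) (dg (t + z)).
    move=> D1; have := (@is_derive_line _ _ g z 1 t _).1.
    rewrite [_%:A]mulr1 => /(_ _ D1).
    by under [X in is_derive _ _ X]funext do rewrite [_%:A]mulr1.
  have D1 (t : R) : `|t| <= `|k| -> is_derive t 1 (fun t => f (h + x) (t + y) - f x (t + y))
      (fy (h + x) (t + y) - fy x (t + y)).
    move=> tk; have tr : `|t| < r by apply: le_lt_trans kr.
    have [[_ D1] _] := Hr _ (inb _ _ hr tr).
    have [[_ D2] _] := Hr _ (inb 0 t ltac:(by rewrite normr0) tr).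
    rewrite /= add0r in D2.
    have D3 := lift (f (h + x)) (fy (h + x)) _ _ D1.
    have D4 := lift (f x) (fy x) _ _ D2.
    exact: is_deriveB.
  have [eta eta_k E1] := mean_value D1.
  rewrite /= !add0r in E1.
  have etar : `|eta| < r by apply: le_lt_trans kr.
  have D2 (t : R) : `|t| <= `|h| -> is_derive t 1 (fun s => fy (s + x) (eta + y)) (fyx (t + x) (eta + y)).
    move=> th; have tr : `|t| < r by apply: le_lt_trans hr.
    have [_ [D2 _]] := Hr _ (inb _ _ tr etar).
    exact: (lift (fy^~ (eta + y)) (fyx^~ (eta + y))).
  have [xi xi_h E2] := mean_value D2.
  rewrite /= !add0r in E2.
  have xir : `|xi| < r by apply: le_lt_trans hr.
  have [_ [_ B]] := Hr _ (inb _ _ xir etar).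
  have -> : h^-1 * (f (h + x) (k + y) - f x (k + y)) - h^-1 * (f (h + x) y - f x y) - k * fyx x y
    = - k * (fyx x y - fyx (xi + x) (eta + y)).
    rewrite -mulrBr opprB addrACA.
    rewrite (_ : (f (h + x) (k + y) + _ + _) = k * (h * fyx (xi + x) (eta + y))).
      by field.
    by rewrite -E2 -E1; ring.
  by rewrite normrM normrN mulrC ler_wpM2r.
have xD k : `|k| < r -> (fun h => h^-1 * (f (h + x) (k + y) - f x (k + y))) @ 0^' --> fx x (k + y).
  move=> kr; have [[D _] _] := Hr _ (inb 0 k ltac:(by rewrite normr0) kr).
  rewrite /= add0r in D.
  have [/cvg_ex[l Hl] E] := D.
  rewrite -E /derive.
  have -> : (fun h => h^-1 * (f (h + x) (k + y) - f x (k + y))) =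
    (fun h : R => h^-1 *: (((f^~ (k + y)) \o shift x) h%:A - f x (k + y))).
    by apply/funext => h /=; rewrite [h%:A]mulr1.
  by apply/cvg_ex; exists l.
near=> k.
have kr : `|k| < r by near: k; apply: near0_norm_lt.
rewrite [k *: 1]mulr1.
have L : (fun h => `|h^-1 * (f (h + x) (k + y) - f x (k + y)) - h^-1 * (f (h + x) y - f x y) - k * fyx x y|) @ 0^' --> `|fx x (k + y) - fx x y - k * fyx x y|.
  apply: cvg_norm; apply: cvgB; last exact: cvg_cst.
  apply: cvgB; first exact: xD.
  by have := xD 0; rewrite normr0 add0r; apply.
rewrite -(cvg_lim _ L)//; apply: limr_le; last exact: key.
by apply/cvg_ex; eexists; exact: L.
Unshelve. all: by end_near. Qed.

End mean_value.

(** * Functions with continuous partial derivatives *)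

Section partials.
Context {R : realType} {d : nat}.
Implicit Types (f : 'rV[R]_d -> R) (x w : 'rV[R]_d).

Lemma dotC x w : dot x w = dot w x.
Proof. by apply: eq_bigr => i _; rewrite mulrC. Qed.

Lemma norm_coord_le x i : `|x 0 i| <= `|x|.
Proof.
rewrite [leRHS]/Num.norm /= mx_normrE.
exact: (@le_bigmax _ _ _ 0 (fun ij : 'I_1 * 'I_d => `|x ij.1 ij.2|) (0, i)).
Qed.

Lemma norm_le_coord x (c : R) : 0 <= c -> (forall i, `|x 0 i| <= c) -> `|x| <= c.
Proof.
move=> c0 H; rewrite [leLHS]/Num.norm /= mx_normrE.
by apply/bigmax_leP; split => // -[i j] _ /=; rewrite ord1.
Qed.

(** The vertices of the path from 0 to [w] that changes one coordinate at a time. *)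
Definition head_rV (k : nat) w : 'rV[R]_d := \row_i (if (i < k)%N then w 0 i else 0).

Lemma head_rV0 w : head_rV 0 w = 0.
Proof. by apply/rowP => i; rewrite !mxE. Qed.

Lemma head_rV_all w : head_rV d w = w.
Proof. by apply/rowP => i; rewrite !mxE ltn_ord. Qed.

Lemma head_rVS (k : 'I_d) w : head_rV k.+1 w = w 0 k *: delta_mx 0 k + head_rV k w.
Proof.
apply/rowP => i; rewrite !mxE eqxx /= ltnS leq_eqVlt.
have [->|ik] := eqVneq i k; first by rewrite eqxx ltnn mulr1 addr0.
by rewrite -val_eqE in ik; rewrite (negbTE ik) mulr0 add0r.
Qed.

Lemma is_derive_pd f x i : derivable f x (delta_mx 0 i) -> is_derive x (delta_mx 0 i) f (pd i f x).
Proof. exact: derivableP. Qed.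

(** The increment telescopes along the points [head_rV k w + x]; each step is parallel to a basis
    vector, where the mean value theorem and the continuity of one partial derivative suffice. *)
Lemma grad_approx f x :
  (\forall y \near x, forall i, derivable f y (delta_mx 0 i)) ->
  (forall i, {for x, continuous (pd i f)}) ->
  forall e : R, 0 < e ->
  \forall w \near (0 : 'rV[R]_d), `|f (w + x) - f x - dot (grad f x) w| <= e * `|w|.
Proof.
move=> D C e e0.
(* The [d] coordinate errors [c |w|] add up to at most [e |w|]; the [+ 1] keeps the denominator
   positive for every [d]. *)
pose c := e / (d%:R + 1).
have d0 : (0 : R) < d%:R + 1 by rewrite ltr_wpDl.
have c0 : 0 < c by rewrite divr_gt0.
have C' : \forall y \near x, forall i, `|pd i f x - pd i f y| <= c.
  apply: (@filter_forall _ 'I_d (fun i y => `|pd i f x - pd i f y| <= c) (nbhs x)) => i.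
  by have /cvgrPdist_le/(_ _ c0) := C i.
have [r r0 Hr] : exists2 r, 0 < r & forall y, ball x r y ->
    (forall i, derivable f y (delta_mx 0 i)) /\ (forall i, `|pd i f x - pd i f y| <= c).
  by apply/nbhs_ballP; exact: filterI.
apply/nbhs_ballP; exists r => // w; rewrite -ball_normE /= sub0r normrN => wr.
have step (k : 'I_d) : `|f (head_rV k.+1 w + x) - f (head_rV k w + x) - w 0 k * pd k f x| <= c * `|w|.
  rewrite head_rVS -[_ *: _ + _ + x]addrA.
  have inb t : `|t| <= `|w 0 k| -> ball x r (t *: delta_mx 0 k + (head_rV k w + x)).
    move=> tk; rewrite -ball_normE /ball_/= addrA opprD addrCA subrr addr0 normrN.
    apply: le_lt_trans wr; apply: norm_le_coord => // i; rewrite !mxE eqxx /=.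
    have [->|ik] := eqVneq i k.
      by rewrite ltnn addr0 mulr1 (le_trans tk)// norm_coord_le.
    rewrite mulr0 add0r; case: ifP => _; first exact: norm_coord_le.
    by rewrite normr0.
  have D1 (t : R) : `|t| <= `|w 0 k| ->
      is_derive t 1 (fun t => f (t *: delta_mx 0 k + (head_rV k w + x)))
        (pd k f (t *: delta_mx 0 k + (head_rV k w + x))).
    move=> tk; have [D0 _] := Hr _ (inb _ tk).
    exact: ((is_derive_line f (head_rV k w + x) (delta_mx 0 k) t _).1 (is_derive_pd (D0 k))).
  have [xi xik E] := mean_value D1.
  rewrite scale0r add0r in E.
  rewrite E -mulrBr normrM mulrC distrC.
  have [_ /(_ k) B] := Hr _ (inb _ xik).
  by apply: ler_pM => //; exact: norm_coord_le.
have -> : f (w + x) - f x - dot (grad f x) w =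
   \sum_(k < d) (f (head_rV k.+1 w + x) - f (head_rV k w + x) - w 0 k * pd k f x).
  rewrite sumrB; congr (_ - _).
    rewrite -(big_mkord xpredT (fun k => f (head_rV k.+1 w + x) - f (head_rV k w + x))).
    by rewrite telescope_sumr// head_rV_all head_rV0 add0r.
  by rewrite /dot; apply: eq_bigr => i _; rewrite mxE mulrC.
apply: le_trans (ler_norm_sum _ _ _) _.
apply: le_trans (ler_sum _ (fun i _ => step i)) _.
rewrite sumr_const card_ord -mulr_natl mulrA ler_wpM2r//.
rewrite /c mulrCA; apply: ler_piMr; first exact: ltW.
by rewrite ler_pdivrMr// mul1r lerDl.
Qed.

Lemma norm_dot_le x w : `|dot x w| <= (\sum_i `|x 0 i|) * `|w|.
Proof.
rewrite mulr_suml; apply: le_trans (ler_norm_sum _ _ _) _.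
by apply: ler_sum => i _; rewrite normrM ler_wpM2l// norm_coord_le.
Qed.

Lemma is_derive_grad f x w :
  (\forall y \near x, forall i, derivable f y (delta_mx 0 i)) ->
  (forall i, {for x, continuous (pd i f)}) ->
  is_derive x w f (dot (grad f x) w).
Proof.
move=> D C; apply: is_derive_cvg => e e0.
have w0 : 0 < `|w| + 1 by rewrite ltr_wpDl.
have /nbhs_ballP[r /= r0 Hr] := grad_approx D C (divr_gt0 e0 w0).
near=> h.
have hr : `|h| * (`|w| + 1) < r.
  rewrite -ltr_pdivlMr//; near: h; apply: near0_norm_lt; exact: divr_gt0.
have hw : `|h *: w| <= `|h| * (`|w| + 1) by rewrite normrZ ler_wpM2l// lerDl.
have -> : h * dot (grad f x) w = dot (grad f x) (h *: w).
  by rewrite /dot mulr_sumr; apply: eq_bigr => i _; rewrite [(h *: w) 0 i]mxE mulrCA.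
apply: (le_trans (Hr (h *: w) _)).
  by rewrite -ball_normE /= sub0r normrN (le_lt_trans hw).
have -> : e / (`|w| + 1) * `|h *: w| = e * `|h| * (`|w| / (`|w| + 1)).
  by rewrite normrZ; field; rewrite gt_eqF.
apply: ler_piMr; first by rewrite mulr_ge0// ltW.
by rewrite ler_pdivrMr// mul1r lerDl.
Unshelve. all: by end_near. Qed.

Lemma grad_continuous f x :
  (\forall y \near x, forall i, derivable f y (delta_mx 0 i)) ->
  (forall i, {for x, continuous (pd i f)}) -> {for x, continuous f}.
Proof.
move=> D C; have FF : Filter (nbhs x) := nbhs_filter x.
rewrite /prop_for /continuous_at; apply/cvgrPdist_le => e e0.
have /nbhs_ballP[r /= r0 Hr] := grad_approx D C ltr01.
pose M := \sum_i `|grad f x 0 i| + 1.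
have M0 : 0 < M by rewrite ltr_wpDl// sumr_ge0.
near=> y.
have yr : `|y - x| < r by rewrite distrC; near: y; exact: cvgr_dist_lt.
have ye : M * `|y - x| <= e.
  rewrite -ler_pdivlMl// mulrC distrC; near: y; apply: cvgr_dist_le => //.
  exact: divr_gt0.
have := Hr (y - x); rewrite -ball_normE /= sub0r normrN => /(_ yr).
rewrite subrK mul1r => H; rewrite distrC.
rewrite (_ : f y - f x = (f y - f x - dot (grad f x) (y - x)) + dot (grad f x) (y - x)); last by rewrite subrK.
apply: le_trans (ler_normD _ _) _; apply: le_trans ye.
by rewrite /M mulrDl mul1r addrC lerD// norm_dot_le.
Unshelve. all: by end_near. Qed.

End partials.

Section for_continuous.
Context {R : realType} {T : topologicalType}.
Implicit Types (f g : T -> R) (x : T).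

Lemma for_continuousD f g x : {for x, continuous f} -> {for x, continuous g} ->
  {for x, continuous (fun y => f y + g y)}.
Proof. by move=> cf cg; exact: (cvgD cf cg). Qed.

Lemma for_continuousM f g x : {for x, continuous f} -> {for x, continuous g} ->
  {for x, continuous (fun y => f y * g y)}.
Proof. by move=> cf cg; exact: (cvgM cf cg). Qed.

Lemma for_continuous_comp (U S : topologicalType) (f : T -> U) (h : U -> S) x :
  {for x, continuous f} -> {for f x, continuous h} -> {for x, continuous (fun y => h (f y))}.
Proof. by move=> cf ch; exact: (cvg_comp f h cf ch). Qed.

End for_continuous.

Section C1_on_theory.
Context {R : realType} {d : nat}.
Implicit Types (f g : 'rV[R]_d -> R) (U : set 'rV[R]_d).

Lemma C1_on_near U f x : open U -> C1_on U f -> U x ->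
  \forall y \near x, forall i, derivable f y (delta_mx 0 i).
Proof.
move=> oU Hf Ux; have : nbhs x U by move: oU; rewrite openE; exact.
by apply: filterS => y Uy i; have [] := Hf i y Uy.
Qed.

Lemma C1_on_continuous U f x : open U -> C1_on U f -> U x -> {for x, continuous f}.
Proof.
move=> oU Hf Ux; apply: grad_continuous; first exact: C1_on_near Ux.
by move=> i; have [] := Hf i x Ux.
Qed.

Lemma C1_on_dir U f x w : open U -> C1_on U f -> U x -> is_derive x w f (dot (grad f x) w).
Proof.
move=> oU Hf Ux; apply: is_derive_grad; first exact: C1_on_near Ux.
by move=> i; have [] := Hf i x Ux.
Qed.

Lemma is_derive_pdE f x i l : is_derive x (delta_mx 0 i) f l -> pd i f x = l.
Proof. by move=> H; rewrite /pd derive_val. Qed.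

Lemma near_continuous (T : topologicalType) (f g : T -> R) x :
  (\forall y \near x, f y = g y) -> {for x, continuous f} -> {for x, continuous g}.
Proof.
move=> fg cf; rewrite /prop_for /continuous_at -(nbhs_singleton fg).
by apply: cvg_trans cf; apply: near_eq_cvg.
Qed.

Lemma C1_on_intro U f (df : 'I_d -> 'rV[R]_d -> R) : open U ->
  (forall x i, U x -> is_derive x (delta_mx 0 i) f (df i x)) ->
  (forall x i, U x -> {for x, continuous (df i)}) -> C1_on U f.
Proof.
move=> oU D C i x Ux; split; first by have [] := D x i Ux.
apply: near_continuous (C x i Ux).
have : nbhs x U by move: oU; rewrite openE; exact.
by apply: filterS => y Uy; rewrite (is_derive_pdE (D y i Uy)).
Qed.

Lemma C1_on_cst U c : open U -> C1_on U (cst c : 'rV[R]_d -> R).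
Proof.
move=> oU; apply: (@C1_on_intro _ _ (fun _ => cst 0)) => // x i Ux.
exact: cst_continuous.
Qed.

Lemma C1_onD U f g : open U -> C1_on U f -> C1_on U g -> C1_on U (fun x => f x + g x).
Proof.
move=> oU Hf Hg; apply: (@C1_on_intro _ _ (fun i x => pd i f x + pd i g x)) => // x i Ux;
  have [f1 f2] := Hf i x Ux; have [g1 g2] := Hg i x Ux.
  have := is_derive_pd f1; have := is_derive_pd g1 => ? ?; exact: is_deriveD.
exact: (for_continuousD f2 g2).
Qed.

Lemma C1_onM U f g : open U -> C1_on U f -> C1_on U g -> C1_on U (fun x => f x * g x).
Proof.
move=> oU Hf Hg; apply: (@C1_on_intro _ _ (fun i x => f x *: pd i g x + g x *: pd i f x)) => // x i Ux;
  have [f1 f2] := Hf i x Ux; have [g1 g2] := Hg i x Ux.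
  have := is_derive_pd f1; have := is_derive_pd g1 => ? ?; exact: is_deriveM.
have cf := C1_on_continuous oU Hf Ux; have cg := C1_on_continuous oU Hg Ux.
exact: (for_continuousD (for_continuousM cf g2) (for_continuousM cg f2)).
Qed.

Lemma C1_on_comp U f (g dg : R -> R) : open U -> C1_on U f ->
  (forall x, U x -> is_derive (f x) 1 g (dg (f x))) ->
  (forall x, U x -> {for f x, continuous dg}) -> C1_on U (fun x => g (f x)).
Proof.
move=> oU Hf Dg Cg; apply: (@C1_on_intro _ _ (fun i x => dg (f x) * pd i f x)) => // x i Ux;
  have [f1 f2] := Hf i x Ux.
  apply: is_derive_comp_real; last exact: Dg.
  exact: is_derive_pd.
apply: for_continuousM => //; apply: for_continuous_comp; [exact: C1_on_continuous Ux|exact: Cg].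
Qed.

Lemma C1_on_subset U W f : W `<=` U -> C1_on U f -> C1_on W f.
Proof. by move=> WU H i x /WU; exact: H. Qed.

Lemma is_derive_coord (x v : 'rV[R]_d) i : is_derive x v (fun y : 'rV[R]_d => y 0 i) (v 0 i).
Proof.
apply: is_derive_cvg => e e0; near=> h.
by rewrite !mxE addrK subrr normr0 mulr_ge0// ltW.
Unshelve. all: by end_near. Qed.

Lemma C1_on_coord U i : open U -> C1_on U (fun y : 'rV[R]_d => y 0 i).
Proof.
move=> oU; apply: (@C1_on_intro _ _ (fun k => cst ((delta_mx 0 k : 'rV[R]_d) 0 i))) => // x k Ux.
  exact: is_derive_coord.
exact: cst_continuous.
Qed.

Lemma open_near U x : open U -> U x -> \forall y \near x, U y.
Proof. by rewrite openE; exact. Qed.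

Lemma compact_closed_rV (K : set 'rV[R]_d) : compact K -> closed K.
Proof. by apply: compact_closed; exact: norm_hausdorff. Qed.

Lemma pd_eq0 f (K : set 'rV[R]_d) x i : closed K -> (forall y, ~ K y -> f y = 0) -> ~ K x ->
  is_derive x (delta_mx 0 i) f 0.
Proof.
move=> cK f0 Kx; apply: (is_derive_near (f := cst (0 : R))).
have : \forall y \near x, (~` K) y by apply: open_near => //; exact: closed_openC.
by apply: filterS => y /f0 ->.
Qed.

(** Off the closed set [K] the product vanishes on a neighbourhood, so regularity of the factors
    inside [U] yields regularity on the whole space. *)
Lemma C1_cutoffM U f g (K : set 'rV[R]_d) : open U -> C1_on U f -> C1_on U g ->
  compact K -> K `<=` U -> (forall x, ~ K x -> g x = 0) -> C1_on setT (fun x => f x * g x).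
Proof.
move=> oU Hf Hg cK KU g0; have clK := compact_closed_rV cK.
have Hfg := C1_onM oU Hf Hg.
have fg0 y : ~ K y -> f y * g y = 0 by move=> /g0 ->; rewrite mulr0.
move=> i x _; have [/KU Ux|Kx] := pselect (K x); first exact: Hfg.
split; first by have [] := pd_eq0 i clK fg0 Kx.
apply: (@near_continuous _ (cst 0)); last exact: cst_continuous.
have : \forall y \near x, (~` K) y by apply: open_near => //; exact: closed_openC.
by apply: filterS => y Ky; rewrite (is_derive_pdE (pd_eq0 i clK fg0 Ky)).
Qed.

End C1_on_theory.

(** * Lebesgue measure on row vectors *)

Section cubes.
Context {R : realType} {d : nat}.
Implicit Types (U : set 'rV[R]_d) (x : 'rV[R]_d).

Definition open_cube (c : 'rV[R]_d) (r : R) : set 'rV[R]_d := [set y | forall i, `|y 0 i - c 0 i| < r].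
Definition closed_cube (c : 'rV[R]_d) (r : R) : set 'rV[R]_d := [set y | forall i, `|y 0 i - c 0 i| <= r].

Definition rat_center (q : 'rV[rat]_d * nat) : 'rV[R]_d := \row_i ratr (q.1 0 i).
Definition rat_radius (q : 'rV[rat]_d * nat) : R := q.2.+1%:R^-1.

Lemma rat_radius_gt0 q : 0 < rat_radius q.
Proof. by rewrite invr_gt0. Qed.

(** A countable base of cubes. The open cube serves to cover [U], the closed one to remain inside
    it, which gives compact supports to the cutoffs built later. Two points of a cube differ by at
    most twice its radius, hence the bound by [r / 2]. *)
Lemma rat_cube_open U x : open U -> U x ->
  exists q, open_cube (rat_center q) (rat_radius q) x /\
    closed_cube (rat_center q) (rat_radius q) `<=` U.
Proof.
rewrite openE => /(_ x) /[apply].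
move=> /nbhs_ballP[r /= r0 xrU].
have [k kr] : exists k : nat, k.+1%:R^-1 < r / 2.
  have [k _ /(_ _ (leqnn k)) H] := near_infty_natSinv_lt (PosNum (ltac:(by rewrite divr_gt0//) : 0 < r / 2)).
  by exists k.
have rk0 : (0 : R) < k.+1%:R^-1 by rewrite invr_gt0.
have : forall i, exists q : rat, `|x 0 i - ratr q| < k.+1%:R^-1.
  move=> i; have /rat_in_itvoo[q] : x 0 i < x 0 i + k.+1%:R^-1 by rewrite ltrDl.
  rewrite in_itv /= => /andP[q1 q2]; exists q.
  by rewrite distrC ger0_norm ?subr_ge0 ?ltW// ltrBlDl.
move=> /choice[q qP]; exists (\row_i q i, k); split.
  by move=> i; rewrite /= !mxE.
move=> y Hy; apply: xrU; rewrite -ball_normE /=.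
apply: (@le_lt_trans _ _ (2 * k.+1%:R^-1)); last by rewrite -ltr_pdivlMl// mulrC.
apply: norm_le_coord; first by rewrite mulr_ge0// ltW.
move=> i; rewrite !mxE; have := Hy i; have := qP i; rewrite /= !mxE /rat_radius/= => A B.
rewrite (_ : _ - _ = (x 0 i - ratr (q i)) - (y 0 i - ratr (q i))); last by ring.
by rewrite (le_trans (ler_normB _ _))// mulrDl mul1r lerD// ltW.
Qed.

Lemma measurable_coord_preimage i (B : set R) : measurable (B : set (measurableTypeR R)) ->
  measurable [set x : 'rV[R]_d | B (x 0 i)].
Proof.
move=> mB; have := @measurable_mx_coord _ (measurableTypeR R) 1 d 0 i measurableT B mB.
by rewrite setTI.
Qed.

Lemma measurable_open_cube c r : measurable (open_cube c r).
Proof.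
rewrite (_ : open_cube c r = \bigcap_(i in [set: 'I_d]) [set y | `](c 0 i - r), (c 0 i + r)[%classic (y 0 i)]).
  apply: fin_bigcap_measurable => // i _.
  by apply: measurable_coord_preimage; exact: measurable_itv.
apply/seteqP; split=> y H i => [_|]; last have := H i I.
  by have := H i; rewrite /= in_itv /= ltr_distl.
by rewrite /= in_itv /= ltr_distl.
Qed.

Lemma measurable_closed_cube c r : measurable (closed_cube c r).
Proof.
rewrite (_ : closed_cube c r = \bigcap_(i in [set: 'I_d]) [set y | `[(c 0 i - r), (c 0 i + r)]%classic (y 0 i)]).
  apply: fin_bigcap_measurable => // i _.
  by apply: measurable_coord_preimage; exact: measurable_itv.
apply/seteqP; split=> y H i => [_|]; last have := H i I.
  by have := H i; rewrite /= in_itv /= ler_distl.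
by rewrite /= in_itv /= ler_distl.
Qed.

(** The sigma-algebra is generated by the coordinates, so the topology enters through a countable
    union of rational cubes. *)
Lemma measurable_open U : open U -> measurable U.
Proof.
move=> oU.
rewrite (_ : U = \bigcup_q (if `[< closed_cube (rat_center q) (rat_radius q) `<=` U >]
    then open_cube (rat_center q) (rat_radius q) else set0)).
  apply: countable_bigcupT_measurable => // q.
  by case: asboolP => _; [exact: measurable_open_cube|exact: measurable0].
apply/seteqP; split=> x.
  move=> /(rat_cube_open oU)[q [xq qU]]; exists q => //.
  by case: asboolP.
move=> [q _]; case: asboolP => // qU xq; apply: qU => i.
exact/ltW/xq.
Qed.

Lemma measurable_closed U : closed U -> measurable U.
Proof.
by move=> cU; rewrite -(setCK U); apply: measurableC; apply: measurable_open; exact: closed_openC.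
Qed.

(** Upper semicontinuity is the hypothesis, because it is what an infimum of continuous functions
    such as [V] satisfies. *)
Lemma measurable_fun_open_lt U (f : 'rV[R]_d -> R) : open U ->
  (forall a, open (U `&` [set x | f x < a])) -> measurable_fun U f.
Proof.
move=> oU H; apply: (measurability _ (measurable_realfun.RGenInftyO.measurableE R)) => //.
move=> _ [_ [a ->] <-]; apply: measurable_open.
have := H a; congr open; apply/seteqP; split => x [Ux] /=; rewrite in_itv //=.
Qed.

Lemma continuous_open_measurable U (f : 'rV[R]_d -> R) : open U ->
  (forall x, U x -> {for x, continuous f}) -> measurable_fun U f.
Proof.
move=> oU cf; apply: measurable_fun_open_lt => // a.
rewrite openE => x [Ux xa].
have : \forall y \near x, U y /\ f y < a.
  apply: filterI; first by move: oU; rewrite openE; exact.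
  have := cf x Ux; move/(_ [set r | r < a]); apply.
  exact: (@lt_nbhsl R (f x) a xa).
by [].
Qed.

End cubes.

(** * Translation invariance of Lebesgue measure and finiteness on cubes *)

Section translation.
Context {R : realType}.
Local Open Scope ereal_scope.

(** The pushforward under the translation gives half-open intervals their length, and Lebesgue
    measure is the only measure that does. *)
Lemma lebesgue_measure_translation (a : R) (A : set R) :
  measurable (A : set (measurableTypeR R)) ->
  (@lebesgue_measure R) A = (@lebesgue_measure R) ((fun x : R => (x + a)%R) @^-1` A).
Proof.
have mT : measurable_fun [set: measurableTypeR R] (fun x : measurableTypeR R => (x + a)%R : measurableTypeR R).
  by apply: measurable_funD.
pose mu : {measure set (measurableTypeR R) -> \bar R} :=
  measure_function_pushforward__canonical__measure_function_Measure (@lebesgue_measure R) mT.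
move=> mA; apply: (@lebesgue_measure_unique R mu) => // _ [[x y] _ <-].
rewrite /= /pushforward.
rewrite (_ : (fun _ => _) @^-1` _ = `](x - a)%R, (y - a)%R]%classic).
  rewrite !lebesgue_measure_itv /= !lte_fin ltrD2r.
  by case: ifP => // _; rewrite -!EFinB; congr EFin; ring.
by apply/seteqP; split => z /=; rewrite !in_itv /= ltrBlDr lerBrDr.
Qed.

Lemma ge0_integral_translation1 (a : R) (f : R -> \bar R) :
  measurable_fun [set: measurableTypeR R] f -> (forall x, 0 <= f x) ->
  \int[@lebesgue_measure R]_x f (x + a)%R = \int[@lebesgue_measure R]_x f x.
Proof.
move=> mf f0.
have mT : measurable_fun [set: measurableTypeR R] (fun x : measurableTypeR R => (x + a)%R : measurableTypeR R).
  by apply: measurable_funD.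
have := @ge0_integral_pushforward _ _ _ _ R _ mT (@lebesgue_measure R) setT f measurableT mf (fun x _ => f0 x).
rewrite preimage_setT => <-.
apply: eq_measure_integral => A mA _.
by rewrite [RHS](lebesgue_measure_translation a mA).
Qed.

Lemma measurable_translation n (a : 'rV[R]_n) :
  measurable_fun [set: 'rV[R]_n] (fun x => (x + a)%R).
Proof.
apply: (@measurable_fun_mx _ (measurableTypeR R)) => i j.
rewrite (_ : (fun x => _) = (fun x : 'rV[R]_n => (x i j + a i j)%R)).
  by apply: measurable_funD => //; exact: (@measurable_mx_coord _ (measurableTypeR R)).
by apply/funext => x; rewrite mxE.
Qed.

Lemma ge0_integral_lebesgue_rVS n (f : 'rV[R]_n.+1 -> \bar R) :
  measurable_fun setT f -> (forall x, 0 <= f x) ->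
  \int[lebesgue_rV R n.+1]_x f x =
  \int[@lebesgue_measure R]_x \int[lebesgue_rV R n]_y f (cons_rV (x, y)).
Proof.
move=> mf f0.
have := @ge0_integral_pushforward _ _ _ _ R _ (@measurable_cons_rV R n)
  (@lebesgue_measure R \x lebesgue_rV R n) setT f measurableT mf (fun x _ => f0 x).
rewrite preimage_setT => E; rewrite [LHS]E.
rewrite fubini_tonelli1//; last by move=> z; exact: f0.
exact: measurableT_comp mf (@measurable_cons_rV R n).
Qed.

Lemma cons_rVD n (a : 'rV[R]_n.+1) (x : R) (y : 'rV[R]_n) :
  cons_rV ((x + a 0 0)%R, (y + rsubmx (a : 'rV[R]_(1 + n)))%R) = (cons_rV (x, y) + a)%R.
Proof.
apply/rowP => j; rewrite [RHS]mxE; case: (@split_ordP 1 n j) => k ->.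
  rewrite /cons_rV !(row_mxEl ((_ : R)%:M : 'M[R]_1)) !mxE !ord1 eqxx !mulr1n.
  by congr (_ + a 0 _)%R; apply/val_inj.
rewrite /cons_rV !(row_mxEr ((_ : R)%:M : 'M[R]_1)) !mxE.
by congr (_ + a 0 _)%R; apply/val_inj.
Qed.

Lemma ge0_integral_translation n (a : 'rV[R]_n) (f : 'rV[R]_n -> \bar R) :
  measurable_fun setT f -> (forall x, 0 <= f x) ->
  \int[lebesgue_rV R n]_x f (x + a)%R = \int[lebesgue_rV R n]_x f x.
Proof.
elim: n a f => [a f mf f0|n IHn a f mf f0].
  by apply: eq_integral => x _; congr f; apply/rowP; case.
have mfa : measurable_fun setT (fun x : 'rV[R]_n.+1 => f (x + a)%R).
  exact: measurableT_comp mf (measurable_translation a).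
rewrite (ge0_integral_lebesgue_rVS mfa (fun x => f0 _)) (ge0_integral_lebesgue_rVS mf f0).
have mfc : measurable_fun setT (fun z : measurableTypeR R * 'rV[R]_n => f (cons_rV z)).
  exact: measurableT_comp mf (@measurable_cons_rV R n).
pose g (x : R) := \int[lebesgue_rV R n]_y f (cons_rV (x, y)).
have mg : measurable_fun [set: measurableTypeR R] g.
  exact: (measurable_fun_fubini_tonelli_F (m2 := lebesgue_rV R n) _ mfc).
transitivity (\int[@lebesgue_measure R]_x g (x + a 0 0)%R).
  apply: eq_integral => x _; rewrite /g.
  rewrite -(IHn (rsubmx (a : 'rV[R]_(1 + n))) (fun y => f (cons_rV ((x + a 0 0)%R, y)))) //.
    apply: eq_integral => y _; by rewrite cons_rVD.
  exact: measurableT_comp mfc (pair1_measurable _).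
rewrite -/g; have g0 x : 0 <= g x by exact: integral_ge0.
exact: (ge0_integral_translation1 (a 0 0)%R mg g0).
Qed.

Lemma lebesgue_rV_cube n (r : R) : (0 <= r)%R -> lebesgue_rV R n (closed_cube 0%R r) < +oo.
Proof.
move=> r0; elim: n => [|n IHn].
  by rewrite /= diracE; case: (_ \in _); rewrite ltry.
rewrite (_ : lebesgue_rV R n.+1 (closed_cube 0%R r) =
  (@lebesgue_measure R \x lebesgue_rV R n)%E (`[(- r)%R, r]%classic `*` closed_cube 0%R r)).
  rewrite product_measure1E//; last exact: measurable_closed_cube.
  have := @lebesgue_measure_itv R `[(- r)%R, r].
  rewrite /= lte_fin => ->.
  by case: ifP => _; rewrite ?mul0e ?ltry// -EFinB lte_mul_pinfty// ?lee_fin; lra.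
rewrite [LHS]/= /lebesgue_succ /pushforward; congr (_ _).
apply/seteqP; split=> -[x y] /=.
  move=> H; split.
    have := H (lshift n (0%R : 'I_1)).
    rewrite /cons_rV (row_mxEl ((_ : R)%:M : 'M[R]_1)) !mxE eqxx mulr1n subr0 /=.
    by rewrite in_itv /= ler_norml.
  move=> i; have := H (rshift 1 i).
  by rewrite /cons_rV (row_mxEr ((_ : R)%:M : 'M[R]_1)) !mxE.
move=> [H1 H2] j; case: (@split_ordP 1 n j) => k ->.
  rewrite /cons_rV (row_mxEl ((_ : R)%:M : 'M[R]_1)) !mxE !ord1 eqxx mulr1n subr0 /=.
  by rewrite in_itv /= in H1; rewrite ler_norml.
by have := H2 k; rewrite /cons_rV (row_mxEr ((_ : R)%:M : 'M[R]_1)) !mxE.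
Qed.

End translation.

(** * Weighted integrals *)

Definition gint_fin {R : realType} {d : nat} (Omega : set 'rV[R]_d) (F f : 'rV[R]_d -> R) : R :=
  fine (gint Omega F f).

Section weighted_integral.
Context {R : realType} {d : nat} {Omega : set 'rV[R]_d} {F : 'rV[R]_d -> R}.
Hypotheses (mO : measurable Omega) (mF : measurable_fun Omega F).
Implicit Types f g : 'rV[R]_d -> R.
Local Notation gi := (gintegrable Omega F).
Local Notation gint := (gint Omega F).
Local Notation rint := (gint_fin Omega F).

Lemma gintE f : gi f -> gint f = (rint f)%:E.
Proof. by move=> Hf; rewrite /gint_fin fineK//; exact: integrable_fin_num. Qed.

Lemma gint_ext f g : (forall x, Omega x -> f x = g x) -> gint f = gint g.
Proof.
by move=> fg; apply: eq_integral => x; rewrite inE => Ox; rewrite fg.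
Qed.

Lemma rint_ext f g : (forall x, Omega x -> f x = g x) -> rint f = rint g.
Proof. by move=> fg; rewrite /gint_fin (gint_ext fg). Qed.

Lemma gi_ext f g : (forall x, Omega x -> f x = g x) -> gi f -> gi g.
Proof.
by move=> fg; apply: eq_integrable => // x; rewrite inE => Ox; rewrite fg.
Qed.

Lemma giD f g : gi f -> gi g -> gi (fun x => f x + g x).
Proof.
move=> Hf Hg; have := integrableD mO Hf Hg.
by apply: eq_integrable => // x _; rewrite /= -EFinD mulrDl.
Qed.

Lemma rintD f g : gi f -> gi g -> rint (fun x => f x + g x) = rint f + rint g.
Proof.
move=> Hf Hg; apply: EFin_inj; rewrite EFinD -!gintE//; last exact: giD.
rewrite /Defs.gint -integralD//.
by apply: eq_integral => x _; rewrite -EFinD mulrDl.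
Qed.

Lemma giZ c f : gi f -> gi (fun x => c * f x).
Proof.
move=> Hf; have := integrableZl mO c Hf.
by apply: eq_integrable => // x _; rewrite /= -EFinM mulrA.
Qed.

Lemma rintZ c f : gi f -> rint (fun x => c * f x) = c * rint f.
Proof.
move=> Hf; apply: EFin_inj; rewrite EFinM -!gintE//; last exact: giZ.
rewrite /Defs.gint -integralZl//.
by apply: eq_integral => x _; rewrite -EFinM mulrA.
Qed.

Lemma giN f : gi f -> gi (fun x => - f x).
Proof. by move=> /(giZ (-1)); apply: gi_ext => x _; rewrite mulN1r. Qed.

Lemma rintN f : gi f -> rint (fun x => - f x) = - rint f.
Proof.
by move=> Hf; rewrite -mulN1r -rintZ//; apply: rint_ext => x _; rewrite mulN1r.
Qed.

Lemma giB f g : gi f -> gi g -> gi (fun x => f x - g x).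
Proof. by move=> Hf Hg; apply: giD => //; exact: giN. Qed.

Lemma rintB f g : gi f -> gi g -> rint (fun x => f x - g x) = rint f - rint g.
Proof. by move=> Hf Hg; rewrite rintD ?rintN//; exact: giN. Qed.

Lemma gi0 : gi (fun=> 0).
Proof.
have : (lebesgue_rV R d).-integrable Omega (cst 0)%E by exact: integrable0.
by apply: eq_integrable => // x _; rewrite mul0r.
Qed.

Lemma rint0 : rint (fun=> 0) = 0.
Proof.
by rewrite /gint_fin /Defs.gint integral0_eq//= => x _; rewrite mul0r.
Qed.

Lemma gi_sum n (h : 'I_n -> 'rV[R]_d -> R) : (forall i, gi (h i)) -> gi (fun x => \sum_i h i x).
Proof.
move=> H; elim: (index_enum _) => [|i s IHs].
  by apply: gi_ext gi0 => x _; rewrite big_nil.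
by apply: gi_ext (giD (H i) IHs) => x _; rewrite big_cons.
Qed.

Lemma rint_sum n (h : 'I_n -> 'rV[R]_d -> R) : (forall i, gi (h i)) ->
  rint (fun x => \sum_i h i x) = \sum_i rint (h i).
Proof.
move=> H.
suff [] : gi (fun x => \sum_i h i x) /\ rint (fun x => \sum_i h i x) = \sum_i rint (h i) by [].
elim: (index_enum _) => [|i s [IHs1 IHs2]].
  split; first by apply: gi_ext gi0 => x _; rewrite big_nil.
  rewrite big_nil; transitivity (rint (fun=> 0)); last exact: rint0.
  by apply: rint_ext => x _; rewrite big_nil.
split; first by apply: gi_ext (giD (H i) IHs1) => x _; rewrite big_cons.
by rewrite big_cons -IHs2 -rintD//; apply: rint_ext => x _; rewrite big_cons.
Qed.

Lemma rint_le f g : gi f -> gi g -> (forall x, Omega x -> f x <= g x) -> rint f <= rint g.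
Proof.
move=> Hf Hg fg; rewrite -lee_fin -!gintE//; apply: le_integral => // x.
by rewrite inE => Ox; rewrite lee_fin ler_wpM2r ?expR_ge0// fg.
Qed.

Lemma rint_ge0 f : (forall x, Omega x -> 0 <= f x) -> 0 <= rint f.
Proof.
move=> f0; rewrite fine_ge0//; apply: integral_ge0 => x Ox.
by rewrite lee_fin mulr_ge0 ?expR_ge0// f0.
Qed.

Lemma measurable_weight : measurable_fun Omega (fun x => expR (- F x)).
Proof.
apply: measurableT_comp; first exact: measurable_expR.
exact: measurable_funN.
Qed.

Lemma measurable_weighted f : measurable_fun Omega f ->
  measurable_fun Omega (fun x => (f x * expR (- F x))%:E).
Proof.
move=> mf; apply/measurable_EFinP; apply: measurable_funM => //.
exact: measurable_weight.
Qed.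

Lemma gi_measurable f : gi f -> measurable_fun Omega f.
Proof.
move=> /integrableP[/measurable_EFinP mf _].
have : measurable_fun Omega (fun x => (f x * expR (- F x)) * expR (F x)).
  apply: measurable_funM => //.
  by apply: measurableT_comp; first exact: measurable_expR.
by apply: eq_measurable_fun => x _; rewrite -mulrA -expRD addNr expR0 mulr1.
Qed.

Lemma gi_le f g : measurable_fun Omega f -> (forall x, Omega x -> `|f x| <= g x) -> gi g -> gi f.
Proof.
move=> mf fg; apply: le_integrable => //; first exact: measurable_weighted.
move=> x Ox; rewrite /= lee_fin !normrM ler_wpM2r//.
by rewrite (le_trans (fg x Ox))// ler_norm.
Qed.

(** The integral of [f] may be infinite. Replacing [g] by its positive part reduces the claim to
    monotonicity for nonnegative functions. *)
Lemma gint_ge f g : gi g -> measurable_fun Omega f -> (forall x, Omega x -> 0 <= f x) ->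
  (forall x, Omega x -> g x <= f x) -> ((rint g)%:E <= gint f)%E.
Proof.
move=> Hg mf f0 gf.
have mg := gi_measurable Hg.
have Hp : gi (fun x => Num.max (g x) 0).
  apply: (@gi_le _ (fun x => `|g x|)) => [|x Ox|].
  - by apply: measurable_maxr.
  - by rewrite ger0_norm ?le_max ?lexx ?orbT// ge_max ler_norm normr_ge0.
  - have := integrable_abse Hg; apply: eq_integrable => // x _.
    by rewrite /= normrM [`|expR _|]ger0_norm// expR_ge0.
apply: (@le_trans _ _ (gint (fun x => Num.max (g x) 0))).
  by rewrite (gintE Hp) lee_fin rint_le// => x Ox; rewrite le_max lexx.
apply: ge0_le_integral => //.
- by move=> x Ox; rewrite lee_fin mulr_ge0 ?expR_ge0// le_max lexx orbT.
- exact: (measurable_weighted (gi_measurable Hp)).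
- exact: measurable_weighted.
- move=> x Ox; rewrite lee_fin ler_wpM2r ?expR_ge0// ge_max gf//= f0//.
Qed.

Lemma rint_dominated (f_ : nat -> 'rV[R]_d -> R) f g :
  (forall n, measurable_fun Omega (f_ n)) -> measurable_fun Omega f -> gi g ->
  (forall x, Omega x -> f_ ^~ x @ \oo --> f x) ->
  (forall n x, Omega x -> `|f_ n x| <= g x) ->
  rint (f_ n) @[n --> \oo] --> rint f.
Proof.
move=> mf_ mf Hg cvf dom.
have Hf_ n : gi (f_ n) by apply: gi_le Hg => // x Ox; exact: dom.
have [] := @dominated_convergence _ _ R (lebesgue_rV R d) Omega mO
  (fun n x => (f_ n x * expR (- F x))%:E) (fun x => (f x * expR (- F x))%:E)
  (fun x => (g x * expR (- F x))%:E).
- by move=> n; exact: measurable_weighted.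
- exact: measurable_weighted.
- apply/aeW => x Ox; apply: cvg_EFin; first by near=> n.
  by apply: cvgM; [exact: cvf|exact: cvg_cst].
- by [].
- by apply/aeW => x n Ox; rewrite /= lee_fin normrM [`|expR _|]ger0_norm ?expR_ge0// ler_wpM2r ?expR_ge0// dom.
move=> If _ H; apply: fine_cvg.
by rewrite -/(rint f) -gintE//; exact: H.
Unshelve. all: by end_near. Qed.

End weighted_integral.

(** * Weak gradients and cutoffs *)

Section compact_support.
Context {R : realType} {d : nat} {Omega : set 'rV[R]_d}.
Hypothesis Omega_open : open Omega.
Implicit Types (f g : 'rV[R]_d -> R) (K : set 'rV[R]_d).

Lemma compact_bound f K : compact K -> (forall x, K x -> {for x, continuous f}) ->
  exists M, forall x, K x -> `|f x| <= M.
Proof.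
move=> cK cf.
have : compact (f @` K).
  apply: continuous_compact => //; apply: continuous_in_subspaceT => x.
  by rewrite inE => /cf.
move=> /compact_bounded[M [_ HM]]; exists (M + 1) => x Kx.
by apply: (HM (M + 1)); [rewrite ltrDl|exists x].
Qed.

Hypothesis lty_compact : forall K, compact K -> K `<=` Omega -> (lebesgue_rV R d K < +oo)%E.

Lemma integrable_on_compact f K : compact K -> K `<=` Omega ->
  (forall x, Omega x -> {for x, continuous f}) ->
  (lebesgue_rV R d).-integrable K (EFin \o f).
Proof.
move=> cK KO cf; have mK := measurable_closed (compact_closed_rV cK).
apply: measurable_bounded_integrable => //; first exact: lty_compact.
  apply: measurable_funS (continuous_open_measurable Omega_open cf) => //.
  exact: measurable_open.
have [M HM] := compact_bound cK (fun x Kx => cf x (KO x Kx)).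
exists M; split; first exact: num_real.
by move=> y My x Kx /=; rewrite (le_trans (HM x Kx))// ltW.
Qed.

Lemma integrable_compact_support f g K : compact K -> K `<=` Omega ->
  (forall x, Omega x -> {for x, continuous f}) -> (forall x, ~ K x -> g x = 0) ->
  (forall x, Omega x -> {for x, continuous g}) ->
  (lebesgue_rV R d).-integrable Omega (fun x => (f x * g x)%:E).
Proof.
move=> cK KO cf g0 cg.
have mK := measurable_closed (compact_closed_rV cK).
have mO := measurable_open Omega_open.
have : (lebesgue_rV R d).-integrable (Omega `&` K) (EFin \o (fun x => f x * g x)).
  rewrite setIC setIidl//; apply: integrable_on_compact => // x Ox.
  exact: (for_continuousM (cf x Ox) (cg x Ox)).
move=> /(integrable_restrict _ mK mO); apply: eq_integrable => // x _.
rewrite patchE; case: ifPn => // /negP; rewrite inE => Kx.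
by rewrite g0 ?mulr0.
Qed.

Context {n : 'rV[R]_d -> 'rV[R]_d} {sigma : {measure set 'rV[R]_d -> \bar R}}.
Hypothesis sigma_surface : surface_measure Omega n sigma.

(** The divergence theorem contained in [surface_measure] is applied to the field [f phi e_i]. Since
    [phi] is supported in a compact subset of Omega, the field extends by zero and its boundary
    integral vanishes. *)
Lemma weak_grad_classical f : C1_on Omega f -> weak_grad Omega f (grad f).
Proof.
move=> Hf; have mO := measurable_open Omega_open.
have cf x : Omega x -> {for x, continuous f} by exact: C1_on_continuous.
have cdf i x : Omega x -> {for x, continuous (fun x => grad f x 0 i)}.
  move=> Ox; have [_] := Hf i x Ox.
  by rewrite (_ : (fun x => _) = pd i f)//; apply/funext => y; rewrite mxE.
split.
- by split=> [|K cK KO]; [exact: continuous_open_measurable|exact: integrable_on_compact].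
- by move=> i; split=> [|K cK KO]; [apply: continuous_open_measurable|apply: integrable_on_compact] => //; exact: cdf.
move=> i phi [phi1 [K [cK KO phi0]]].
have clK := compact_closed_rV cK.
have cphi x : {for x, continuous phi}.
  by apply: (C1_on_continuous openT phi1).
have phiO : C1_on Omega phi by exact: C1_on_subset phi1.
pose X x : 'rV[R]_d := \row_j (if j == i then f x * phi x else 0).
have XE j : (fun x => X x 0 j) = if j == i then (fun x => f x * phi x) else cst 0.
  by apply/funext => x; rewrite mxE; case: ifP.
have HX : forall j, C1_compact_support setT (fun x => X x 0 j).
  move=> j; rewrite XE; split.
    case: ifP => _; last exact: C1_on_cst openT.
    exact: (C1_cutoffM Omega_open Hf phiO cK KO phi0).
  exists K; split => // x Kx; case: ifP => //= _.
  by rewrite phi0 ?mulr0.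
have [_ /(_ X HX)] := sigma_surface.
rewrite [X in _ = X -> _](_ : _ = 0)%E; last first.
  rewrite integral0_eq// => x [_ nOx]; congr EFin.
  rewrite /dot big1// => j _; rewrite mxE; case: ifP => _; rewrite ?mul0r//.
  by rewrite phi0 ?mulr0 ?mul0r// => /KO.
have I1 : (lebesgue_rV R d).-integrable Omega (fun x => (f x * pd i phi x)%:E).
  apply: (integrable_compact_support cK KO cf).
    by move=> x Kx; rewrite (is_derive_pdE (pd_eq0 i clK phi0 Kx)).
  by move=> x _; have [_] := phi1 i x I.
have I2 : (lebesgue_rV R d).-integrable Omega (fun x => (grad f x 0 i * phi x)%:E).
  by apply: (integrable_compact_support cK KO (cdf i) phi0) => x _; exact: cphi.
move=> E.
have : (\int[lebesgue_rV R d]_(x in Omega) (f x * pd i phi x)%:E +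
  \int[lebesgue_rV R d]_(x in Omega) (grad f x 0 i * phi x)%:E = 0)%E.
  rewrite -integralD// -[RHS]E; apply: eq_integral => x; rewrite inE => Ox.
  rewrite -EFinD; congr EFin; rewrite /divergence (bigD1 i)//= big1 => [|j ji]; last first.
    by rewrite XE (negbTE ji) /pd derive_cst.
  rewrite XE eqxx addr0 mxE.
  have f1 := is_derive_pd (Hf i x Ox).1; have p1 := is_derive_pd (phi1 i x I).1.
  rewrite [RHS](is_derive_pdE (is_deriveM f1 p1)) /GRing.scale /=.
  by rewrite [phi x * _]mulrC.
rewrite -(fineK (integrable_fin_num mO I1)) -(fineK (integrable_fin_num mO I2)).
by rewrite -EFinD => -[]/eqP; rewrite addr_eq0 => /eqP ->; rewrite EFinN.
Qed.

Lemma integrable_L1_loc_mul f g K : L1_loc Omega f -> compact K -> K `<=` Omega ->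
  (forall x, Omega x -> {for x, continuous g}) -> (forall x, ~ K x -> g x = 0) ->
  (lebesgue_rV R d).-integrable Omega (fun x => (f x * g x)%:E).
Proof.
move=> [mf Hf] cK KO cg g0.
have mK := measurable_closed (compact_closed_rV cK).
have mO := measurable_open Omega_open.
have mg := continuous_open_measurable Omega_open cg.
have [M HM] := compact_bound cK (fun x Kx => cg x (KO x Kx)).
have I1 : (lebesgue_rV R d).-integrable (Omega `&` K) (fun x => M%:E * (EFin \o f) x)%E.
  by rewrite setIC setIidl//; apply: integrableZl => //; exact: Hf.
move/(integrable_restrict _ mK mO): I1; apply: le_integrable => //.
  by apply/measurable_EFinP; exact: measurable_funM.
move=> x Ox; rewrite patchE; case: ifPn => [|/negP]; rewrite inE => Kx.
  rewrite /= lee_fin !normrM mulrC ler_wpM2r//.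
  by rewrite (le_trans (HM x Kx))// ler_norm.
by rewrite g0// mulr0 (_ : `|0%:E| = 0)%E ?abse_ge0//= normr0.
Qed.

End compact_support.

(** * Bump functions and cutoff sequences *)

Section cutoff.
Context {R : realType} {d : nat} {Omega : set 'rV[R]_d}.
Hypothesis Omega_open : open Omega.
Implicit Types (f g : 'rV[R]_d -> R).

(** The square makes the positive part continuously differentiable at 0. *)
Definition sqr_pos (y : R) : R := Num.max 0 y ^+ 2.

Lemma is_derive_sqr_pos (y : R) : is_derive y 1 sqr_pos (2 * Num.max 0 y).
Proof.
apply: is_derive_cvg => e e0; near=> h.
have he : `|h| <= e by apply/ltW; near: h; exact: near0_norm_lt.
rewrite [h *: 1]mulr1 /sqr_pos.
apply: (@le_trans _ _ (`|h| * `|h|)); last by rewrite ler_wpM2r.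
rewrite -normrM (ger0_norm (sqr_ge0 h)) ler_norml.
by case: (leP 0 (h + y)); case: (leP 0 y) => A B; apply/andP; split; nra.
Unshelve. all: by end_near. Qed.

Lemma continuous_sqr_pos_derive (y : R) : {for y, continuous (fun y : R => 2 * Num.max 0 y)}.
Proof.
apply: for_continuousM; first exact: cst_continuous.
apply: (@continuous_max _ _ (cst 0) id); [exact: cst_continuous|exact: id].
Qed.

(** The product over the coordinates of [(1 - ((x_i - c_i) / r)^2)_+^2], written with sums and
    products alone so that the closure properties of [C1_on] apply to it as it stands. *)
Definition bump (c : 'rV[R]_d) (r : R) (x : 'rV[R]_d) : R :=
  \prod_i sqr_pos (1 + - 1 * (((x 0 i + - c 0 i) * r^-1) * ((x 0 i + - c 0 i) * r^-1))).

Lemma C1_on_prod (U : set 'rV[R]_d) (I : finType) (f : I -> 'rV[R]_d -> R) : open U ->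
  (forall i, C1_on U (f i)) -> C1_on U (fun x => \prod_i f i x).
Proof.
move=> oU Hf; elim: (index_enum _) => [|i s IHs].
  rewrite (_ : (fun _ => _) = cst 1); first exact: C1_on_cst.
  by apply/funext => x; rewrite big_nil.
rewrite (_ : (fun _ => _) = (fun x => f i x * \prod_(i <- s) f i x)).
  exact: (C1_onM oU (Hf i) IHs).
by apply/funext => x; rewrite big_cons.
Qed.

Lemma C1_bump c r : C1_on setT (bump c r).
Proof.
apply: C1_on_prod => [|i]; first exact: openT.
have oT : open [set: 'rV[R]_d] by exact: openT.
have cc k : C1_on setT (fun _ : 'rV[R]_d => k : R) by exact: C1_on_cst.
have H : C1_on setT (fun x : 'rV[R]_d => (x 0 i + - c 0 i) * r^-1).
  exact: (C1_onM oT (C1_onD oT (C1_on_coord _ oT) (cc _)) (cc _)).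
apply: (@C1_on_comp _ _ _ (fun x => 1 + -1 * ((x 0 i - c 0 i) / r * ((x 0 i - c 0 i) / r)))
  sqr_pos (fun y => 2 * Num.max 0 y)) => //.
- exact: (C1_onD oT (cc 1) (C1_onM oT (cc (-1)) (C1_onM oT H H))).
- by move=> x _; exact: is_derive_sqr_pos.
- by move=> x _; exact: continuous_sqr_pos_derive.
Qed.

Lemma sqr_pos_ge0 y : 0 <= sqr_pos y. Proof. exact: sqr_ge0. Qed.

Lemma bump_ge0_le1 c r x : 0 <= bump c r x <= 1.
Proof.
apply/andP; split; first by apply: prodr_ge0 => i _; exact: sqr_pos_ge0.
apply: prodr_ile1 => i _; rewrite sqr_pos_ge0 /sqr_pos expr_le1//; last by rewrite le_max lexx.
rewrite ge_max ler01 /= mulN1r lerBlDr lerDl -expr2; exact: sqr_ge0.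
Qed.

Lemma bump_eq0 c r x : 0 < r -> ~ closed_cube c r x -> bump c r x = 0.
Proof.
move=> r0 /existsNP[i /negP]; rewrite -ltNge => xi.
apply/eqP; apply/prodf_eq0; exists i => //.
rewrite /sqr_pos max_l ?expr0n// mulN1r subr_le0 -expr2 -real_normK ?num_real// normrM normfV (gtr0_norm r0).
by rewrite exprn_ege1// ler_pdivlMr// mul1r ltW.
Qed.

Lemma bump_gt0 c r x : open_cube c r x -> 0 < bump c r x.
Proof.
move=> Hx; apply: prodr_gt0 => i _; have xi := Hx i.
have r0 : 0 < r by apply: le_lt_trans xi.
rewrite /sqr_pos exprn_gt0// lt_max mulN1r subr_gt0 -expr2 -real_normK ?num_real// normrM normfV (gtr0_norm r0).
rewrite ltxx /= exprn_ilt1// ?ltr_pdivrMr ?mul1r//.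
by rewrite mulr_ge0// invr_ge0 ltW.
Qed.

Lemma compact_closed_cube (c : 'rV[R]_d) r : compact (closed_cube c r).
Proof.
rewrite (_ : closed_cube c r = [set v : 'rV[R]_d | forall i, `[(c 0 i - r), (c 0 i + r)]%classic (v 0 i)]).
  by apply: (@rV_compact _ _ (fun i => `[(c 0 i - r), (c 0 i + r)]%classic)) => i; exact: segment_compact.
by apply/seteqP; split=> y H i; have := H i; rewrite /= in_itv /= ler_distl.
Qed.

Definition is_cutoff f := C1_compact_support Omega f /\ forall x, 0 <= f x <= 1.

Lemma is_cutoff0 : is_cutoff (cst 0).
Proof.
split; last by move=> x; rewrite /= lexx ler01.
split; first exact: (C1_on_cst _ openT).
by exists set0; split => //; exact: compact0.
Qed.

(** This combination is a smooth substitute for the maximum: it is 0 where both functions are 0, it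
    stays in [[0, 1]], and it keeps the regularity that [Num.max] would lose. *)
Lemma is_cutoff_join f g : is_cutoff f -> is_cutoff g ->
  is_cutoff (fun x => 1 - (1 - f x) * (1 - g x)).
Proof.
move=> [[f1 [K [cK KO f0]]] fb] [[g1 [L [cL LO g0]]] gb]; split; last first.
  move=> x; have /andP[a b] := fb x; have /andP[a' b'] := gb x.
  by apply/andP; split; nra.
split.
  rewrite (_ : (fun _ => _) = (fun x => f x + (g x + -1 * (f x * g x)))).
    have oT : open [set: 'rV[R]_d] by exact: openT.
    have cc : C1_on setT (fun _ : 'rV[R]_d => -1 : R) by exact: C1_on_cst.
    exact: (C1_onD oT f1 (C1_onD oT g1 (C1_onM oT cc (C1_onM oT f1 g1)))).
  by apply/funext => x; ring.
exists (K `|` L); split; first exact: compactU.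
  by move=> x [/KO|/LO].
by move=> x /not_orP[Kx Lx]; rewrite f0// g0//; ring.
Qed.

(* [chi_k = 1 - prod_(j < k) (1 - b_j)^k], where [b_j] are the bumps of the rational cubes in Omega. *)
Lemma cutoff_sequence : exists chi : nat -> 'rV[R]_d -> R,
  (forall k, is_cutoff (chi k)) /\ forall x, Omega x -> chi k x @[k --> \oo] --> (1 : R).
Proof.
(* Codes that decode to no cube, or to a cube whose closure leaves Omega, contribute the zero
   function. *)
pose b (j : nat) x : R := if unpickle j is Some q then
  if `[< closed_cube (rat_center q) (rat_radius q) `<=` Omega >]
  then bump (rat_center q) (rat_radius q) x else 0 else 0.
have Hb j : is_cutoff (b j).
  rewrite /b; case: (unpickle j) => [q|]; last exact: is_cutoff0.
  case: asboolP => HqO; last exact: is_cutoff0.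
  split; last by move=> x; exact: bump_ge0_le1.
  split; first exact: C1_bump.
  exists (closed_cube (rat_center q) (rat_radius q)); split => //.
    exact: compact_closed_cube.
  by move=> x; apply: bump_eq0; exact: rat_radius_gt0.
have Hpow f m : is_cutoff f -> is_cutoff (fun x => 1 - (1 - f x) ^+ m).
  move=> Hf; elim: m => [|m IHm].
    rewrite (_ : (fun _ => _) = cst 0); first exact: is_cutoff0.
    by apply/funext => x; rewrite expr0 subrr.
  rewrite (_ : (fun _ => _) = (fun x => 1 - (1 - f x) * (1 - (1 - (1 - f x) ^+ m)))).
    exact: is_cutoff_join.
  by apply/funext => x; rewrite exprS; ring.
have Hprod n m : is_cutoff (fun x => 1 - \prod_(j < n) (1 - b j x) ^+ m).
  elim: n => [|n IHn].
    rewrite (_ : (fun _ => _) = cst 0); first exact: is_cutoff0.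
    by apply/funext => x; rewrite big_ord0 subrr.
  rewrite (_ : (fun _ => _) = (fun x => 1 - (1 - (1 - \prod_(j < n) (1 - b j x) ^+ m)) *
     (1 - (1 - (1 - b n x) ^+ m)))).
    by apply: is_cutoff_join => //; exact: Hpow.
  by apply/funext => x; rewrite big_ord_recr /=; ring.
exists (fun k x => 1 - \prod_(j < k) (1 - b j x) ^+ k); split => // x Ox.
have [q [xq qO]] := rat_cube_open Omega_open Ox.
pose a := bump (rat_center q) (rat_radius q) x.
have a0 : 0 < a by exact: bump_gt0.
have a1 : a <= 1 by have /andP[] := bump_ge0_le1 (rat_center q) (rat_radius q) x.
rewrite -[X in _ --> X]subr0; apply: cvgB; first exact: cvg_cst.
(* Once [k] exceeds the index of a cube containing [x], one factor equals [(1 - a)^k] and the others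
   are at most 1. *)
apply: (@squeeze_cvgr _ _ _ _ (cst 0) (fun k => (1 - a) ^+ k)); last first.
- by apply: cvg_expr; rewrite ger0_norm ?subr_ge0// ltrBlDr ltrDl.
- exact: cvg_cst.
near=> k.
have kq : (pickle q < k)%N by near: k; exact: nbhs_infty_gt.
have bb (j : nat) : 0 <= 1 - b j x <= 1.
  have [_ /(_ x)/andP[b0 b1]] := Hb j.
  by rewrite subr_ge0 b1 /= lerBlDr lerDl.
apply/andP; split.
  by apply: prodr_ge0 => j _; rewrite exprn_ge0//; have /andP[] := bb j.
rewrite (bigD1 (Ordinal kq))//= [X in (1 - X) ^+ _ * _](_ : _ = a); last first.
  by rewrite /b pickleK asboolT.
rewrite ler_piMr ?exprn_ge0 ?subr_ge0//.
apply: prodr_ile1 => j _; have /andP[b0 b1] := bb j.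
by rewrite exprn_ge0// exprn_ile1.
Unshelve. all: by end_near. Qed.

End cutoff.

(** * The Fisher information in terms of classical gradients *)

Section energy.
Context {R : realType} {d : nat} {Omega : set 'rV[R]_d} {F : 'rV[R]_d -> R}.
Hypothesis Omega_open : open Omega.
Hypothesis lty_compact : forall K, compact K -> K `<=` Omega -> (lebesgue_rV R d K < +oo)%E.
Context {n : 'rV[R]_d -> 'rV[R]_d} {sigma : {measure set 'rV[R]_d -> \bar R}}.
Hypothesis sigma_surface : surface_measure Omega n sigma.
Hypothesis F1 : C1_on Omega F.
Implicit Types (s : 'rV[R]_d -> R) (G : 'rV[R]_d -> 'rV[R]_d).
Local Notation gi := (gintegrable Omega F).
Local Notation gint := (gint Omega F).
Local Notation rint := (gint_fin Omega F).

Lemma C1_weight : C1_on Omega (fun x => expR (- F x)).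
Proof.
apply: (@C1_on_comp _ _ _ F (fun y => expR (- y)) (fun y => expR (- y) * -1)) => //.
move=> x _; apply: for_continuousM; last exact: cst_continuous.
  by apply: for_continuous_comp; [exact: opp_continuous|exact: continuous_expR].
Qed.

(** Weak gradients are defined with Lebesgue measure. The test function [chi e^{-F} pd i s] carries
    the weight, so comparing [G] with the classical gradient becomes an identity between integrals
    in gamma. *)
Lemma weak_grad_test s G chi i : C1_on Omega s -> C1_on Omega (pd i s) ->
  weak_grad Omega s G -> is_cutoff (Omega := Omega) chi ->
  [/\ gi (fun x => G x 0 i * (chi x * pd i s x)), gi (fun x => pd i s x * (chi x * pd i s x)) &
     rint (fun x => G x 0 i * (chi x * pd i s x)) = rint (fun x => pd i s x * (chi x * pd i s x))].
Proof.
move=> s1 ds1 [_ LG HG] [[chi1 [K [cK KO chi0]]] _].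
have [_ Ls HS] := weak_grad_classical Omega_open lty_compact sigma_surface s1.
pose phi x := (pd i s x * expR (- F x)) * chi x.
have C1w := C1_onM Omega_open ds1 C1_weight.
have phi1 : C1_on setT phi.
  by apply: (C1_cutoffM Omega_open C1w _ cK KO chi0); exact: C1_on_subset chi1.
have phi0 x : ~ K x -> phi x = 0 by move=> Kx; rewrite /phi chi0 ?mulr0.
have cphi x : Omega x -> {for x, continuous phi}.
  by move=> _; apply: (C1_on_continuous openT phi1).
have phic : C1_compact_support Omega phi by split => //; exists K.
have I1 := integrable_L1_loc_mul Omega_open (LG i) cK KO cphi phi0.
have I2 := integrable_L1_loc_mul Omega_open (Ls i) cK KO cphi phi0.
have E : (\int[lebesgue_rV R d]_(x in Omega) (G x 0 i * phi x)%:E =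
          \int[lebesgue_rV R d]_(x in Omega) (grad s x 0 i * phi x)%:E)%E.
  by rewrite -[LHS]oppeK -(HG i _ phic) (HS i _ phic) oppeK.
have mO := measurable_open Omega_open.
have E1 x : G x 0 i * phi x = G x 0 i * (chi x * pd i s x) * expR (- F x) by rewrite /phi; ring.
have E2 x : grad s x 0 i * phi x = pd i s x * (chi x * pd i s x) * expR (- F x).
  by rewrite /phi mxE; ring.
split.
- by move: I1; apply: eq_integrable => // x _; rewrite E1.
- by move: I2; apply: eq_integrable => // x _; rewrite E2.
- rewrite /gint_fin /Defs.gint; congr fine.
  transitivity (\int[lebesgue_rV R d]_(x in Omega) (grad s x 0 i * phi x)%:E)%E.
    by rewrite -E; apply: eq_integral => x _; rewrite E1.
  by apply: eq_integral => x _; rewrite E2.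
Qed.

(* Integrate [|G|^2 >= 2 (G, X) - |X|^2] with [X = chi Ds], [chi] a cutoff. *)
Lemma weak_grad_energy s G : C1_on Omega s -> (forall i, C1_on Omega (pd i s)) ->
  gi (fun x => dot (grad s x) (grad s x)) -> weak_grad Omega s G ->
  (gint (fun x => dot (grad s x) (grad s x)) <= gint (fun x => dot (G x) (G x)))%E.
Proof.
move=> s1 ds1 Is HG; have mO := measurable_open Omega_open.
have mF : measurable_fun Omega F.
  by apply: (continuous_open_measurable Omega_open) => x; exact: (C1_on_continuous Omega_open F1).
have mG i : measurable_fun Omega (fun x => G x 0 i) by have [_ /(_ i)[]] := HG.
have mGG : measurable_fun Omega (fun x => dot (G x) (G x)).
  by apply: measurable_sum => i; exact: measurable_funM.
have mds i : measurable_fun Omega (pd i s).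
  by apply: (continuous_open_measurable Omega_open) => x; exact: (C1_on_continuous Omega_open (ds1 i)).
have [chi [Hchi chi_cvg]] := cutoff_sequence Omega_open.
have mchi k : measurable_fun Omega (chi k).
  have [[c1 _] _] := Hchi k.
  by apply: continuous_open_measurable => // x _; apply: (C1_on_continuous openT c1).
have dotE x : dot (grad s x) (grad s x) = \sum_i pd i s x * pd i s x.
  by apply: eq_bigr => i _; rewrite mxE.
have Ichi k : gi (fun x => chi k x * dot (grad s x) (grad s x)).
  apply: (gi_le mO mF _ _ Is).
    apply: measurable_funM => //; exact: (gi_measurable mF Is).
  move=> x _; have [_ /(_ x)/andP[a b]] := Hchi k.
  have D0 : 0 <= dot (grad s x) (grad s x) by apply: sumr_ge0 => i _; rewrite -expr2 sqr_ge0.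
  by rewrite normrM (ger0_norm a) (ger0_norm D0) ler_piMl.
have lower k : ((rint (fun x => chi k x * dot (grad s x) (grad s x)))%:E <= gint (fun x => dot (G x) (G x)))%E.
  have T i := weak_grad_test s1 (ds1 i) HG (Hchi k).
  have I2 i : gi (fun x => (chi k x * pd i s x) * (chi k x * pd i s x)).
    have [_ I _] := T i; apply: (gi_le mO mF _ _ I).
      by apply: measurable_funM; apply: measurable_funM.
    move=> x _; have [_ /(_ x)/andP[a b]] := Hchi k.
    rewrite ger0_norm; last by rewrite -expr2 sqr_ge0.
    rewrite -subr_ge0 (_ : _ - _ = (chi k x * (1 - chi k x)) * pd i s x ^+ 2); last by ring.
    by rewrite mulr_ge0 ?sqr_ge0// mulr_ge0// subr_ge0.
  have I3 : gi (fun x => \sum_i (2 * (G x 0 i * (chi k x * pd i s x)) - (chi k x * pd i s x) * (chi k x * pd i s x))).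
    apply: (gi_sum mO) => i; have [I1 _ _] := T i.
    exact: (giB mO (giZ mO 2 I1) (I2 i)).
  have I3' i : gi (fun x => 2 * (G x 0 i * (chi k x * pd i s x)) - (chi k x * pd i s x) * (chi k x * pd i s x)).
    have [I1 _ _] := T i; exact: (giB mO (giZ mO 2 I1) (I2 i)).
  apply: (@le_trans _ _ (rint (fun x => \sum_i (2 * (G x 0 i * (chi k x * pd i s x)) - (chi k x * pd i s x) * (chi k x * pd i s x))))%:E).
    rewrite lee_fin.
    rewrite (rint_sum mO I3').
    have -> : \sum_i rint (fun x => 2 * (G x 0 i * (chi k x * pd i s x)) - (chi k x * pd i s x) * (chi k x * pd i s x))
       = \sum_i rint (fun x => 2 * (pd i s x * (chi k x * pd i s x)) - (chi k x * pd i s x) * (chi k x * pd i s x)).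
      apply: eq_bigr => i _; have [I1 I1' E] := T i.
      rewrite (rintB mO (giZ mO 2 I1) (I2 i)) (rintB mO (giZ mO 2 I1') (I2 i)).
      by rewrite (rintZ mO 2 I1) (rintZ mO 2 I1') E.
    have I4 i : gi (fun x => 2 * (pd i s x * (chi k x * pd i s x)) - (chi k x * pd i s x) * (chi k x * pd i s x)).
      have [_ I1 _] := T i; exact: (giB mO (giZ mO 2 I1) (I2 i)).
    rewrite -(rint_sum mO I4); apply: (rint_le mO (Ichi k) (gi_sum mO I4)) => x _.
    rewrite dotE mulr_sumr; apply: ler_sum => i _.
    have [_ /(_ x)/andP[a b]] := Hchi k.
    (* Since [0 <= chi <= 1], one has [2 chi - chi^2 >= chi]. *)
    have -> : 2 * (pd i s x * (chi k x * pd i s x)) - chi k x * pd i s x * (chi k x * pd i s x) =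
      chi k x * (pd i s x * pd i s x) + (chi k x * (1 - chi k x)) * (pd i s x * pd i s x) by ring.
    by rewrite lerDl -expr2 mulr_ge0 ?sqr_ge0// mulr_ge0// subr_ge0.
  apply: (gint_ge mO mF I3 mGG).
    by move=> x _; apply: sumr_ge0 => i _; rewrite -expr2 sqr_ge0.
  move=> x _; apply: ler_sum => i _; rewrite -subr_ge0.
  have -> : G x 0 i * G x 0 i - (2 * (G x 0 i * (chi k x * pd i s x)) - chi k x * pd i s x * (chi k x * pd i s x))
    = (G x 0 i - chi k x * pd i s x) ^+ 2 by ring.
  exact: sqr_ge0.
rewrite (gintE mO Is).
have L : rint (fun x => chi k x * dot (grad s x) (grad s x)) @[k --> \oo] --> rint (fun x => dot (grad s x) (grad s x)).
  apply: (rint_dominated mO mF _ _ Is).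
  - move=> k; exact: (gi_measurable mF (Ichi k)).
  - exact: (gi_measurable mF Is).
  - move=> x Ox; rewrite -[X in _ --> X]mul1r; apply: cvgM; [exact: chi_cvg|exact: cvg_cst].
  - move=> k x _; have [_ /(_ x)/andP[a b]] := Hchi k.
    have D0 : 0 <= dot (grad s x) (grad s x) by apply: sumr_ge0 => i _; rewrite -expr2 sqr_ge0.
    by rewrite normrM (ger0_norm a) (ger0_norm D0) ler_piMl.
have G0 : (0 <= gint (fun x => dot (G x) (G x)))%E.
  apply: integral_ge0 => x _; rewrite lee_fin mulr_ge0 ?expR_ge0//.
  by apply: sumr_ge0 => i _; rewrite -expr2 sqr_ge0.
move: lower G0; case: (gint (fun x => dot (G x) (G x))) => [r| |] lower G0.
- rewrite lee_fin -(cvg_lim _ L)//; apply: limr_le.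
    by apply/cvg_ex; eexists; exact: L.
  by near=> k; rewrite -lee_fin; exact: lower.
- exact: leey.
- by move: G0; rewrite leeNy_eq.
Unshelve. all: by end_near. Qed.

(** The classical gradient is a competitor in the infimum, and [weak_grad_energy] says that no
    competitor has less energy; comparing energies takes the place of the uniqueness of weak
    gradients. *)
Lemma fisher_classical p w : 0 < p -> C1_on Omega (fun x => w x `^ (p / 2)) ->
  (forall i, C1_on Omega (pd i (fun x => w x `^ (p / 2)))) ->
  gi (fun x => dot (grad (fun x => w x `^ (p / 2)) x) (grad (fun x => w x `^ (p / 2)) x)) ->
  fisher Omega F p w = (4 / p * rint (fun x => dot (grad (fun x => w x `^ (p / 2)) x) (grad (fun x => w x `^ (p / 2)) x)))%:E.
Proof.
move=> p0 s1 ds1 Is; have mO := measurable_open Omega_open.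
rewrite EFinM -(gintE mO Is); apply/eqP; rewrite eq_le; apply/andP; split.
  apply: ereal_inf_lbound; exists (grad (fun x => w x `^ (p / 2))); split => //.
  exact: (weak_grad_classical Omega_open lty_compact sigma_surface s1).
apply: le_ereal_inf_tmp => _ [G [HG ->]].
apply: lee_wpmul2l; last exact: weak_grad_energy.
by rewrite lee_fin divr_ge0// ltW.
Qed.

End energy.

(** * Regularity up to the boundary *)

Section Ck_bar_theory.
Context {R : realType} {d : nat} {Omega : set 'rV[R]_d}.
Hypothesis Omega_open : open Omega.
Implicit Types (f g : 'rV[R]_d -> R) (x : 'rV[R]_d).

Lemma within_closure_proper x : closure Omega x -> ProperFilter (within Omega (nbhs x)).
Proof. by move=> cx; exact: within_nbhs_proper. Qed.

Lemma within_open x : Omega x -> within Omega (nbhs x) = nbhs x.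
Proof. by move=> Ox; apply: within_interior; move: Omega_open; rewrite openE; exact. Qed.

Lemma trace_eq f x (l : R) : closure Omega x -> f @ within Omega (nbhs x) --> l -> trace Omega f x = l.
Proof.
by move=> cx fl; have FF := within_closure_proper cx; apply: cvg_lim fl.
Qed.

(** At an interior point the filter is [nbhs x], which is not punctured: a limit along it can only
    be [f x]. *)
Lemma continuous_bar_continuous f x : continuous_bar Omega f -> Omega x -> {for x, continuous f}.
Proof.
move=> cf Ox; have := cf x (subset_closure Ox).
rewrite (within_open Ox) => fl.
suff E : lim (f @ x) = f x by move: fl; rewrite E.
apply: contrapT => /eqP ne.
have e0 : 0 < `|lim (f @ x) - f x| by rewrite normr_gt0 subr_eq0.
have FF : Filter (nbhs x) := nbhs_filter x.
have /cvgrPdist_lt/(_ _ e0)/nbhs_singleton := fl.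
by rewrite ltxx.
Qed.

Lemma trace_interior f x : Omega x -> {for x, continuous f} -> trace Omega f x = f x.
Proof.
move=> Ox cf; apply: trace_eq; first exact: subset_closure.
by rewrite (within_open Ox).
Qed.

Lemma near_within f g x : (forall y, Omega y -> f y = g y) ->
  f @ within Omega (nbhs x) --> g @ within Omega (nbhs x).
Proof.
move=> fg P; rewrite /nbhs /= /within /=; apply: filterS => y H Oy.
by rewrite fg//; exact: H.
Qed.

Lemma continuous_bar_ext f g : (forall y, Omega y -> f y = g y) ->
  continuous_bar Omega f -> continuous_bar Omega g.
Proof.
move=> fg cf x cx; apply/cvg_ex; exists (trace Omega f x).
apply: cvg_trans (cf x cx); apply: near_within => y Oy; exact/esym/fg.
Qed.

Lemma near_open f g x : (forall y, Omega y -> f y = g y) -> Omega x -> \forall y \near x, f y = g y.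
Proof. by move=> fg Ox; apply: filterS (open_near Omega_open Ox). Qed.

Lemma pd_ext f g i x : (forall y, Omega y -> f y = g y) -> Omega x -> pd i f x = pd i g x.
Proof. by move=> fg Ox; apply: near_eq_derive; exact: near_open. Qed.

Lemma derivable_ext f g v x : (forall y, Omega y -> f y = g y) -> Omega x ->
  derivable f x v -> derivable g x v.
Proof. by move=> fg Ox; apply: near_eq_derivable; exact: near_open. Qed.

Lemma Ck_bar_ext k f g : (forall y, Omega y -> f y = g y) -> Ck_bar k Omega f -> Ck_bar k Omega g.
Proof.
elim: k f g => [|k IHk] f g fg /= [cf Hf]; split; try exact: continuous_bar_ext cf; try by [].
move=> i; have [D1 D2] := Hf i; split.
  by move=> x Ox; apply: derivable_ext (D1 x Ox).
by apply: IHk D2 => y Oy; exact: pd_ext.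
Qed.

Lemma Ck_bar0 k f : Ck_bar k Omega f -> continuous_bar Omega f.
Proof. by case: k => [|k] []. Qed.

Lemma Ck_bar_pd k f i : Ck_bar k.+1 Omega f -> Ck_bar k Omega (pd i f).
Proof. by move=> [_ /(_ i)[]]. Qed.

Lemma Ck_bar_derive k f i x : Ck_bar k.+1 Omega f -> Omega x -> is_derive x (delta_mx 0 i) f (pd i f x).
Proof. by move=> [_ /(_ i)[H _]] Ox; exact/is_derive_pd/H. Qed.

Lemma Ck_bar_pred k f : Ck_bar k.+1 Omega f -> Ck_bar k Omega f.
Proof.
elim: k f => [|k IHk] f; first by move=> [cf _]; split.
move=> [cf Hf]; split => // i; have [D1 D2] := Hf i; split => //.
exact: IHk.
Qed.

Lemma Ck_bar_le k l f : (k <= l)%N -> Ck_bar l Omega f -> Ck_bar k Omega f.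
Proof.
move=> kl; rewrite -(subnK kl); elim: (l - k)%N => [//|m IHm].
by rewrite addSn => /Ck_bar_pred.
Qed.

Lemma Ck_bar_continuous k f x : Ck_bar k Omega f -> Omega x -> {for x, continuous f}.
Proof. by move=> /Ck_bar0; exact: continuous_bar_continuous. Qed.

Lemma Ck_bar_C1 k f : Ck_bar k.+1 Omega f -> C1_on Omega f.
Proof.
move=> Hf i x Ox; split; first by have [] := Ck_bar_derive i Hf Ox.
exact: (Ck_bar_continuous (Ck_bar_pd i Hf)).
Qed.

Lemma Ck_bar_intro k f (df : 'I_d -> 'rV[R]_d -> R) : continuous_bar Omega f ->
  (forall i x, Omega x -> is_derive x (delta_mx 0 i) f (df i x)) ->
  (forall i, Ck_bar k Omega (df i)) -> Ck_bar k.+1 Omega f.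
Proof.
move=> cf D Hdf; split => // i; split; first by move=> x /(D i)[].
by apply: Ck_bar_ext (Hdf i) => y Oy; rewrite (is_derive_pdE (D i y Oy)).
Qed.

Lemma Ck_bar_cst k (c : R) : Ck_bar k Omega (fun=> c).
Proof.
have cc (e : R) : continuous_bar Omega (fun=> e).
  by move=> x cx; apply/cvg_ex; exists e; exact: cvg_cst.
elim: k c => [|k IHk] c; first by split.
by apply: (@Ck_bar_intro _ _ (fun i => fun=> 0)).
Qed.

Lemma continuous_barD f g : continuous_bar Omega f -> continuous_bar Omega g ->
  continuous_bar Omega (fun x => f x + g x).
Proof.
move=> cf cg x cx; have FF := within_closure_proper cx.
apply/cvg_ex; eexists; apply: cvgD; [exact: (cf x cx)|exact: (cg x cx)].
Qed.

Lemma continuous_barM f g : continuous_bar Omega f -> continuous_bar Omega g ->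
  continuous_bar Omega (fun x => f x * g x).
Proof.
move=> cf cg x cx; have FF := within_closure_proper cx.
apply/cvg_ex; eexists; apply: cvgM; [exact: (cf x cx)|exact: (cg x cx)].
Qed.

Lemma Ck_barD k f g : Ck_bar k Omega f -> Ck_bar k Omega g -> Ck_bar k Omega (fun x => f x + g x).
Proof.
elim: k f g => [|k IHk] f g Hf Hg.
  by split => //; apply: continuous_barD; [exact: Ck_bar0 Hf|exact: Ck_bar0 Hg].
apply: (@Ck_bar_intro _ _ (fun i x => pd i f x + pd i g x)).
- by apply: continuous_barD; [exact: Ck_bar0 Hf|exact: Ck_bar0 Hg].
- move=> i x Ox; have := Ck_bar_derive i Hf Ox; have := Ck_bar_derive i Hg Ox => ? ?.
  exact: is_deriveD.
- by move=> i; apply: IHk; exact: Ck_bar_pd.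
Qed.

Lemma Ck_barM k f g : Ck_bar k Omega f -> Ck_bar k Omega g -> Ck_bar k Omega (fun x => f x * g x).
Proof.
elim: k f g => [|k IHk] f g Hf Hg.
  by split => //; apply: continuous_barM; [exact: Ck_bar0 Hf|exact: Ck_bar0 Hg].
apply: (@Ck_bar_intro _ _ (fun i x => f x * pd i g x + g x * pd i f x)).
- by apply: continuous_barM; [exact: Ck_bar0 Hf|exact: Ck_bar0 Hg].
- move=> i x Ox; have := Ck_bar_derive i Hf Ox; have := Ck_bar_derive i Hg Ox => ? ?.
  exact: is_deriveM.
- move=> i; apply: Ck_barD; apply: IHk; try exact: Ck_bar_pd; exact: Ck_bar_pred.
Qed.

Lemma Ck_barZ k c f : Ck_bar k Omega f -> Ck_bar k Omega (fun x => c * f x).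
Proof. by apply: Ck_barM; exact: Ck_bar_cst. Qed.

Lemma Ck_barN k f : Ck_bar k Omega f -> Ck_bar k Omega (fun x => - f x).
Proof. by move=> /(Ck_barZ (-1)); apply: Ck_bar_ext => y _; rewrite mulN1r. Qed.

Lemma Ck_barB k f g : Ck_bar k Omega f -> Ck_bar k Omega g -> Ck_bar k Omega (fun x => f x - g x).
Proof. by move=> Hf Hg; apply: Ck_barD => //; exact: Ck_barN. Qed.

Lemma Ck_bar_sum k n (f : 'I_n -> 'rV[R]_d -> R) : (forall i, Ck_bar k Omega (f i)) ->
  Ck_bar k Omega (fun x => \sum_i f i x).
Proof.
move=> Hf; elim: (index_enum _) => [|i s IHs].
  by apply: Ck_bar_ext (Ck_bar_cst k 0) => y _; rewrite big_nil.
by apply: Ck_bar_ext (Ck_barD (Hf i) IHs) => y _; rewrite big_cons.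
Qed.

(** Positivity of the traces keeps the closure away from the singularity of real powers at 0, so
    that powers of [f] remain regular up to the boundary. *)
Definition bar_pos f := (forall x, Omega x -> 0 < f x) /\ (forall x, boundary Omega x -> 0 < trace Omega f x).

Lemma bar_pos_trace f x : continuous_bar Omega f -> bar_pos f -> closure Omega x -> 0 < trace Omega f x.
Proof.
move=> cf [f1 f2] cx; have [Ox|nOx] := pselect (Omega x); last exact: f2.
by rewrite trace_interior//; [exact: f1|exact: continuous_bar_continuous].
Qed.

Lemma is_derive_powR (a x : R) : 0 < x -> is_derive x 1 (fun y : R => y `^ a) (a * x `^ (a - 1)).
Proof. by move=> x0; exact: is_derive1_powR. Qed.

Lemma continuous_powR (a x : R) : 0 < x -> {for x, continuous (fun y : R => y `^ a)}.
Proof.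
move=> x0; apply: differentiable_continuous; apply/derivable1_diffP.
by have [] := is_derive_powR a x0.
Qed.

Lemma cvg_trace_comp f (h : R -> R) x : cvg (f @ within Omega (nbhs x)) ->
  {for trace Omega f x, continuous h} ->
  (fun y => h (f y)) @ within Omega (nbhs x) --> h (trace Omega f x).
Proof. by move=> cf ch; exact: (cvg_comp f h cf ch). Qed.

Lemma continuous_bar_pow a f : continuous_bar Omega f -> bar_pos f ->
  continuous_bar Omega (fun x => f x `^ a).
Proof.
move=> cf pf x cx; apply/cvg_ex; exists (trace Omega f x `^ a).
apply: (@cvg_trace_comp _ (fun y : R => y `^ a)); first exact: cf.
by apply: continuous_powR; exact: bar_pos_trace.
Qed.

Lemma pow_derive a f k i x : Ck_bar k.+1 Omega f -> bar_pos f -> Omega x ->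
  is_derive x (delta_mx 0 i) (fun x => f x `^ a) (a * f x `^ (a - 1) * pd i f x).
Proof.
move=> Hf [pf _] Ox.
exact: (is_derive_comp_real (Ck_bar_derive i Hf Ox) (is_derive_powR a (pf x Ox))).
Qed.

Lemma Ck_bar_pow k a f : Ck_bar k Omega f -> bar_pos f -> Ck_bar k Omega (fun x => f x `^ a).
Proof.
elim: k a => [|k IHk] a Hf pf.
  by split => //; apply: continuous_bar_pow => //; exact: Ck_bar0 Hf.
apply: (@Ck_bar_intro _ _ (fun i x => a * f x `^ (a - 1) * pd i f x)).
- by apply: continuous_bar_pow => //; exact: Ck_bar0 Hf.
- by move=> i x Ox; exact: pow_derive Hf pf Ox.
- move=> i; apply: Ck_barM; last exact: Ck_bar_pd.
  by apply: Ck_barZ; apply: IHk => //; exact: Ck_bar_pred.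
Qed.

Lemma bar_pos_pow a f : continuous_bar Omega f -> bar_pos f -> bar_pos (fun x => f x `^ a).
Proof.
move=> cf pf; split=> x Hx; first by rewrite powR_gt0//; apply: pf.1.
have cx : closure Omega x by case: Hx.
have -> : trace Omega (fun x => f x `^ a) x = trace Omega f x `^ a.
  apply: trace_eq => //; apply: (@cvg_trace_comp _ (fun y : R => y `^ a)); first exact: cf.
  by apply: continuous_powR; exact: bar_pos_trace.
by rewrite powR_gt0//; apply: pf.2.
Qed.

(** Schwarz's theorem, from [mixed_derivative] applied to [f] on the affine plane through [x]
    parametrized by [P]. *)
Lemma pd_pdC f i j x : Ck_bar 2 Omega f -> Omega x -> pd i (pd j f) x = pd j (pd i f) x.
Proof.
move=> Hf Ox.
pose P (z : R * R) := z.1 *: delta_mx 0 i + (z.2 *: delta_mx 0 j + x) : 'rV[R]_d.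
have cP : {for (0, 0) : R * R, continuous P}.
  apply: cvgD; first by apply: cvgZr_tmp; exact: cvg_fst.
  by apply: cvgD; [apply: cvgZr_tmp; exact: cvg_snd|exact: cvg_cst].
have P0 : P (0, 0) = x by rewrite /P /= !scale0r !add0r.
have nO : \forall z \near ((0, 0) : R * R), Omega (P z).
  by apply: cP; rewrite P0; exact: open_near.
have := @mixed_derivative R (fun a b => f (P (a, b))) (fun a b => pd i f (P (a, b)))
  (fun a b => pd j f (P (a, b))) (fun a b => pd i (pd j f) (P (a, b))) 0 0.
have Pj a b : P (a, b) = b *: delta_mx 0 j + (a *: delta_mx 0 i + x) by rewrite /P /= addrCA.
move=> H.
have {}H : is_derive (0 : R) 1 (fun b => pd i f (P (0, b))) (pd i (pd j f) (P (0, 0))).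
  apply: H.
  - apply: filterS nO => -[a b] /= OP; apply/(is_derive_line f (b *: delta_mx 0 j + x) (delta_mx 0 i) a).
    exact: Ck_bar_derive Hf OP.
  - apply: filterS nO => -[a b] /= OP.
    have -> : (fun b => f (P (a, b))) = (fun b => f (b *: delta_mx 0 j + (a *: delta_mx 0 i + x))).
      by apply/funext => b'; rewrite Pj.
    apply/(is_derive_line f (a *: delta_mx 0 i + x) (delta_mx 0 j) b); rewrite -Pj.
    exact: Ck_bar_derive Hf OP.
  - apply: filterS nO => -[a b] /= OP.
    apply/(is_derive_line (pd j f) (b *: delta_mx 0 j + x) (delta_mx 0 i) a).
    exact: Ck_bar_derive (Ck_bar_pd j Hf) OP.
  - have cc := Ck_bar_continuous (Ck_bar_pd i (Ck_bar_pd j Hf)) Ox.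
    rewrite -P0 in cc.
    rewrite (_ : (fun z => _) = (fun z => pd i (pd j f) (P z))); last by apply/funext => -[].
    exact: (for_continuous_comp cP cc).
rewrite P0 in H; symmetry; apply: is_derive_pdE.
have /(is_derive_line (pd i f) x (delta_mx 0 j) 0) : is_derive (0 : R) 1 (fun b => pd i f (b *: delta_mx 0 j + x)) (pd i (pd j f) x).
  move: H; rewrite (_ : (fun b => pd i f (P (0, b))) = (fun b => pd i f (b *: delta_mx 0 j + x)))//.
  by apply/funext => b; rewrite /P /= scale0r add0r.
by rewrite scale0r add0r.
Qed.

End Ck_bar_theory.

(** * Exchange of time and space derivatives *)

Section evolution.
Context {R : realType} {d : nat} {Omega : set 'rV[R]_d}.
Hypothesis Omega_open : open Omega.
Implicit Types (u v : R -> 'rV[R]_d -> R) (x : 'rV[R]_d).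

Lemma Ck_bar_evol_pd k u i : Ck_bar_evol Omega k.+1 u -> Ck_bar_evol Omega k (fun t => pd i (u t)).
Proof. by move=> [_ /(_ i)[]]. Qed.

Lemma Ck_bar_evol_slice k u t : Ck_bar_evol Omega k u -> 0 < t -> Ck_bar k Omega (u t).
Proof.
have c0 w : (forall (t : R) x, 0 < t -> closure Omega x ->
    cvg ((fun z : R * 'rV[R]_d => w z.1 z.2) @ within [set z | Omega z.2] (nbhs (t, x)))) ->
  0 < t -> continuous_bar Omega (w t).
  move=> H t0 x cx; have /cvg_ex[l Hl] := H t x t0 cx.
  apply/cvg_ex; exists l.
  have -> : w t = (fun z : R * 'rV[R]_d => w z.1 z.2) \o (fun y => (t, y)) by [].
  apply: cvg_comp Hl => A [[B C]] /= [Bt Cx] BC.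
  by apply: filterS Cx => y Cy Oy; apply: (BC (t, y)) => //; split => //; exact: nbhs_singleton Bt.
elim: k u => [|k IHk] u /= [H1 H2] t0; split; try exact: c0; try by [].
move=> i; have [D1 D2] := H2 i; split; first by move=> x; exact: D1.
exact: (IHk (fun t => pd i (u t))).
Qed.

Lemma Ck_bar_evol_continuous k u t x : Ck_bar_evol Omega k u -> 0 < t -> Omega x ->
  {for (t, x), continuous (fun z : R * 'rV[R]_d => u z.1 z.2)}.
Proof.
move=> H t0 Ox.
have cu : cvg ((fun z : R * 'rV[R]_d => u z.1 z.2) @ within [set z | Omega z.2] (nbhs (t, x))).
  by case: k H => [|k] [H _]; apply: H => //; exact: subset_closure.
rewrite within_interior in cu; last first.
  exists (setT, Omega) => /=; last by move=> z [].
  by split; [exact: filterT|exact: open_near].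
have FF : Filter (nbhs (t, x)) := nbhs_filter (t, x).
suff E : lim ((fun z : R * 'rV[R]_d => u z.1 z.2) @ (t, x)) = u t x by move: cu; rewrite E.
apply: contrapT => /eqP ne.
have e0 : 0 < `|lim ((fun z : R * 'rV[R]_d => u z.1 z.2) @ (t, x)) - u t x| by rewrite normr_gt0 subr_eq0.
have /cvgrPdist_lt/(_ _ e0)/nbhs_singleton := cu.
by rewrite ltxx.
Qed.

Lemma is_derive_dt u t x : derivable (fun tau => u tau x) t 1 -> is_derive t 1 (fun tau => u tau x) (dt u t x).
Proof. by move=> H; rewrite /dt derive1E; exact: derivableP. Qed.

(** The time differentiability of [pd i v] is part of the conclusion: [mixed_derivative] produces it
    from the joint continuity of [pd i (dt v)]. *)
Lemma dt_pdC v i (t : R) x : smooth_evol Omega v -> 0 < t -> Omega x ->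
  is_derive t 1 (fun tau => pd i (v tau) x) (pd i (dt v t) x).
Proof.
move=> [v3 vt dv1] t0 Ox.
pose P (a : R) := a *: delta_mx 0 i + x : 'rV[R]_d.
have cP : {for (0, t) : R * R, continuous (fun z : R * R => P z.1)}.
  by apply: cvgD; [apply: cvgZr_tmp; exact: cvg_fst|exact: cvg_cst].
have P0 : P 0 = x by rewrite /P scale0r add0r.
have nO : \forall z \near ((0, t) : R * R), Omega (P z.1) /\ 0 < z.2.
  apply: filterI; first by apply: cP; rewrite /= P0; exact: open_near.
  have : {for (0, t) : R * R, continuous (fun z : R * R => z.2)} by exact: cvg_snd.
  move/(_ [set r : R | 0 < r]); apply; exact: lt_nbhsr.
have := @mixed_derivative R (fun a tau => v tau (P a)) (fun a tau => pd i (v tau) (P a))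
  (fun a tau => dt v tau (P a)) (fun a tau => pd i (dt v tau) (P a)) 0 t.
rewrite P0; apply.
- apply: filterS nO => -[a b] /= [OP b0]; apply/(is_derive_line (v b) x (delta_mx 0 i) a).
  exact: (Ck_bar_derive _ (Ck_bar_evol_slice v3 b0)).
- by apply: filterS nO => -[a b] /= [OP b0]; apply: is_derive_dt; exact: vt.
- apply: filterS nO => -[a b] /= [OP b0]; apply/(is_derive_line (dt v b) x (delta_mx 0 i) a).
  exact: (Ck_bar_derive _ (Ck_bar_evol_slice dv1 b0)).
- have cc := Ck_bar_evol_continuous (Ck_bar_evol_pd i dv1) t0 Ox.
  rewrite -P0 in cc.
  have cQ : {for (0, t) : R * R, continuous (fun z : R * R => (z.2, P z.1))}.
    move=> A [[B C] /= [Bt CP]] BC.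
    have nB : \forall z \near ((0, t) : R * R), B z.2.
      have : {for (0, t) : R * R, continuous (fun z : R * R => z.2)} by exact: cvg_snd.
      by move/(_ B); apply.
    have nC : \forall z \near ((0, t) : R * R), C (P z.1) by exact: cP.
    by apply: filterS2 nB nC => z Bz Cz; apply: BC.
  exact: (@cvg_comp _ _ _ (fun z : R * R => (z.2, P z.1)) (fun z => pd i (dt v z.1) z.2) _ _ _ cQ cc).
Qed.

End evolution.

(** * Convex domains with C1 boundary *)

Section convex_open.
Context {R : realType} {d : nat} {Omega : set 'rV[R]_d}.
Hypotheses (Omega_open : open Omega) (Omega_convex : convex_set Omega).
Implicit Types x y w : 'rV[R]_d.

Lemma convex_comb x y (t : R) : Omega x -> Omega y -> 0 <= t <= 1 -> Omega (t *: x + (1 - t) *: y).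
Proof.
move=> Ox Oy t01.
have /andP[t0 t1] := t01.
have := @Omega_convex x y (Itv01 t0 t1); rewrite !inE => /(_ Ox Oy).
exact.
Qed.

Lemma open_ball x : Omega x -> exists2 r, 0 < r & forall y, `|y - x| < r -> Omega y.
Proof.
move=> Ox; have /nbhs_ballP[r /= r0 H] : nbhs x Omega by exact: open_near.
by exists r => // y yx; apply: H; rewrite -ball_normE /= distrC.
Qed.

Lemma closure_near x (r : R) : closure Omega x -> 0 < r -> exists2 y, Omega y & `|y - x| < r.
Proof.
move=> cx r0; have [y [Oy]] := cx _ (nbhsx_ballx x r r0).
by rewrite -ball_normE /= => H; exists y => //; rewrite distrC.
Qed.

(** The point is a convex combination of some [x'] in Omega close to [x] and of a point so close to
    [y] that it lies in a ball contained in Omega. *)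
Lemma convex_closure_segment x y (t : R) : closure Omega x -> Omega y -> 0 < t <= 1 ->
  Omega (x + t *: (y - x)).
Proof.
move=> cx Oy /andP[t0 t1]; have [r r0 Hr] := open_ball Oy.
have [x' Ox' x'x] := closure_near cx (mulr_gt0 r0 t0).
(* This point is chosen so that its combination with [x'], with weights [t] and [1 - t], is exactly
   [x + t (y - x)]; the choice [|x' - x| < r t] keeps it within [r] of [y]. *)
have H : Omega (y + (t^-1 * (1 - t)) *: (x - x')).
  apply: Hr; rewrite addrC addKr normrZ normrM normfV (gtr0_norm t0) [`|x - x'|]distrC.
  apply: (@le_lt_trans _ _ (t^-1 * `|x' - x|)).
    rewrite ler_wpM2r// ler_piMr ?invr_ge0 ?(ltW t0)//.
    by rewrite ger0_norm ?subr_ge0// lerBlDr lerDl ltW.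
  by rewrite mulrC ltr_pdivrMr.
have := convex_comb H Ox' (ltac:(by rewrite t1 (ltW t0)) : 0 <= t <= 1).
congr Omega; apply/rowP => i; rewrite !mxE; field; exact: lt0r_neq0.
Qed.

(** The crossing parameter is the infimum of those whose point lies in Omega. Openness would allow a
    positive parameter in Omega to be lowered, and the parameter 0 gives [x], which is outside. *)
Lemma boundary_crossing x y : ~ Omega x -> Omega y ->
  exists2 s : R, 0 <= s <= 1 & boundary Omega (x + s *: (y - x)).
Proof.
move=> nOx Oy.
pose S := [set s : R | 0 <= s <= 1 /\ Omega (x + s *: (y - x))].
have S1 : S 1 by rewrite /S /= ler01 lexx scale1r addrC subrK.
have lbS : has_lbound S by exists 0 => s [/andP[]].
have iS : has_inf S by split => //; exists 1.
pose s := inf S.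
have s0 : 0 <= s by apply: lb_le_inf => [|z [/andP[]]]//; exists 1.
have s1 : s <= 1 by exact: ge_inf.
exists s; first by rewrite s0.
have M0 : 0 < `|y - x| + 1 by rewrite ltr_wpDl.
have shift_le (a b : R) : `|(x + a *: (y - x)) - (x + b *: (y - x))| <= `|a - b| * (`|y - x| + 1).
  rewrite opprD addrACA subrr add0r -scalerBl normrZ ler_wpM2l// lerDl//.
split.
  move=> B /nbhs_ballP[e /= e0 He].
  have [a Sa as_] := @inf_adherent _ S (e / (`|y - x| + 1)) (divr_gt0 e0 M0) iS.
  have sa : s <= a by exact: ge_inf.
  exists (x + a *: (y - x)); split; first by case: Sa.
  apply: He; rewrite -ball_normE /= (le_lt_trans (shift_le _ _))//.
  rewrite -ltr_pdivlMr// distrC ger0_norm ?subr_ge0//.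
  by rewrite ltrBlDl.
move=> Os.
have s_gt0 : 0 < s.
  rewrite lt_neqAle s0 andbT; apply/eqP => E; apply: nOx.
  by rewrite -[x]addr0 -(scale0r (y - x)) E.
have [r r0 Hr] := open_ball Os.
pose a := s - Num.min s (r / 2 / (`|y - x| + 1)).
have m0 : 0 < Num.min s (r / 2 / (`|y - x| + 1)).
  by rewrite lt_min s_gt0 /= !divr_gt0.
have : S a.
  split.
    rewrite /a subr_ge0 ge_min lexx /= (le_trans _ s1)// lerBlDr lerDl ltW//.
  apply: Hr; apply: (le_lt_trans (shift_le _ _)).
  rewrite -ltr_pdivlMr// /a addrAC subrr add0r normrN gtr0_norm//.
  apply: (@le_lt_trans _ _ (r / 2 / (`|y - x| + 1))); first by rewrite ge_min lexx orbT.
  by rewrite ltr_pM2r ?invr_gt0// ltr_pdivrMr// ltr_pMr// ltr1n.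
move=> /(ge_inf lbS); rewrite -/s /a leNgt => /negP; apply.
by rewrite ltrBlDr ltrDl.
Qed.

End convex_open.

Lemma cvg_sumr {R : realType} {T : Type} (F : set_system T) {FF : Filter F} n
    (f : 'I_n -> T -> R) (l : 'I_n -> R) :
  (forall i, f i @ F --> l i) -> (fun t => \sum_i f i t) @ F --> \sum_i l i.
Proof.
move=> H; elim: (index_enum _) => [|i s IHs].
  by rewrite big_nil; under eq_fun do rewrite big_nil; exact: cvg_cst.
rewrite big_cons; under eq_fun do rewrite big_cons.
exact: cvgD.
Qed.

Section dot_theory.
Context {R : realType} {d : nat}.
Implicit Types x y z : 'rV[R]_d.

Lemma dotDr x y z : dot x (y + z) = dot x y + dot x z.
Proof. by rewrite /dot -big_split; apply: eq_bigr => i _; rewrite mxE mulrDr. Qed.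

Lemma dotZr x c y : dot x (c *: y) = c * dot x y.
Proof. by rewrite /dot mulr_sumr; apply: eq_bigr => i _; rewrite mxE mulrCA. Qed.

Lemma dotZl x c y : dot (c *: x) y = c * dot x y.
Proof. by rewrite dotC dotZr dotC. Qed.

Lemma dotNr x y : dot x (- y) = - dot x y.
Proof. by rewrite -scaleN1r dotZr mulN1r. Qed.

Lemma dotBr x y z : dot x (y - z) = dot x y - dot x z.
Proof. by rewrite dotDr dotNr. Qed.

Lemma dot_ge0 x : 0 <= dot x x.
Proof. by apply: sumr_ge0 => i _; rewrite -expr2 sqr_ge0. Qed.

Lemma dot_gt0 x : x != 0 -> 0 < dot x x.
Proof.
move=> x0; rewrite lt_neqAle dot_ge0 andbT eq_sym; apply: contra x0 => /eqP H.
apply/eqP/rowP => i; rewrite mxE; apply/eqP; rewrite -sqrf_eq0 expr2.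
move: H => /eqP; rewrite psumr_eq0 => [/allP/(_ i)|j _]; last by rewrite -expr2 sqr_ge0.
by rewrite mem_index_enum => /(_ isT).
Qed.

End dot_theory.

Section supporting.
Context {R : realType} {d : nat} {Omega : set 'rV[R]_d} {n : 'rV[R]_d -> 'rV[R]_d}.
Hypotheses (Omega_open : open Omega) (Omega_convex : convex_set Omega).
Hypothesis Omega_C1 : C1_boundary_normal Omega n.
Implicit Types x y w : 'rV[R]_d.

(** The defining function is needed only along lines through [x], and [c] is [|D rho|]. Its value at
    [x] is 0: it is not negative since [x] is outside Omega, and if it were positive it would remain
    so near [x], against [closure Omega x]. *)
Lemma normal_local x w : boundary Omega x -> exists (rho : 'rV[R]_d -> R) (c : R),
  [/\ 0 < c, is_derive (0 : R) 1 (fun t : R => rho (t *: w + x)) (c * dot (n x) w), rho x = 0,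
   dot (n x) (n x) = 1 &
   \forall t \near (0 : R), Omega (t *: w + x) <-> rho (t *: w + x) < 0].
Proof.
move=> bx; have [U [rho [[oU Ux] rho1 rhoP g0 nE]]] := Omega_C1 bx.
pose g := grad rho x.
have gg0 : 0 < dot g g by exact: dot_gt0.
have sg0 : 0 < Num.sqrt (dot g g) by rewrite sqrtr_gt0.
exists rho, (Num.sqrt (dot g g)); split => //.
- have -> : Num.sqrt (dot g g) * dot (n x) w = dot (grad rho x) w.
    by rewrite nE dotZl mulrA divff ?mul1r// gt_eqF.
  apply/(is_derive_line rho x w 0); rewrite scale0r add0r.
  exact: (C1_on_dir w oU rho1 Ux).
- have [cx nOx] := bx; apply/eqP; rewrite eq_le; apply/andP; split; last first.
    by rewrite leNgt; apply/negP => /(rhoP x Ux).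
  rewrite leNgt; apply/negP => r0.
  have crho := C1_on_continuous oU rho1 Ux.
  have : \forall y \near x, U y /\ 0 < rho y.
    apply: filterI; first exact: open_near.
    by move: crho; move/(_ [set r : R | 0 < r]); apply; exact: lt_nbhsr.
  move=> /cx[y [Oy [Uy ry]]].
  by have := (rhoP y Uy).1 Oy; rewrite ltNge (ltW ry).
- rewrite nE dotZl dotZr -[X in _ * (_ * X)]sqr_sqrtr ?ltW// -/g.
  by field; rewrite gt_eqF.
- have c0 : {for (0 : R), continuous (fun t : R => t *: w + x)}.
    by apply: cvgD; [apply: cvgZr_tmp; exact: cvg_id|exact: cvg_cst].
  have : \forall t \near (0 : R), U (t *: w + x).
    by apply: c0; rewrite scale0r add0r; exact: open_near.
  by apply: filterS => t Ut; exact: rhoP.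
Qed.

Lemma normal_unit x : boundary Omega x -> dot (n x) (n x) = 1.
Proof. by move=> bx; have [rho [c [_ _ _ ->]]] := normal_local 0 bx. Qed.

Lemma quotient_cvg (f : R -> R) (l : R) : is_derive (0 : R) 1 f l -> f 0 = 0 ->
  (fun t => t^-1 * f t) @ 0^' --> l.
Proof.
move=> [/cvg_ex[l' Hl'] Hl] f0.
have -> : (fun t : R => t^-1 * f t) = (fun h : R => h^-1 *: ((f \o shift 0) (h *: 1) - f 0)).
  by apply/funext => t; rewrite /= addr0 [t *: 1]mulr1 f0 subr0.
by rewrite -Hl /derive; apply/cvg_ex; exists l'.
Qed.

Lemma cone_in x w : boundary Omega x -> dot (n x) w < 0 ->
  exists2 eta : R, 0 < eta & forall t, 0 < t -> t <= eta -> Omega (x + t *: w).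
Proof.
move=> bx nw; have [rho [c [c0 D r0 _ HO]]] := normal_local w bx.
have L := quotient_cvg D (ltac:(by rewrite /= scale0r add0r) : (fun t : R => rho (t *: w + x)) 0 = 0).
have cl0 : c * dot (n x) w < 0 by rewrite pmulr_rlt0.
have N1 : \forall t \near 0^', t^-1 * rho (t *: w + x) < 0.
  by move: L; move/(_ [set r : R | r < 0]); apply; exact: lt_nbhsl.
have : \forall t \near (0 : R), t != 0 -> (Omega (t *: w + x) <-> rho (t *: w + x) < 0) /\ t^-1 * rho (t *: w + x) < 0.
  move: N1; rewrite near_withinE => N1.
  by apply: filterS2 HO N1 => t A B t0; split => //; exact: B.
move=> /nbhs_ballP[e /= e0 He]; exists (e / 2); first by rewrite divr_gt0.
move=> t t0 te.
have [] := He t _ (lt0r_neq0 t0).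
  rewrite -ball_normE /= sub0r normrN gtr0_norm// (le_lt_trans te)//.
  by rewrite ltr_pdivrMr// ltr_pMr// ltr1n.
by rewrite addrC => -> ; rewrite pmulr_rlt0 ?invr_gt0.
Qed.

(** If the product were positive, [rho] would be positive at points of the segment close to [x],
    while convexity places these points in Omega. *)
Lemma support_le x y : boundary Omega x -> Omega y -> dot (n x) (y - x) <= 0.
Proof.
move=> bx Oy; have [rho [c [c0 D r0 _ HO]]] := normal_local (y - x) bx.
have L := quotient_cvg D (ltac:(by rewrite /= scale0r add0r) : (fun t : R => rho (t *: (y - x) + x)) 0 = 0).
rewrite -(pmulr_rle0 _ c0) leNgt; apply/negP => cl0.
have N1 : \forall t \near 0^', 0 < t^-1 * rho (t *: (y - x) + x).
  by move: L; move/(_ [set r : R | 0 < r]); apply; exact: lt_nbhsr.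
have : \forall t \near (0 : R), t != 0 -> (Omega (t *: (y - x) + x) <-> rho (t *: (y - x) + x) < 0) /\ 0 < t^-1 * rho (t *: (y - x) + x).
  move: N1; rewrite near_withinE => N1.
  by apply: filterS2 HO N1 => t A B t0; split => //; exact: B.
move=> /nbhs_ballP[e /= e0 He].
pose t := Num.min 1 (e / 2).
have t0 : 0 < t by rewrite lt_min ltr01 divr_gt0.
have [] := He t _ (lt0r_neq0 t0).
  rewrite -ball_normE /= sub0r normrN gtr0_norm// (@le_lt_trans _ _ (e / 2))//.
    by rewrite ge_min lexx orbT.
  by rewrite ltr_pdivrMr// ltr_pMr// ltr1n.
have : Omega (t *: (y - x) + x).
  rewrite addrC; apply: (convex_closure_segment Omega_open Omega_convex) => //; first by case: bx.
  by rewrite t0 ge_min lexx.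
by move=> + H => /H; rewrite pmulr_rgt0 ?invr_gt0// => A; rewrite ltNge (ltW A).
Qed.

(** Apply the weak inequality to [y] pushed slightly along [n x], a move that openness allows and
    that increases the product. *)
Lemma support_lt x y : boundary Omega x -> Omega y -> dot (n x) (y - x) < 0.
Proof.
move=> bx Oy; have [r r0 Hr] := open_ball Omega_open Oy.
pose e := r / (`|n x| + 1).
have e0 : 0 < e by rewrite divr_gt0// ltr_wpDl.
have : Omega (y + (e / 2) *: n x).
  apply: Hr; rewrite addrC addKr normrZ gtr0_norm ?divr_gt0//.
  rewrite /e (_ : _ / 2 * _ = r * (`|n x| / ((`|n x| + 1) * 2))); last first.
    by field; rewrite gt_eqF// ltr_wpDl.
  rewrite gtr_pMr// ltr_pdivrMr ?mulr_gt0 ?ltr_wpDl// mul1r.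
  by have := normr_ge0 (n x); lra.
move=> /(support_le bx); rewrite (_ : y + _ - x = (y - x) + (e / 2) *: n x); last by rewrite addrAC.
rewrite dotDr dotZr (normal_unit bx) mulr1.
by move=> H; rewrite (lt_le_trans _ H)// ltrDl divr_gt0.
Qed.

(** A ball of Omega around the far end [x + eta w] absorbs the perturbation of [w]; the segments
    from [x] to that ball then fill a truncated cone. *)
Lemma cone_in_near x w : boundary Omega x -> dot (n x) w < 0 ->
  exists2 del : R, 0 < del & exists2 eta : R, 0 < eta &
    forall t w', 0 < t -> t <= eta -> `|w' - w| < del -> Omega (x + t *: w').
Proof.
move=> bx nw; have [eta eta0 H] := cone_in bx nw.
have [r r0 Hr] := open_ball Omega_open (H eta eta0 (lexx _)).
exists (r / eta); first by rewrite divr_gt0.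
exists eta => // t w' t0 te ww'.
have O1 : Omega (x + eta *: w').
  apply: Hr; rewrite opprD addrACA subrr add0r -scalerBr normrZ gtr0_norm//.
  by rewrite mulrC -ltr_pdivlMr.
have [cx _] := bx.
have := convex_closure_segment Omega_open Omega_convex cx O1 (ltac:(by rewrite divr_gt0//= ler_pdivrMr ?mul1r) : 0 < t / eta <= 1).
by rewrite addrAC subrr add0r scalerA divfK// gt_eqF.
Qed.

Lemma tangent_line_out x w t : boundary Omega x -> dot (n x) w = 0 -> ~ Omega (x + t *: w).
Proof.
move=> bx nw /(support_lt bx); rewrite addrAC subrr add0r dotZr nw mulr0.
by rewrite ltxx.
Qed.

(** A Taylor estimate between points of the closure. The mean value theorem gives it between two
    points of Omega, joined by a segment thanks to convexity; one end then tends to [z] and the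
    other to [x]. *)
Lemma bar_taylor f x : Ck_bar 1 Omega f -> closure Omega x -> forall e : R, 0 < e ->
  exists2 r : R, 0 < r & forall z, closure Omega z -> `|z - x| < r ->
  `|trace Omega f z - trace Omega f x - \sum_j trace Omega (pd j f) x * (z - x) 0 j| <= e * `|z - x|.
Proof.
move=> f1 cx e e0.
have cf := Ck_bar0 f1.
pose a : 'rV[R]_d := \row_j trace Omega (pd j f) x.
have aE w : \sum_j trace Omega (pd j f) x * w 0 j = dot a w.
  by apply: eq_bigr => j _; rewrite mxE.
pose c := e / (d%:R + 1).
have d0 : (0 : R) < d%:R + 1 by rewrite ltr_wpDl.
have c0 : 0 < c by rewrite divr_gt0.
have FF y : closure Omega y -> ProperFilter (within Omega (nbhs y)).
  exact: within_closure_proper.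
have [r r0 Hr] : exists2 r, 0 < r & forall y, ball x r y -> Omega y -> forall j, `|a 0 j - pd j f y| <= c.
  have N : \forall y \near within Omega (nbhs x), forall j, `|a 0 j - pd j f y| <= c.
    have FFx := FF x cx.
    apply: (@filter_forall _ 'I_d (fun j y => `|a 0 j - pd j f y| <= c) (within Omega (nbhs x))) => j.
    have cj := Ck_bar0 (Ck_bar_pd j f1) cx.
    by have /cvgrPdist_le/(_ _ c0) := cj; rewrite mxE.
  by move: N; rewrite near_withinE => /nbhs_ballP.
exists r => // z cz zr; rewrite aE.
have inner y1 y2 : Omega y1 -> Omega y2 -> ball x r y1 -> ball x r y2 ->
    `|f y2 - f y1 - dot a (y2 - y1)| <= e * `|y2 - y1|.
  move=> O1 O2 b1 b2.
  have seg t : 0 <= t <= 1 -> Omega (t *: (y2 - y1) + y1) /\ ball x r (t *: (y2 - y1) + y1).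
    move=> t01; have -> : t *: (y2 - y1) + y1 = t *: y2 + (1 - t) *: y1.
      by apply/rowP => i; rewrite !mxE; ring.
    split; first exact: (convex_comb Omega_convex).
    have /andP[t0 t1] := t01.
    move: b1 b2; rewrite -!ball_normE /= => b1 b2.
    have -> : x - (t *: y2 + (1 - t) *: y1) = t *: (x - y2) + (1 - t) *: (x - y1).
      by apply/rowP => i; rewrite !mxE; ring.
    apply: le_lt_trans (ler_normD _ _) _; rewrite !normrZ (ger0_norm t0) ger0_norm ?subr_ge0//.
    by move: (normr_ge0 (x - y1)) (normr_ge0 (x - y2)) => n1 n2; have [->|/eqP tn0] := eqVneq t 0; nra.
  have D (t : R) : 0 <= t <= 1 -> is_derive t 1 (fun t => f (t *: (y2 - y1) + y1)) (dot (grad f (t *: (y2 - y1) + y1)) (y2 - y1)).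
    move=> /seg[Ot _]; apply/(is_derive_line f y1 (y2 - y1) t).
    exact: (C1_on_dir _ Omega_open (Ck_bar_C1 Omega_open f1) Ot).
  have [] := @MVT_segment _ (fun t => f (t *: (y2 - y1) + y1)) (fun t => dot (grad f (t *: (y2 - y1) + y1)) (y2 - y1)) 0 1 ler01.
  - by move=> t; rewrite in_itv /= => /andP[t0 t1]; apply: D; rewrite !ltW.
  - apply: derivable_within_continuous => t; rewrite in_itv /= => /D[]//.
  move=> t; rewrite in_itv /= => t01; rewrite scale1r subrK scale0r add0r subr0 mulr1 => ->.
  have [Ot bt] := seg t t01.
  rewrite dotC [dot a _]dotC -dotBr dotC.
  apply: le_trans (norm_dot_le _ _) _; rewrite ler_wpM2r//.
  apply: (@le_trans _ _ (\sum_(i < d) c)).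
    by apply: ler_sum => i _; rewrite !mxE distrC; have := Hr _ bt Ot i; rewrite mxE.
  rewrite sumr_const card_ord -mulr_natl /c mulrCA ler_piMr ?(ltW e0)//.
  by rewrite ler_pdivrMr// mul1r lerDl.
have bz : ball x r z by rewrite -ball_normE /= distrC.
have cvn (y w : 'rV[R]_d) : (fun u => u - w) @ within Omega (nbhs y) --> y - w.
  apply: cvgB; last exact: cvg_cst.
  by apply: cvg_within.
have cvdot (y w : 'rV[R]_d) : (fun u => dot a (u - w)) @ within Omega (nbhs y) --> dot a (y - w).
  have -> : (fun u => dot a (u - w)) = (fun u => \sum_i a 0 i * (u - w) 0 i) by [].
  apply: cvg_sumr => i; apply: cvgM; first exact: cvg_cst.
  exact: (cvg_comp _ _ (cvn y w) (@coord_continuous _ _ _ 0 i _)).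
have nb y : ball x r y -> \forall u \near within Omega (nbhs y), Omega u /\ ball x r u.
  move=> by_; rewrite near_withinE; have : \forall u \near y, ball x r u.
    by apply: open_near => //; exact: ball_open.
  by apply: filterS => u bu Ou.
have outer y : Omega y -> ball x r y -> `|trace Omega f z - f y - dot a (z - y)| <= e * `|z - y|.
  move=> Oy by_; have FFz := FF z cz.
  have L : (fun u => e * `|u - y| - `|f u - f y - dot a (u - y)|) @ within Omega (nbhs z) -->
     e * `|z - y| - `|trace Omega f z - f y - dot a (z - y)|.
    apply: cvgB; first by apply: cvgM; [exact: cvg_cst|apply: cvg_norm; exact: cvn].
    apply: cvg_norm; apply: cvgB; last exact: cvdot.
    by apply: cvgB; [exact: (cf z cz)|exact: cvg_cst].
  rewrite -subr_ge0 -(cvg_lim _ L)//; apply: limr_ge; first by apply/cvg_ex; eexists; exact: L.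
  by apply: filterS (nb z bz) => u [Ou bu]; rewrite subr_ge0; exact: inner.
have FFx := FF x cx.
have L : (fun u => e * `|z - u| - `|trace Omega f z - f u - dot a (z - u)|) @ within Omega (nbhs x) -->
     e * `|z - x| - `|trace Omega f z - trace Omega f x - dot a (z - x)|.
  have cvn' : (fun u => z - u) @ within Omega (nbhs x) --> z - x.
    by apply: cvgB; [exact: cvg_cst|exact: cvg_within].
  apply: cvgB; first by apply: cvgM; [exact: cvg_cst|apply: cvg_norm; exact: cvn'].
  apply: cvg_norm; apply: cvgB.
    by apply: cvgB; [exact: cvg_cst|exact: (cf x cx)].
  apply: cvg_sumr => i; apply: cvgM; first exact: cvg_cst.
  exact: (cvg_comp _ _ cvn' (@coord_continuous _ _ _ 0 i _)).
rewrite -subr_ge0 -(cvg_lim _ L)//; apply: limr_ge; first by apply/cvg_ex; eexists; exact: L.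
by apply: filterS (nb x (ballxx _ r0)) => u [Ou bu]; rewrite subr_ge0; exact: outer.
Qed.

Lemma trace_dot h x w : Ck_bar 1 Omega h -> closure Omega x ->
  trace Omega (fun y => dot (grad h y) w) x = \sum_i trace Omega (pd i h) x * w 0 i.
Proof.
move=> h1 cx; have FF := within_closure_proper cx; apply: trace_eq => //.
apply: cvg_sumr => i; apply: cvgM; last exact: cvg_cst.
rewrite (_ : (fun t => grad h t 0 i) = pd i h); first exact: (Ck_bar0 (Ck_bar_pd i h1) cx).
by apply/funext => y; rewrite mxE.
Qed.

(* Let [Y] be the gradient of [h] on the boundary, [A] its derivative and [X = Y x], which is
   tangent at [x]. The boundary points [z = x + e X + o(e)] have [Y z = X + e A X + o(e)]; the line
   through [z] directed by [Y z] is tangent at [z], hence avoids [Omega], and contains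
   [z - e Y z = x - e^2 (A X + o(1)) - k n] with [k >= 0], which would be in [Omega] if [A X . n > 0]. *)
Lemma convex_boundary_hess h : Ck_bar 2 Omega h ->
  (forall x, boundary Omega x -> trace Omega (fun y => dot (grad h y) (n x)) x = 0) ->
  forall x, boundary Omega x ->
  \sum_i (\sum_j trace Omega (pd j (pd i h)) x * trace Omega (pd j h) x) * n x 0 i <= 0.
Proof.
move=> h2 hn x bx; have h1 := Ck_bar_pred h2.
have [cx nOx] := bx.
pose Y z : 'rV[R]_d := \row_i trace Omega (pd i h) z.
pose A (w : 'rV[R]_d) : 'rV[R]_d := \row_i \sum_j trace Omega (pd j (pd i h)) x * w 0 j.
pose X := Y x.
have tangent z : boundary Omega z -> dot (n z) (Y z) = 0.
  move=> bz; rewrite -(hn z bz) trace_dot//; last by case: bz.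
  by rewrite dotC; apply: eq_bigr => i _; rewrite mxE.
have -> : \sum_i (\sum_j trace Omega (pd j (pd i h)) x * trace Omega (pd j h) x) * n x 0 i = dot (n x) (A X).
  rewrite dotC; apply: eq_bigr => i _; rewrite mxE; congr (_ * _).
  by apply: eq_bigr => j _; rewrite mxE.
rewrite leNgt; apply/negP => AX0.
have AZ c w : A (c *: w) = c *: A w.
  by apply/rowP => i; rewrite !mxE mulr_sumr; apply: eq_bigr => j _; rewrite !mxE mulrCA.
have AB w1 w2 : A (w1 - w2) = A w1 - A w2.
  by apply/rowP => i; rewrite !mxE -sumrB; apply: eq_bigr => j _; rewrite !mxE mulrBr.
have [del del0 [eta eta0 cone]] := cone_in_near bx (ltac:(by rewrite dotNr oppr_lt0) : dot (n x) (- A X) < 0).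
have nn := normal_unit bx.
have [eta1 eta10 cone1] := cone_in bx (ltac:(by rewrite dotNr nn ltrN10) : dot (n x) (- n x) < 0).
(* The direction [X] is only tangent. Tilting it to [X - kap n] makes it point inward, and [kap] is
   small enough for the effect on [A] to stay below [del / 4]. *)
pose kap := del / 4 / (`|A (n x)| + 1).
have an0 : 0 < `|A (n x)| + 1 by rewrite ltr_wpDl.
have kap0 : 0 < kap by rewrite !divr_gt0.
have kapA : kap * `|A (n x)| <= del / 4.
  by rewrite /kap mulrAC ler_pdivrMr// ler_wpM2l ?divr_ge0 ?(ltW del0)// lerDl.
(* Every point [x + eps (X - s kap n)] with [0 <= s <= 1] is within [eps N] of [x], so a Taylor
   error relative to [del / 4 / N] costs [eps del / 4]. *)
pose N := `|X| + kap * `|n x| + 1.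
have N0 : 0 < N by rewrite ltr_wpDl// addr_ge0// mulr_ge0// ltW.
have e0 : 0 < del / 4 / N by rewrite !divr_gt0.
have [r r0 taylor] : exists2 r, 0 < r & forall z, closure Omega z -> `|z - x| < r ->
    `|Y z - X - A (z - x)| <= del / 4 / N * `|z - x|.
  have H i : exists2 r, 0 < r & forall z, closure Omega z -> `|z - x| < r ->
    `|(Y z - X - A (z - x)) 0 i| <= del / 4 / N * `|z - x|.
    have [r r0 Hr] := bar_taylor (Ck_bar_pd i h2) cx e0.
    exists r => // z cz zr; rewrite !mxE; have := Hr z cz zr.
    by congr (`| _ - _| <= _); apply: eq_bigr => j _; rewrite !mxE.
  have [rr Hrr] := choice (fun i => let: ex_intro2 r r0 H := H i in ex_intro (fun r => 0 < r /\ forall z, closure Omega z -> `|z - x| < r ->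
    `|(Y z - X - A (z - x)) 0 i| <= del / 4 / N * `|z - x|) r (conj r0 H)).
  exists (\big[Num.min/1]_i rr i).
    by apply: lt_bigmin => // i _; case: (Hrr i).
  move=> z cz zr; apply: norm_le_coord; first by rewrite mulr_ge0// ltW.
  move=> i; have [_] := Hrr i; apply => //; apply: (lt_le_trans zr); exact: bigmin_le.
have [eta2 eta20 cone2] := cone_in bx (ltac:(by rewrite dotBr dotZr nn mulr1 tangent// sub0r oppr_lt0) : dot (n x) (X - kap *: n x) < 0).
(* [H1] puts the tilted point inside Omega and [H2] keeps [z] in the Taylor ball. The factors 2 in
   [H3] and [H4] come from writing the final point as a midpoint. *)
have [eps eps0 [H1 H2 H3 H4]] : exists2 e : R, 0 < e & [/\ e <= eta2, e * N < r, 2 * e ^+ 2 <= eta & 2 * (kap * e) <= eta1].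
  pose e := Num.min (Num.min eta2 (r / 2 / N)) (Num.min (Num.min 1 (eta / 2)) (eta1 / 2 / kap)).
  have e_gt0 : 0 < e by rewrite !lt_min ltr01 eta20 !divr_gt0.
  have E1 : e <= eta2 by rewrite /e !ge_min lexx.
  have E2 : e <= r / 2 / N by rewrite /e !ge_min lexx !orbT.
  have E3 : e <= 1 by rewrite /e !ge_min lexx !orbT.
  have E4 : e <= eta / 2 by rewrite /e !ge_min lexx !orbT.
  have E5 : e <= eta1 / 2 / kap by rewrite /e !ge_min lexx !orbT.
  exists e => //; split => //.
  - rewrite -ltr_pdivlMr//; apply: (le_lt_trans E2).
    by rewrite ltr_pM2r ?invr_gt0// ltr_pdivrMr// ltr_pMr// ltr1n.
  - by rewrite mulrC -ler_pdivlMr// (le_trans _ E4)// expr2 ler_piMl// ltW.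
  - by rewrite mulrC -ler_pdivlMr// mulrC -ler_pdivlMr.
have nOp : ~ Omega (x + eps *: X) by apply: tangent_line_out => //; exact: tangent.
(* The point [z] lies between the tangential point [x + eps X], outside Omega, and the tilted one,
   inside; its offset along [- n x] is [k]. *)
have [s s01 bz] := boundary_crossing Omega_open nOp (cone2 eps eps0 H1).
pose k := s * (kap * eps).
have /andP[s0 s1] := s01.
have ke0 : 0 <= kap * eps by rewrite mulr_ge0// ltW.
have k0 : 0 <= k by exact: mulr_ge0.
have k1 : k <= kap * eps by exact: ler_piMl.
set z := (X in boundary _ X) in bz.
have zE : z - x = eps *: X - k *: n x.
  by apply/rowP => i; rewrite !mxE /k; ring.
have zN : `|z - x| <= eps * N.
  rewrite zE; apply: le_trans (ler_normB _ _) _.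
  rewrite (normrZ eps) (normrZ k) (gtr0_norm eps0) (ger0_norm k0) /N.
  have : k * `|n x| <= kap * eps * `|n x| by rewrite ler_wpM2r.
  by move: (ltW eps0) => ? ?; lra.
have zr : `|z - x| < r by apply: le_lt_trans zN _.
have cz : closure Omega z by case: bz.
have T := taylor z cz zr.
(* This is the remainder in [Y z = X + eps (A X + v)], gathering the Taylor error and the effect of
   the tilt. *)
pose v := eps^-1 *: (Y z - X - A (z - x)) - (k / eps) *: A (n x).
have vN : `|v| < del.
  apply: le_lt_trans (ler_normB _ _) _; rewrite (normrZ eps^-1) (normrZ (k / eps)).
  have A1 : `|eps^-1| * `|Y z - X - A (z - x)| <= del / 4.
    rewrite gtr0_norm ?invr_gt0// mulrC ler_pdivrMr//; apply: (le_trans T).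
    rewrite (le_trans (ler_wpM2l (ltW e0) zN))// (_ : _ * (eps * N) = del / 4 * eps)//.
    by field; rewrite gt_eqF.
  have A2 : `|k / eps| * `|A (n x)| <= del / 4.
    apply: le_trans kapA; rewrite ler_wpM2r// ger0_norm; last by rewrite divr_ge0// ltW.
    by rewrite ler_pdivrMr.
  by move: A1 A2 del0; lra.
have nOz : ~ Omega (z + (- eps) *: Y z) by apply: tangent_line_out => //; exact: tangent.
apply: nOz.
have YE : Y z = X + eps *: (A X + v).
  have -> : A X = eps^-1 *: (A (z - x) + k *: A (n x)).
    rewrite zE AB !AZ subrK scalerA mulVf ?scale1r// gt_eqF//.
  apply/rowP => i; rewrite !mxE; field; rewrite gt_eqF//.
(* The point [z - eps Y z = x - k n - eps^2 (A X + v)] is the midpoint of this interior point and of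
   [x - 2 k n], which belongs to the closure. *)
have O1 : Omega (x + (2 * eps ^+ 2) *: (- A X - v)).
  apply: cone => //; first by rewrite mulr_gt0// exprn_gt0.
  by rewrite addrAC subrr add0r normrN.
have c1 : closure Omega (x + (2 * k) *: (- n x)).
  have [k_gt0|k_le0] := ltP 0 k.
    apply: subset_closure; apply: cone1; first by rewrite mulr_gt0.
    by apply: le_trans H4; rewrite ler_wpM2l.
  by rewrite (_ : k = 0) ?mulr0 ?scale0r ?addr0//; apply/eqP; rewrite eq_le k_le0.
have half : 0 < (2^-1 : R) <= 1 by rewrite invr_gt0 ltr0n/= invf_le1// ler1n.
have := convex_closure_segment Omega_open Omega_convex c1 O1 half.
have midpoint (a b c u w : 'rV[R]_d) (e l : R) :
    a + (2 * l) *: - b + 2^-1 *: (a + (2 * e ^+ 2) *: (- u - w) - (a + (2 * l) *: - b)) =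
    e *: c - l *: b + a + - e *: (c + e *: (u + w)).
  by apply/rowP => i; rewrite !mxE; field.
by rewrite (midpoint x (n x) X (A X) v eps k) YE -[z](subrK x) zE.
Qed.

End supporting.

(** * Bochner formula and boundary fluxes *)

Lemma is_derive_sumr {R : realType} {V : normedModType R} n (f : 'I_n -> V -> R) (df : 'I_n -> R) (x v : V) :
  (forall i, is_derive x v (f i) (df i)) -> is_derive x v (fun y => \sum_i f i y) (\sum_i df i).
Proof.
move=> H; elim: (index_enum _) => [|i s IHs].
  rewrite big_nil (_ : (fun y => _) = cst 0); first exact: is_derive_cst.
  by apply/funext => y; rewrite big_nil.
rewrite big_cons (_ : (fun y => _) = (f i \+ (fun y => \sum_(i <- s) f i y))).
  by have := H i => Hi; exact: is_deriveD.
by apply/funext => y; rewrite big_cons.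
Qed.

Section bochner.
Context {R : realType} {d : nat} {Omega : set 'rV[R]_d}.
Hypothesis Omega_open : open Omega.
Implicit Types (f h F : 'rV[R]_d -> R) (x : 'rV[R]_d).

Definition grad_sq f x : R := dot (grad f x) (grad f x).

Lemma dot_gradE f h x : dot (grad f x) (grad h x) = \sum_i pd i f x * pd i h x.
Proof. by apply: eq_bigr => i _; rewrite !mxE. Qed.

Lemma Ck_bar_dot_grad k f h : Ck_bar k.+1 Omega f -> Ck_bar k.+1 Omega h ->
  Ck_bar k Omega (fun x => dot (grad f x) (grad h x)).
Proof.
move=> Hf Hh; apply: (@Ck_bar_ext _ _ _ Omega_open k (fun x => \sum_i pd i f x * pd i h x)).
  by move=> y _; rewrite dot_gradE.
by apply: (Ck_bar_sum Omega_open) => i; apply: (Ck_barM Omega_open); exact: Ck_bar_pd.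
Qed.

Lemma Ck_bar_laplacian k F h : Ck_bar k.+1 Omega F -> Ck_bar k.+2 Omega h ->
  Ck_bar k Omega (laplacian_g F h).
Proof.
move=> HF Hh; apply: (Ck_barB Omega_open).
  by apply: (Ck_bar_sum Omega_open) => i; apply: Ck_bar_pd; exact: Ck_bar_pd.
apply: Ck_bar_dot_grad => //; exact: Ck_bar_pred.
Qed.

Lemma pd_dot_grad f h j x : Ck_bar 2 Omega f -> Ck_bar 2 Omega h -> Omega x ->
  is_derive x (delta_mx 0 j) (fun x => dot (grad f x) (grad h x))
    (\sum_i (pd i f x * pd j (pd i h) x + pd i h x * pd j (pd i f) x)).
Proof.
move=> Hf Hh Ox.
rewrite (_ : (fun x => _) = (fun x => \sum_i pd i f x * pd i h x)); last first.
  by apply/funext => y; rewrite dot_gradE.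
apply: is_derive_sumr => i.
have := Ck_bar_derive j (Ck_bar_pd i Hf) Ox; have := Ck_bar_derive j (Ck_bar_pd i Hh) Ox => ? ?.
exact: is_deriveM.
Qed.

Lemma pd_grad_sq f j x : Ck_bar 2 Omega f -> Omega x ->
  pd j (grad_sq f) x = 2 * \sum_i pd i f x * pd j (pd i f) x.
Proof.
move=> Hf Ox; rewrite (is_derive_pdE (pd_dot_grad j Hf Hf Ox)) mulr_sumr.
by apply: eq_bigr => i _; ring.
Qed.

Lemma pd_pd_pdC f i j x : Ck_bar 3 Omega f -> Omega x ->
  pd j (pd j (pd i f)) x = pd i (pd j (pd j f)) x.
Proof.
move=> f3 Ox; have f2 := Ck_bar_pred f3.
rewrite -(pd_pdC Omega_open j i (Ck_bar_pd j f3) Ox).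
by apply: (pd_ext Omega_open) Ox => y Oy; exact: (pd_pdC Omega_open).
Qed.

Lemma pd_pd_grad_sq f j x : Ck_bar 3 Omega f -> Omega x ->
  pd j (pd j (grad_sq f)) x =
  2 * \sum_i (hess f x i j ^+ 2 + pd i f x * pd i (pd j (pd j f)) x).
Proof.
move=> f3 Ox; have f2 := Ck_bar_pred f3.
rewrite (@pd_ext _ _ _ Omega_open _ (fun x => 2 * \sum_i pd i f x * pd j (pd i f) x)) //; last first.
  by move=> y Oy; exact: pd_grad_sq.
apply: is_derive_pdE.
have H : is_derive x (delta_mx 0 j) (fun x => \sum_i pd i f x * pd j (pd i f) x)
   (\sum_i (pd i f x * pd j (pd j (pd i f)) x + pd j (pd i f) x * pd j (pd i f) x)).
  apply: is_derive_sumr => i.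
  have H1 := Ck_bar_derive j (Ck_bar_pd i f3) Ox.
  have H2 := Ck_bar_derive j (Ck_bar_pd j (Ck_bar_pd i f3)) Ox.
  exact: is_deriveM.
have -> : \sum_i (hess f x i j ^+ 2 + pd i f x * pd i (pd j (pd j f)) x) =
   \sum_i (pd i f x * pd j (pd j (pd i f)) x + pd j (pd i f) x * pd j (pd i f) x).
  apply: eq_bigr => i _; rewrite (pd_pd_pdC i j f3 Ox) [hess _ _ _ _]mxE.
  by rewrite expr2 [LHS]addrC.
exact: is_deriveZ.
Qed.

Lemma pd_laplacian_g F f i x : Ck_bar 2 Omega F -> Ck_bar 3 Omega f -> Omega x ->
  pd i (laplacian_g F f) x = \sum_j pd i (pd j (pd j f)) x -
    \sum_j (pd j F x * pd i (pd j f) x + pd j f x * pd i (pd j F) x).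
Proof.
move=> F2 f3 Ox; apply: is_derive_pdE.
have H1 : is_derive x (delta_mx 0 i) (fun x => \sum_j pd j (pd j f) x) (\sum_j pd i (pd j (pd j f)) x).
  by apply: is_derive_sumr => j; exact: (Ck_bar_derive i (Ck_bar_pd j (Ck_bar_pd j f3)) Ox).
have H2 := pd_dot_grad i F2 (Ck_bar_pred f3) Ox.
exact: is_deriveB.
Qed.

(** Bochner's formula with all derivatives frozen to numbers: the third derivatives [f3] occur on
    both sides, and the symmetry of [f2] does the rest. *)
Lemma bochner_sum n (f1 F1 : 'I_n -> R) (f2 f3 F2 : 'I_n -> 'I_n -> R) :
  (forall i j, f2 i j = f2 j i) ->
  \sum_j 2 * (\sum_i (f2 i j ^+ 2 + f1 i * f3 i j)) - \sum_j F1 j * (2 * \sum_i f1 i * f2 i j) =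
  2 * (\sum_i \sum_j f2 i j ^+ 2 +
       \sum_i (\sum_j f3 i j - \sum_j (F1 j * f2 j i + f1 j * F2 i j)) * f1 i +
       \sum_i \sum_j F2 j i * f1 i * f1 j).
Proof.
move=> sym.
have E1 : \sum_j 2 * (\sum_i (f2 i j ^+ 2 + f1 i * f3 i j)) =
   2 * (\sum_i \sum_j f2 i j ^+ 2 + \sum_i \sum_j f3 i j * f1 i).
  rewrite -mulr_sumr; congr (2 * _); rewrite -big_split exchange_big /=.
  apply: eq_bigr => i _; rewrite -big_split; apply: eq_bigr => j _ /=; ring.
have E2 : \sum_j F1 j * (2 * \sum_i f1 i * f2 i j) = 2 * \sum_i \sum_j F1 j * f2 j i * f1 i.
  rewrite exchange_big mulr_sumr; apply: eq_bigr => j _.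
  rewrite mulrCA; congr (2 * _); rewrite mulr_sumr; apply: eq_bigr => i _.
  by rewrite (sym j i); ring.
have E3 : \sum_i (\sum_j f3 i j - \sum_j (F1 j * f2 j i + f1 j * F2 i j)) * f1 i =
   \sum_i \sum_j f3 i j * f1 i - \sum_i \sum_j F1 j * f2 j i * f1 i -
   \sum_i \sum_j f1 j * F2 i j * f1 i.
  rewrite -!sumrB; apply: eq_bigr => i _; rewrite mulrBl 2!mulr_suml -!sumrB.
  by apply: eq_bigr => j _; ring.
have E4 : \sum_i \sum_j F2 j i * f1 i * f1 j = \sum_i \sum_j f1 j * F2 i j * f1 i.
  rewrite exchange_big; apply: eq_bigr => i _; apply: eq_bigr => j _; ring.
rewrite E1 E2 E3 E4; ring.
Qed.

(** The Hessian of [F] appears when a derivative of [f] is commuted with the drift [DF . D]. *)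
Lemma bochner F f x : Ck_bar 2 Omega F -> Ck_bar 3 Omega f -> Omega x ->
  laplacian_g F (grad_sq f) x =
  2 * (\sum_i \sum_j hess f x i j ^+ 2 + dot (grad (laplacian_g F f) x) (grad f x) +
       quad (hess F x) (grad f x)).
Proof.
move=> F2 f3 Ox; have f2 := Ck_bar_pred f3.
pose f1_ i := pd i f x; pose F1_ i := pd i F x.
pose f2_ i j := hess f x i j; pose f3_ i j := pd i (pd j (pd j f)) x.
pose F2_ i j := pd i (pd j F) x.
have sym i j : f2_ i j = f2_ j i by rewrite /f2_ !mxE; exact: (pd_pdC Omega_open).
have E1 : \sum_j pd j (pd j (grad_sq f)) x = \sum_j 2 * (\sum_i (f2_ i j ^+ 2 + f1_ i * f3_ i j)).
  by apply: eq_bigr => j _; rewrite (pd_pd_grad_sq j f3 Ox).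
have E2 : dot (grad F x) (grad (grad_sq f) x) = \sum_j F1_ j * (2 * \sum_i f1_ i * f2_ i j).
  rewrite dot_gradE; apply: eq_bigr => j _; rewrite (pd_grad_sq j f2 Ox).
  by congr (_ * (2 * _)); apply: eq_bigr => i _; rewrite /f2_ mxE.
have E3 : dot (grad (laplacian_g F f) x) (grad f x) =
    \sum_i (\sum_j f3_ i j - \sum_j (F1_ j * f2_ j i + f1_ j * F2_ i j)) * f1_ i.
  rewrite dot_gradE; apply: eq_bigr => i _; rewrite (pd_laplacian_g i F2 f3 Ox).
  congr ((_ - _) * _); apply: eq_bigr => j _; by rewrite /f2_ mxE.
have E4 : quad (hess F x) (grad f x) = \sum_i \sum_j F2_ j i * f1_ i * f1_ j.
  by apply: eq_bigr => i _; apply: eq_bigr => j _; rewrite !mxE.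
rewrite E3 E4; transitivity (\sum_j 2 * (\sum_i (f2_ i j ^+ 2 + f1_ i * f3_ i j)) -
  \sum_j F1_ j * (2 * \sum_i f1_ i * f2_ i j)); last exact: bochner_sum.
by rewrite -E1 -E2.
Qed.

(** For [f = g = s] the right side is made of the cross term and the last term in the expansion of
    [|D^2 s - Ds Ds^T / s|^2], up to sign. *)
Lemma dot_grad_quotient f g x : Ck_bar 2 Omega f -> Ck_bar 1 Omega g -> Omega x -> g x != 0 ->
  dot (grad (fun y => grad_sq f y / g y) x) (grad f x) =
  2 * quad (hess f x) (grad f x) / g x - grad_sq f x * dot (grad g x) (grad f x) / g x ^+ 2.
Proof.
move=> f2 g1 Ox g0; rewrite dot_gradE.
have E j : pd j (fun y => grad_sq f y / g y) x =
   (2 * \sum_i pd i f x * pd j (pd i f) x) / g x - grad_sq f x * pd j g x / g x ^+ 2.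
  apply: is_derive_pdE; have H1 := pd_dot_grad j f2 f2 Ox; have H2 := Ck_bar_derive j g1 Ox.
  have H3 : is_derive x (delta_mx 0 j) (fun y => (g y)^-1) (- (g x ^- 2) *: pd j g x).
    by split; [apply: derivableV => //; case: H2|rewrite (@deriveV _ _ g) //; case: H2 => _ ->].
  have H4 := is_deriveM H1 H3; apply: is_derive_eq H4 _.
  rewrite (_ : \sum_i _ = 2 * \sum_i pd i f x * pd j (pd i f) x); last first.
    by rewrite mulr_sumr; apply: eq_bigr => i _; ring.
  rewrite /GRing.scale /= -/(grad_sq f x); move: (grad_sq f x) (pd j g x) => a b.
  move: (\sum_i _) => c; field => //.
under eq_bigr do rewrite E mulrBl.
rewrite sumrB dot_gradE /quad; congr (_ - _).
  rewrite exchange_big mulr_sumr mulr_suml; apply: eq_bigr => j _.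
  rewrite -!mulrA; congr (2 * _); rewrite mulr_suml mulr_suml; apply: eq_bigr => i _.
  by rewrite !mxE; ring.
by rewrite mulr_sumr mulr_suml; apply: eq_bigr => j _; ring.
Qed.

End bochner.

Section flux.
Context {R : realType} {d : nat} {Omega : set 'rV[R]_d} {F : 'rV[R]_d -> R}.
Context {n : 'rV[R]_d -> 'rV[R]_d} {sigma : {measure set 'rV[R]_d -> \bar R}}.
Hypotheses (Omega_open : open Omega) (Omega_convex : convex_set Omega).
Hypothesis Omega_C1 : C1_boundary_normal Omega n.
Hypothesis F0 : continuous_bar Omega F.
Implicit Types (f g h : 'rV[R]_d -> R).
Local Notation gi := (gintegrable Omega F).
Local Notation rint := (gint_fin Omega F).

Lemma cvg_within_ext f g (x : 'rV[R]_d) (l : R) : (forall y, Omega y -> f y = g y) ->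
  g @ within Omega (nbhs x) --> l -> f @ within Omega (nbhs x) --> l.
Proof. by move=> fg gl; apply: cvg_trans gl; exact: near_within. Qed.

Definition neumann h := forall x, boundary Omega x -> trace Omega (fun y => dot (grad h y) (n x)) x = 0.

Lemma boundary_fluxE g h x : continuous_bar Omega g -> Ck_bar 1 Omega h -> boundary Omega x ->
  boundary_flux Omega F n g h x =
  trace Omega g x * trace Omega (fun y => dot (grad h y) (n x)) x * expR (- trace Omega F x).
Proof.
move=> cg h1 [cx nOx]; have FF := within_closure_proper cx.
apply: trace_eq => //; apply: cvgM.
  apply: cvgM; first exact: (cg x cx).
  rewrite trace_dot//; apply: cvg_sumr => i; apply: cvgM; last exact: cvg_cst.
  rewrite (_ : (fun t => grad h t 0 i) = pd i h); first exact: (Ck_bar0 (Ck_bar_pd i h1) cx).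
  by apply/funext => y; rewrite mxE.
apply: (@cvg_trace_comp _ _ _ F (fun y => expR (- y))); first exact: (F0 cx).
by apply: for_continuous_comp; [exact: opp_continuous|exact: continuous_expR].
Qed.

Lemma boundary_flux_neumann g h x : continuous_bar Omega g -> Ck_bar 1 Omega h -> neumann h ->
  boundary Omega x -> boundary_flux Omega F n g h x = 0.
Proof. by move=> cg h1 hn bx; rewrite boundary_fluxE// hn// mulr0 mul0r. Qed.

(** The normal derivative of [|Dh|^2] is [2 (D^2 h Dh, n)], whose sign is the content of
    [convex_boundary_hess]. *)
Lemma boundary_flux_grad_sq_le0 h x : Ck_bar 2 Omega h -> neumann h -> boundary Omega x ->
  boundary_flux Omega F n (cst 1) (grad_sq h) x <= 0.
Proof.
move=> h2 hn bx; have [cx nOx] := bx; have FF := within_closure_proper cx.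
have h1 := Ck_bar_pred h2.
have c1 : continuous_bar Omega (cst 1) by exact: (Ck_bar0 (Ck_bar_cst Omega_open 0 1)).
have g1 : Ck_bar 1 Omega (grad_sq h) by exact: Ck_bar_dot_grad.
rewrite boundary_fluxE// pmulr_lle0 ?expR_gt0//.
rewrite (trace_eq (l := 1) cx); last exact: cvg_cst.
rewrite mul1r trace_dot//.
have -> : \sum_i trace Omega (pd i (grad_sq h)) x * n x 0 i =
  2 * \sum_i (\sum_j trace Omega (pd j (pd i h)) x * trace Omega (pd j h) x) * n x 0 i.
  rewrite mulr_sumr; apply: eq_bigr => i _; rewrite mulrA; congr (_ * _).
  apply: trace_eq => //.
  apply: (@cvg_within_ext _ (fun y => 2 * \sum_j pd j (pd i h) y * pd j h y)).
    move=> y Oy; rewrite (pd_grad_sq i h2 Oy); congr (2 * _); apply: eq_bigr => j _.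
    by rewrite (pd_pdC Omega_open i j h2 Oy) mulrC.
  apply: cvgM; first exact: cvg_cst.
  apply: cvg_sumr => j; apply: cvgM; last exact: (Ck_bar0 (Ck_bar_pd j h1) cx).
  exact: (Ck_bar0 (Ck_bar_pd j (Ck_bar_pd i h2)) cx).
rewrite pmulr_rle0//.
exact: (convex_boundary_hess Omega_open Omega_convex Omega_C1 h2 hn bx).
Qed.

Lemma green_flux0 f h : green Omega F n sigma f h ->
  (forall x, boundary Omega x -> boundary_flux Omega F n f h x = 0) ->
  [/\ gi (fun x => f x * laplacian_g F h x), gi (fun x => dot (grad f x) (grad h x)) &
      rint (fun x => f x * laplacian_g F h x) = - rint (fun x => dot (grad f x) (grad h x))].
Proof.
have mO := measurable_open Omega_open.
move=> [I1 I2 _ E] H; split => //.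
apply: EFin_inj; rewrite EFinN -!gintE// [LHS]E integral0_eq ?adde0//.
by move=> x bx; rewrite H.
Qed.

Lemma green_flux_le0 f h : green Omega F n sigma f h ->
  (forall x, boundary Omega x -> boundary_flux Omega F n f h x <= 0) ->
  rint (fun x => f x * laplacian_g F h x) <= - rint (fun x => dot (grad f x) (grad h x)).
Proof.
have mO := measurable_open Omega_open.
move=> [I1 I2 I3 E] H.
have mB : measurable (boundary Omega).
  by apply: measurableD; [apply: measurable_closed; exact: closed_closure|exact: mO].
rewrite -lee_fin EFinN -!gintE// [leLHS]E.
apply: (@le_trans _ _ (- gint Omega F (fun x => dot (grad f x) (grad h x)) + 0)%E).
  rewrite leeD2l// -(integral0 sigma (boundary Omega)).
  apply: le_integral => //; first exact: integrable0.
  by move=> x; rewrite inE => bx; rewrite lee_fin; exact: H.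
by rewrite adde0.
Qed.

End flux.

(** * The square-root variable *)

Section root_variable.
Context {R : realType} {d : nat} {Omega : set 'rV[R]_d} {F : 'rV[R]_d -> R}.
Context {n : 'rV[R]_d -> 'rV[R]_d} {v : R -> 'rV[R]_d -> R} {p : R}.
Hypothesis Omega_open : open Omega.
Hypothesis v_sol : smooth_positive_solution Omega F n v.
Hypothesis p_gt0 : 0 < p.

Definition root_var (t : R) (x : 'rV[R]_d) : R := v t x `^ (p / 2).
Local Notation s := root_var.

Lemma sol_C3 (t : R) : 0 < t -> Ck_bar 3 Omega (v t).
Proof. by case: v_sol => -[v3 _ _] _ _ _; exact: Ck_bar_evol_slice. Qed.

Lemma sol_dt_C1 (t : R) : 0 < t -> Ck_bar 1 Omega (dt v t).
Proof. by case: v_sol => -[_ _ v3] _ _ _; exact: Ck_bar_evol_slice. Qed.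

Lemma sol_pos (t : R) : 0 < t -> bar_pos (Omega := Omega) (v t).
Proof. by move=> t0; case: v_sol => _ [p1 p2] _ _; split=> x; [exact: p1|exact: p2]. Qed.

Lemma sol_gt0 (t : R) x : 0 < t -> Omega x -> 0 < v t x.
Proof. by move=> /sol_pos[H _]; exact: H. Qed.

Lemma sol_eq (t : R) x : 0 < t -> Omega x -> dt v t x = laplacian_g F (v t) x.
Proof. by case: v_sol => _ _ H _; exact: H. Qed.

Lemma sol_neumann (t : R) : 0 < t -> neumann (Omega := Omega) (n := n) (v t).
Proof. by move=> t0; case: v_sol => _ _ _ H x; exact: H. Qed.

Lemma sol_is_derive (t : R) x : 0 < t -> Omega x -> is_derive t 1 (fun tau => v tau x) (dt v t x).
Proof. by case: v_sol => -[_ vt _] _ _ _ t0 Ox; apply: is_derive_dt; exact: vt. Qed.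

Lemma root_C3 (t : R) : 0 < t -> Ck_bar 3 Omega (s t).
Proof. by move=> t0; apply: Ck_bar_pow => //; [exact: sol_C3|exact: sol_pos]. Qed.

Lemma root_pos (t : R) : 0 < t -> bar_pos (Omega := Omega) (s t).
Proof. by move=> t0; apply: bar_pos_pow => //; [exact: (Ck_bar0 (sol_C3 t0))|exact: sol_pos]. Qed.

Lemma root_gt0 (t : R) x : 0 < t -> Omega x -> 0 < s t x.
Proof. by move=> /root_pos[H _]; exact: H. Qed.

Lemma root_pd (t : R) x i : 0 < t -> Omega x ->
  pd i (s t) x = p / 2 * v t x `^ (p / 2 - 1) * pd i (v t) x.
Proof.
by move=> t0 Ox; apply: is_derive_pdE; exact: (pow_derive _ _ (sol_C3 t0) (sol_pos t0) Ox).
Qed.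

Lemma root_is_derive_dt (t : R) x : 0 < t -> Omega x ->
  is_derive t 1 (fun tau => s tau x) (p / 2 * v t x `^ (p / 2 - 1) * dt v t x).
Proof.
move=> t0 Ox.
exact: (is_derive_comp_real (sol_is_derive t0 Ox) (is_derive_powR (p / 2) (sol_gt0 t0 Ox))).
Qed.

Lemma root_dt (t : R) x : 0 < t -> Omega x ->
  dt s t x = p / 2 * v t x `^ (p / 2 - 1) * dt v t x.
Proof. by move=> t0 Ox; rewrite /dt derive1E; have [_] := root_is_derive_dt t0 Ox. Qed.

Lemma root_dt_C1 (t : R) : 0 < t -> Ck_bar 1 Omega (dt s t).
Proof.
move=> t0; apply: (@Ck_bar_ext _ _ _ Omega_open 1 (fun x => p / 2 * v t x `^ (p / 2 - 1) * dt v t x)).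
  by move=> y Oy; rewrite root_dt.
apply: (Ck_barM Omega_open); last exact: sol_dt_C1.
apply: (Ck_barZ Omega_open); apply: (Ck_bar_pow Omega_open); last exact: sol_pos.
exact: (Ck_bar_le (isT : 1 <= 3)%N (sol_C3 t0)).
Qed.

Lemma root_neumann (t : R) : 0 < t -> neumann (Omega := Omega) (n := n) (s t).
Proof.
move=> t0 x bx; have [cx nOx] := bx; have FF := within_closure_proper cx.
have v1 := Ck_bar_le (isT : 1 <= 3)%N (sol_C3 t0).
apply: trace_eq => //.
apply: (@cvg_within_ext _ _ _ _ (fun y => p / 2 * v t y `^ (p / 2 - 1) * dot (grad (v t) y) (n x))).
  move=> y Oy; rewrite /dot mulr_sumr; apply: eq_bigr => i _.
  by rewrite !mxE root_pd// !mulrA.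
rewrite -[X in _ --> X](mulr0 (trace Omega (fun y => p / 2 * v t y `^ (p / 2 - 1)) x)).
apply: cvgM.
  apply: Ck_bar0 cx; apply: (Ck_barZ Omega_open); apply: (Ck_bar_pow Omega_open); last exact: sol_pos.
  exact: v1.
rewrite -(sol_neumann t0 bx) trace_dot//; apply: cvg_sumr => i; apply: cvgM; last exact: cvg_cst.
rewrite (_ : (fun t => grad _ t 0 i) = pd i (v t)); first exact: (Ck_bar0 (Ck_bar_pd i v1) cx).
by apply/funext => y; rewrite mxE.
Qed.

Lemma powR_pred (a x : R) : 0 < x -> x `^ (a - 1) = x `^ a / x.
Proof. by move=> x0; rewrite powRB ?(gt_eqF x0) ?implybT// powRr1// ltW. Qed.

(** Differentiating the power twice puts [(p/2) (p/2 - 1) v^(p/2 - 2) |Dv|^2 = (1 - 2/p) |Ds|^2 / s]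
    into [Delta_g s]; the added term cancels it. *)
Lemma root_equation (t : R) x : 0 < t -> Omega x ->
  dt s t x = laplacian_g F (s t) x + (2 / p - 1) * (grad_sq (s t) x / s t x).
Proof.
move=> t0 Ox; have v0 := sol_gt0 t0 Ox.
have v3 := sol_C3 t0.
rewrite root_dt// sol_eq// /laplacian_g /grad_sq !dot_gradE.
have E2 i : pd i (pd i (s t)) x = p / 2 * ((p / 2 - 1) * (v t x `^ (p / 2 - 1) / v t x) * pd i (v t) x ^+ 2 + v t x `^ (p / 2 - 1) * pd i (pd i (v t)) x).
  rewrite (@pd_ext _ _ _ Omega_open _ (fun x => p / 2 * v t x `^ (p / 2 - 1) * pd i (v t) x)) //; last first.
    by move=> y Oy; exact: root_pd.
  apply: is_derive_pdE.
  have H1 := pow_derive (p / 2 - 1) i v3 (sol_pos t0) Ox.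
  have H2 := Ck_bar_derive i (Ck_bar_pd i v3) Ox.
  have H3 := is_deriveM H1 H2.
  have H4 : is_derive x (delta_mx 0 i) (fun y => p / 2 * (v t y `^ (p / 2 - 1) * pd i (v t) y)) (p / 2 * ((p / 2 - 1) * (v t x `^ (p / 2 - 1) / v t x) * pd i (v t) x ^+ 2 + v t x `^ (p / 2 - 1) * pd i (pd i (v t)) x)).
    have H5 := is_deriveZ (p / 2) H3; apply: (is_derive_eq H5).
    by rewrite /GRing.scale /= (powR_pred (p / 2 - 1) v0); ring.
  move: H4; congr is_derive; apply/funext => y; exact: mulrA.
under [in RHS]eq_bigr do rewrite E2.
under [X in _ - X + _]eq_bigr do rewrite root_pd//.
have -> : \sum_i pd i (s t) x * pd i (s t) x = \sum_i p / 2 * v t x `^ (p / 2 - 1) * pd i (v t) x * (p / 2 * v t x `^ (p / 2 - 1) * pd i (v t) x).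
  by apply: eq_bigr => i _; rewrite root_pd.
rewrite -mulr_sumr big_split /= -2!mulr_sumr.
have -> : \sum_i pd i F x * (p / 2 * v t x `^ (p / 2 - 1) * pd i (v t) x) =
   p / 2 * v t x `^ (p / 2 - 1) * \sum_i pd i F x * pd i (v t) x.
  by rewrite mulr_sumr; apply: eq_bigr => i _; rewrite mulrCA.
have -> : \sum_i p / 2 * v t x `^ (p / 2 - 1) * pd i (v t) x * (p / 2 * v t x `^ (p / 2 - 1) * pd i (v t) x) =
   (p / 2 * v t x `^ (p / 2 - 1)) ^+ 2 * \sum_i pd i (v t) x ^+ 2.
  by rewrite mulr_sumr; apply: eq_bigr => i _; ring.
(* With every power written through [w = v^(p/2)] and [v], a rational identity remains. *)
rewrite /s (powR_pred (p / 2) v0).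
have V0 : 0 < v t x `^ (p / 2) by rewrite powR_gt0.
move: (v t x `^ (p / 2)) V0 => w w0.
field; by rewrite !gt_eqF.
Qed.

Lemma root_dt_pd (t : R) x i : 0 < t -> Omega x ->
  is_derive t 1 (fun tau => pd i (s tau) x) (pd i (dt s t) x).
Proof.
move=> t0 Ox; have [[v3 vt dv1] _ _ _] := v_sol.
have -> : pd i (dt s t) x = p / 2 * v t x `^ (p / 2 - 1) * pd i (dt v t) x +
    pd i (v t) x * (p / 2 * ((p / 2 - 1) * v t x `^ (p / 2 - 1 - 1) * dt v t x)).
  rewrite (@pd_ext _ _ _ Omega_open _ (fun x => p / 2 * v t x `^ (p / 2 - 1) * dt v t x)) //; last first.
    by move=> y Oy; exact: root_dt.
  apply: is_derive_pdE.
  have H1 : is_derive x (delta_mx 0 i) (fun y => p / 2 * v t y `^ (p / 2 - 1))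
      (p / 2 * ((p / 2 - 1) * v t x `^ (p / 2 - 1 - 1) * pd i (v t) x)).
    exact: (is_deriveZ (p / 2) (pow_derive (p / 2 - 1) i (sol_C3 t0) (sol_pos t0) Ox)).
  have H2 := Ck_bar_derive i (sol_dt_C1 t0) Ox.
  have H3 := is_deriveM H1 H2; apply: (is_derive_eq H3).
  by rewrite /GRing.scale /=; ring.
have H1 : is_derive t 1 (fun tau => p / 2 * v tau x `^ (p / 2 - 1)) (p / 2 * ((p / 2 - 1) * v t x `^ (p / 2 - 1 - 1) * dt v t x)).
  have := is_derive_comp_real (sol_is_derive t0 Ox) (is_derive_powR (p / 2 - 1) (sol_gt0 t0 Ox)).
  exact: is_deriveZ.
have H2 := dt_pdC Omega_open i (And3 v3 vt dv1) t0 Ox.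
apply: (is_derive_near _ (is_deriveM H1 H2)).
have : \forall tau \near t, 0 < tau by exact: lt_nbhsr.
by apply: filterS => tau tau0; rewrite root_pd.
Qed.

Lemma root_dt_grad_sq (t : R) x : 0 < t -> Omega x ->
  dt (fun t => grad_sq (s t)) t x = 2 * dot (grad (dt s t) x) (grad (s t) x).
Proof.
move=> t0 Ox; rewrite /dt derive1E.
have H : is_derive t 1 (fun tau => \sum_i pd i (s tau) x * pd i (s tau) x)
  (\sum_i (pd i (s t) x * pd i (dt s t) x + pd i (s t) x * pd i (dt s t) x)).
  by apply: is_derive_sumr => i; have Hi := root_dt_pd i t0 Ox; exact: is_deriveM.
rewrite (_ : (fun tau => grad_sq _ x) = (fun tau => \sum_i pd i (s tau) x * pd i (s tau) x)); last first.
  by apply/funext => tau; rewrite /grad_sq dot_gradE.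
have [_ ->] := H; rewrite dot_gradE mulr_sumr; apply: eq_bigr => i _; ring.
Qed.

End root_variable.

(** * The potential V and the spectral inequality *)

Section potential.
Context {R : realType} {d : nat} (hd : (0 < d)%N) {Omega : set 'rV[R]_d} {F : 'rV[R]_d -> R}.
Hypotheses (Omega_open : open Omega) (F_C2 : Ck_bar 2 Omega F).
Implicit Types (x xi : 'rV[R]_d) (A : 'M[R]_d).

Lemma norm_coord_unit xi i : dot xi xi = 1 -> `|xi 0 i| <= 1.
Proof.
move=> H; rewrite -(ler_pXn2r (ltn0Sn 1)) ?nnegrE// expr1n real_normK ?num_real// -H.
by rewrite /dot (bigD1 i)//= expr2 lerDl sumr_ge0// => j _; rewrite -expr2 sqr_ge0.
Qed.

Lemma quad_lbound A xi : dot xi xi = 1 -> - (\sum_i \sum_j `|A i j|) <= quad A xi.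
Proof.
move=> H; rewrite lerNl; apply: le_trans (ler_norm _) _; rewrite normrN.
apply: le_trans (ler_norm_sum _ _ _) _; apply: ler_sum => i _.
apply: le_trans (ler_norm_sum _ _ _) _; apply: ler_sum => j _.
rewrite !normrM -mulrA ler_piMr// -[leRHS]mulr1 ler_pM//; exact: norm_coord_unit.
Qed.

(** The real [inf] in [V] is meaningful because [d > 0] makes the unit sphere nonempty and the
    entries of [A] bound the form on it. *)
Lemma has_inf_quad A : has_inf [set q : R | exists xi, dot xi xi = 1 /\ q = quad A xi].
Proof.
split; last first.
  by exists (- (\sum_i \sum_j `|A i j|)) => _ [xi [H ->]]; exact: quad_lbound.
pose e : 'rV[R]_d := delta_mx 0 (Ordinal hd).
exists (quad A e), e; split => //.
rewrite /dot (bigD1 (Ordinal hd))//= big1 ?addr0 => [|j jd]; first by rewrite !mxE !eqxx mulr1.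
by rewrite !mxE (negbTE jd) mulr0.
Qed.

Lemma quadZ A c xi : quad A (c *: xi) = c ^+ 2 * quad A xi.
Proof.
rewrite /quad mulr_sumr; apply: eq_bigr => i _; rewrite mulr_sumr; apply: eq_bigr => j _.
rewrite !mxE; ring.
Qed.

Lemma V_quad x xi : V F x * dot xi xi <= quad (hess F x) xi.
Proof.
have [->|xi0] := eqVneq xi 0.
  by rewrite -(scale0r 0) quadZ dotZr expr0n/= !mul0r mulr0.
have g0 := dot_gt0 xi0; have s0 : 0 < Num.sqrt (dot xi xi) by rewrite sqrtr_gt0.
have H : V F x <= quad (hess F x) ((Num.sqrt (dot xi xi))^-1 *: xi).
  apply: ge_inf; first by case: (has_inf_quad (hess F x)).
  eexists; split; last reflexivity.
  rewrite dotZr dotZl -{3}(sqr_sqrtr (ltW g0)); field; exact: lt0r_neq0.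
rewrite quadZ exprVn sqr_sqrtr ?(ltW g0)// in H.
by rewrite -ler_pdivlMr// mulrC.
Qed.

Lemma hess_continuous x i j : Omega x -> {for x, continuous (fun y => hess F y i j)}.
Proof.
move=> Ox; rewrite (_ : (fun y => _) = pd j (pd i F)); last by apply/funext => y; rewrite mxE.
exact: (Ck_bar_continuous Omega_open (Ck_bar_pd j (Ck_bar_pd i F_C2))).
Qed.

(** As an infimum of continuous functions, [V] is upper semicontinuous: a unit vector witnessing
    [V F x < a] is a witness near [x] as well. *)
Lemma measurable_V : measurable_fun Omega (V F).
Proof.
apply: measurable_fun_open_lt => // a; rewrite openE => x [Ox /= Vx].
have [_ [xi [u ->]] qa] := inf_lt (has_inf_quad (hess F x)).1 Vx.
have cq : {for x, continuous (fun y => quad (hess F y) xi)}.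
  have cs (k : nat) (f : 'I_k -> 'rV[R]_d -> R) : (forall i, {for x, continuous (f i)}) ->
      {for x, continuous (fun y => \sum_i f i y)}.
    by move=> H; apply: (@cvg_sumr _ _ (nbhs x) _ _ f (fun i => f i x)).
  apply: (cs d (fun i y => \sum_j hess F y i j * xi 0 i * xi 0 j)) => i.
  apply: (cs d (fun j y => hess F y i j * xi 0 i * xi 0 j)) => j; apply: for_continuousM; last exact: cst_continuous.
  by apply: for_continuousM; last exact: cst_continuous; exact: hess_continuous.
have : \forall y \near x, Omega y /\ quad (hess F y) xi < a.
  apply: filterI; first exact: open_near.
  by move: cq; move/(_ [set r : R | r < a]); apply; exact: lt_nbhsl.
apply: (@filterS _ (nbhs x)) => y [Oy ya]; split; first exact: Oy.
apply: le_lt_trans ya; apply: ge_inf; last by exists xi.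
by case: (has_inf_quad (hess F y)).
Qed.

End potential.

(** On [K] the weight is at least [e^{-M}], so the finite mass of gamma bounds the volume of [K]. *)
Lemma weight_lty_compact {R : realType} {d : nat} {Omega : set 'rV[R]_d} {F : 'rV[R]_d -> R} :
  open Omega -> (forall x, Omega x -> {for x, continuous F}) ->
  (lebesgue_rV R d).-integrable Omega (fun x => (expR (- F x))%:E) ->
  forall K, compact K -> K `<=` Omega -> (lebesgue_rV R d K < +oo)%E.
Proof.
move=> oO cF gL1 K cK KO.
have mK := measurable_closed (compact_closed_rV cK); have mO := measurable_open oO.
have [M HM] := compact_bound cK (fun x Kx => cF x (KO x Kx)).
have H : ((expR (- M))%:E * lebesgue_rV R d K < +oo)%E.
  rewrite -integral_cst//; apply: le_lt_trans (integrable_lty mO gL1).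
  have mw : measurable_fun Omega (fun x => (expR (- F x))%:E) by case/integrableP: gL1.
  apply: (@le_trans _ _ (\int[lebesgue_rV R d]_(x in K) (expR (- F x))%:E)%E).
    apply: ge0_le_integral => //.
    - by move=> x _; rewrite lee_fin expR_ge0.
    - exact: measurable_funS mw.
    - by move=> x Kx; rewrite lee_fin ler_expR lerN2 (le_trans (ler_norm _) (HM x Kx)).
  by apply: ge0_subset_integral => // x _; rewrite lee_fin expR_ge0.
move: H; case: (lebesgue_rV R d K) => [r| |] H; [exact: ltry| |by rewrite ltNye].
by move: H; rewrite gt0_muley ?lte_fin ?expR_gt0// ltxx.
Qed.

Section spectral.
Context {R : realType} {d : nat} (hd : (0 < d)%N) {Omega : set 'rV[R]_d} {F : 'rV[R]_d -> R}.
Context {n : 'rV[R]_d -> 'rV[R]_d} {sigma : {measure set 'rV[R]_d -> \bar R}}.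
Hypotheses (Omega_open : open Omega) (F_C2 : Ck_bar 2 Omega F).
Hypothesis sigma_surface : surface_measure Omega n sigma.
Hypothesis lty_compact : forall K, compact K -> K `<=` Omega -> (lebesgue_rV R d K < +oo)%E.
Context {p lam : R}.
Hypotheses (hp : 1 <= p <= 2) (lam_le : (lam%:E <= lambda1 Omega F p)%E).
Implicit Types f : 'rV[R]_d -> R.
Local Notation gi := (gintegrable Omega F).
Local Notation gint := (gint Omega F).
Local Notation rint := (gint_fin Omega F).

Let mO : measurable Omega := measurable_open Omega_open.
Let mF : measurable_fun Omega F.
Proof.
by apply: continuous_open_measurable => // x; exact: (Ck_bar_continuous Omega_open F_C2).
Qed.

Definition hess_sq f x : R := \sum_i \sum_j hess f x i j ^+ 2.

(** The test function is [w = pd i f]. Nothing bounds [V] from below, so only the positive part of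
    the numerator is integrable at first. This makes its integral meaningful in [[-oo, +oo[], hence
    admissible in [lambda1], and the resulting lower bound excludes [-oo]. *)
Lemma spectral_coord f i : Ck_bar 3 Omega f -> gi (grad_sq f) -> gi (hess_sq f) ->
  gi (fun x => quad (hess F x) (grad f x)) ->
  let num x := 2 * ((p - 1) / p) * dot (grad (pd i f) x) (grad (pd i f) x) + V F x * pd i f x ^+ 2 in
  gi num /\ lam * rint (fun x => pd i f x ^+ 2) <= rint num.
Proof.
move=> f3 If Ih Iq num; have /andP[p1 p2] := hp.
have p0 : 0 < p by apply: lt_le_trans p1.
have c0 : 0 <= 2 * ((p - 1) / p) by rewrite mulr_ge0// divr_ge0 ?subr_ge0// ltW.
have mc k g : Ck_bar k Omega g -> measurable_fun Omega g.
  by move=> gk; apply: continuous_open_measurable => // x; exact: (Ck_bar_continuous Omega_open gk).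
have mw := mc _ _ (Ck_bar_pd i f3).
have mV := measurable_V hd Omega_open F_C2.
have mg : measurable_fun Omega (fun x => dot (grad (pd i f) x) (grad (pd i f) x)).
  have H := Ck_bar_pd i f3; exact: mc (Ck_bar_dot_grad Omega_open H H).
have w2_le x : pd i f x ^+ 2 <= grad_sq f x.
  rewrite /grad_sq dot_gradE (bigD1 i)//= expr2 lerDl sumr_ge0// => j _.
  by rewrite -expr2 sqr_ge0.
have g_le x : dot (grad (pd i f) x) (grad (pd i f) x) <= hess_sq f x.
  rewrite dot_gradE /hess_sq [leRHS](bigD1 i)//=.
  rewrite (eq_bigr (fun j => hess f x i j ^+ 2)) => [|j _]; last by rewrite mxE expr2.
  by rewrite lerDl sumr_ge0// => k _; apply: sumr_ge0 => j _; rewrite sqr_ge0.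
have Iw : gi (fun x => pd i f x ^+ 2).
  apply: (gi_le mO mF _ _ If); first by apply: measurable_funX.
  by move=> x _; rewrite ger0_norm ?sqr_ge0.
have Ig : gi (fun x => dot (grad (pd i f) x) (grad (pd i f) x)).
  by apply: (gi_le mO mF _ _ Ih) => // x _; rewrite ger0_norm ?dot_ge0.
have mnum : measurable_fun Omega num.
  apply: measurable_funD; first by apply: measurable_funM.
  by apply: measurable_funM => //; apply: measurable_funX.
have Ipos : gi (fun x => Num.max (num x) 0).
  apply: (gi_le mO mF _ _ (giD mO (giZ mO (2 * ((p - 1) / p)) Ih) (g := fun x => `|quad (hess F x) (grad f x)|) _)).
  - by apply: measurable_maxr.
  - move=> x Ox; rewrite ger0_norm ?le_max ?lexx ?orbT// ge_max; apply/andP; split.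
      rewrite /num lerD ?ler_wpM2l//.
      (* Where [V >= 0], one has [V (pd i f)^2 <= V |Df|^2 <= (D^2 F Df, Df)]; where [V < 0] the
         term can only help. *)
      have [V0|V0] := leP 0 (V F x).
        apply: le_trans (ler_norm _); apply: le_trans (V_quad hd x _).
        by rewrite ler_wpM2l// w2_le.
      by apply: le_trans (normr_ge0 _); rewrite mulr_le0_ge0 ?sqr_ge0// ltW.
    rewrite addr_ge0// mulr_ge0//; apply: le_trans (g_le x); exact: dot_ge0.
  - have := integrable_abse Iq; apply: eq_integrable => // x _.
    by rewrite /= normrM [`|expR _|]ger0_norm// expR_ge0.
have Hdef : gint_defined Omega F num.
  by split => //; left; rewrite (gintE mO Ipos).
have HH : H1 Omega F (pd i f) (grad (pd i f)).
  split => //; apply: (weak_grad_classical Omega_open lty_compact sigma_surface).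
  exact: (Ck_bar_C1 Omega_open (Ck_bar_pd i f3)).
have ub : (gint num < +oo)%E.
  apply: (@le_lt_trans _ _ (gint (fun x => Num.max (num x) 0))); last by rewrite (gintE mO Ipos) ltry.
  rewrite /gint integralE -[leRHS]sube0; apply: leeB; last exact: integral_ge0.
  apply: ge0_le_integral => //.
  - by apply: measurable_funepos; apply: (measurable_weighted mF).
  - by apply: (measurable_weighted mF); apply: measurable_maxr.
  - move=> x _; rewrite funeposE -EFin_max lee_fin ge_max; apply/andP; split.
      by rewrite ler_wpM2r ?expR_ge0// le_max lexx.
    by rewrite mulr_ge0 ?expR_ge0// le_max lexx orbT.
have lb : ((lam * rint (fun x => pd i f x ^+ 2))%:E <= gint num)%E.
  (* If the denominator of the quotient vanishes, so does the [V]-part of the numerator. *)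
  have [D0|D0] := eqVneq (gint (fun x => pd i f x ^+ 2)) 0%E.
    rewrite {1}/gint_fin D0 /= mulr0.
    have N0 : ae_eq (lebesgue_rV R d) Omega (fun x => (pd i f x ^+ 2 * expR (- F x))%:E) (cst 0%E).
      apply/ae_eq_integral_abs => //; first by case/integrableP: Iw.
      rewrite -D0; apply: eq_integral => x _.
      by rewrite gee0_abs// lee_fin mulr_ge0 ?expR_ge0 ?sqr_ge0.
    rewrite /gint (@ae_eq_integral _ _ _ _ _
      (fun x => (2 * ((p - 1) / p) * dot (grad (pd i f) x) (grad (pd i f) x) * expR (- F x))%:E))//.
    - apply: integral_ge0 => x _; rewrite lee_fin mulr_ge0 ?expR_ge0// mulr_ge0//; exact: dot_ge0.
    - exact: measurable_weighted.
    - by apply: measurable_weighted => //; apply: measurable_funM.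
    - apply: filterS N0 => x /[apply] -[] /eqP; rewrite mulf_eq0 (gt_eqF (expR_gt0 _)) orbF => /eqP E.
      by rewrite /num E mulr0 addr0.
  have q : (lam%:E <= gint num * ((fine (gint (fun x => (pd i f x ^+ 2)%R)))^-1)%:E)%E.
    apply: le_trans lam_le _; apply: ereal_inf_lbound.
    by exists (pd i f), (grad (pd i f)).
  have r0 : 0 < rint (fun x => pd i f x ^+ 2).
    rewrite lt_neqAle rint_ge0 ?andbT => [|x _]; last exact: sqr_ge0.
    by apply: contra D0 => /eqP E; rewrite (gintE mO Iw) -E.
  by rewrite EFinM -lee_pdivlMr.
(* The upper bound comes from the positive part, the lower one from [lambda1]. *)
have fin : gint num \is a fin_num.
  by rewrite fin_numElt ub andbT (lt_le_trans _ lb)// ltNyr.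
have Inum : gi num.
  apply/integrableP; split; first exact: measurable_weighted.
  have [H _] := @abse_integralP _ _ R (lebesgue_rV R d) Omega _ mO (measurable_weighted mF mnum).
  by apply: H; rewrite -fin_num_abs.
split => //; rewrite -lee_fin; apply: le_trans lb _.
by rewrite (gintE mO Inum).
Qed.

Lemma hess_sq_sum f x : hess_sq f x = \sum_i dot (grad (pd i f) x) (grad (pd i f) x).
Proof.
apply: eq_bigr => i _; rewrite dot_gradE; apply: eq_bigr => j _; by rewrite mxE expr2.
Qed.

Lemma grad_sq_sum f x : grad_sq f x = \sum_i pd i f x ^+ 2.
Proof. by rewrite /grad_sq dot_gradE; apply: eq_bigr => i _; rewrite expr2. Qed.

(** Summed over the coordinates, the energies of the functions [pd i f] give [|D^2 f|^2] and their
    squares give [|Df|^2]; only then is [V |Df|^2] bounded by the Hessian form of [F]. *)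
Lemma lambda_bound f : Ck_bar 3 Omega f -> gi (grad_sq f) -> gi (hess_sq f) ->
  gi (fun x => quad (hess F x) (grad f x)) ->
  lam * rint (grad_sq f) <= rint (fun x => (2 - 2 / p) * hess_sq f x + quad (hess F x) (grad f x)).
Proof.
move=> f3 If Ih Iq.
have p0 : p != 0 by rewrite gt_eqF//; case/andP: hp => p1 _; lra.
have S i := spectral_coord i f3 If Ih Iq.
have Iw i : gi (fun x => pd i f x ^+ 2).
  apply: (gi_le mO mF _ _ If).
    have := Ck_bar_pd i f3 => H; apply: measurable_funX; apply: continuous_open_measurable => // x.
    exact: (Ck_bar_continuous Omega_open H).
  move=> x _; rewrite ger0_norm ?sqr_ge0// grad_sq_sum (bigD1 i)//= lerDl sumr_ge0// => j _.
  exact: sqr_ge0.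
rewrite (rint_ext (g := fun x => \sum_i pd i f x ^+ 2)) => [|x _]; last exact: grad_sq_sum.
rewrite (rint_sum mO)// mulr_sumr.
apply: (@le_trans _ _ (rint (fun x => \sum_i
  (2 * ((p - 1) / p) * dot (grad (pd i f) x) (grad (pd i f) x) + V F x * pd i f x ^+ 2)))).
  rewrite (rint_sum mO) => [|i]; last by have [] := S i.
  by apply: ler_sum => i _; have [] := S i.
apply: (rint_le mO).
- by apply: (gi_sum mO) => i; have [] := S i.
- by apply: (giD mO) => //; apply: (giZ mO).
- move=> x _; rewrite big_split/= -!mulr_sumr -hess_sq_sum -grad_sq_sum lerD//; last exact: V_quad.
  by rewrite (_ : 2 * ((p - 1) / p) = 2 - 2 / p)//; field.
Qed.

End spectral.

(** Gronwall's argument: [f e^(k t)] has a nonpositive derivative. It compares two positive times,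
    as no derivative is known at 0; the rate [k = 0] gives plain monotonicity. *)
Lemma exp_decay {R : realType} (f : R -> R) (k : R) :
  (forall t : R, 0 < t -> exists2 D, is_derive t 1 f D & D <= - (k * f t)) ->
  forall r t : R, 0 < r -> r <= t -> f t * expR (k * t) <= f r * expR (k * r).
Proof.
move=> H; pose P (t D : R) := is_derive t 1 f D /\ D <= - (k * f t).
(* [xget] gathers the derivatives into one function; its default value concerns times [t <= 0]
   only. *)
pose D (t : R) : R := xget 0 (P t).
have DP (t : R) : 0 < t -> P t (D t).
  by move=> t0; have [D0 H1 H2] := H t t0; apply: (@xgetPex _ 0 (P t)); exists D0.
have De (t : R) : is_derive t 1 (fun t : R => expR (k * t)) (expR (k * t) * k).
  have Hk : is_derive t 1 (fun t : R => k * t) k.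
    have Hk := is_deriveZ k (is_derive_id t (1 : R)); apply: (is_derive_eq Hk).
    by rewrite /GRing.scale/= mulr1.
  exact: (is_derive_comp_real Hk (is_derive_expR _)).
have main := @nonincreasing_derive R (fun t => f t * expR (k * t))
  (fun t => f t * (expR (k * t) * k) + expR (k * t) * D t) 0.
apply: main => t t0.
  by have Hm := is_deriveM (DP t t0).1 (De t); exact: Hm.
rewrite mulrCA -mulrDr pmulr_rle0 ?expR_gt0//.
by have [_] := DP t t0; lra.
Qed.

(** * Dissipation of the Fisher information *)

(** The difference of the two sides is the squared norm of the matrix [D^2 f - Df Df^T / c]. *)
Lemma hess_defect_ge0 {R : realType} {d : nat} (f : 'rV[R]_d -> R) (x : 'rV[R]_d) (c : R) : c != 0 ->
  2 * quad (hess f x) (grad f x) / c - grad_sq f x ^+ 2 / c ^+ 2 <= hess_sq f x.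
Proof.
move=> c0; rewrite -subr_ge0.
have -> : hess_sq f x - (2 * quad (hess f x) (grad f x) / c - grad_sq f x ^+ 2 / c ^+ 2) =
  \sum_i \sum_j (hess f x i j - pd i f x * pd j f x / c) ^+ 2.
  rewrite /hess_sq /quad grad_sq_sum [in _ ^+ 2 / _]expr2 big_distrlr/= mulr_sumr !mulr_suml -!sumrB.
  apply: eq_bigr => i _; rewrite mulr_sumr !mulr_suml -!sumrB; apply: eq_bigr => j _.
  by rewrite !mxE; field.
by apply: sumr_ge0 => i _; apply: sumr_ge0 => j _; exact: sqr_ge0.
Qed.

(** Here [a] stands for [2/p]: a fraction [a - 1] of the Hessian term [h] pays for [X], and [2 - a]
    is left. The sign condition is [p <= 2]. *)
Lemma hess_defect_scaled {R : realDomainType} (a h q X : R) : 0 <= a - 1 -> X <= h ->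
  (2 - a) * h + q <= h + q - (a - 1) * X.
Proof. nra. Qed.

Section fisher_dissipation.
Context {R : realType} {d : nat} (hd : (0 < d)%N) {Omega : set 'rV[R]_d} {F : 'rV[R]_d -> R}.
Context {n : 'rV[R]_d -> 'rV[R]_d} {sigma : {measure set 'rV[R]_d -> \bar R}}.
Hypotheses (Omega_open : open Omega) (Omega_convex : convex_set Omega).
Hypothesis Omega_C1 : C1_boundary_normal Omega n.
Hypothesis sigma_surface : surface_measure Omega n sigma.
Hypothesis F_C2 : Ck_bar 2 Omega F.
Hypothesis lty_compact : forall K, compact K -> K `<=` Omega -> (lebesgue_rV R d K < +oo)%E.
Context {p lam : R} {v : R -> 'rV[R]_d -> R}.
Hypothesis hp : 1 <= p <= 2.
Hypothesis v_sol : smooth_positive_solution Omega F n v.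
Hypothesis v_adequate : adequate Omega F n sigma p v.
Local Notation gi := (gintegrable Omega F).
Local Notation rint := (gint_fin Omega F).
Local Notation s := (@root_var R d v p).

Let mO : measurable Omega := measurable_open Omega_open.
Let p_gt0 : 0 < p. Proof. by case/andP: hp => p1 _; apply: lt_le_trans p1. Qed.
Let F0 : continuous_bar Omega F := Ck_bar0 F_C2.

Definition root_energy (t : R) : R := rint (grad_sq (s t)).

Lemma root_energy_gi (t : R) : 0 < t -> gi (grad_sq (s t)).
Proof. by move=> t0; case: v_adequate => _ /(_ t t0)[]. Qed.

Lemma fisher_root (t : R) : 0 < t -> fisher Omega F p (v t) = (4 / p * root_energy t)%:E.
Proof.
move=> t0; have s3 := root_C3 (p := p) Omega_open v_sol t0.
apply: (fisher_classical Omega_open lty_compact sigma_surface) => //.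
- exact: (Ck_bar_C1 Omega_open F_C2).
- exact: (Ck_bar_C1 Omega_open s3).
- by move=> i; apply: (Ck_bar_C1 Omega_open); exact: (Ck_bar_pd i s3).
- exact: root_energy_gi.
Qed.

Lemma adequate_root_green (t : R) : 0 < t ->
  [/\ green Omega F n sigma (dt s t) (s t), green Omega F n sigma (laplacian_g F (s t)) (s t),
      green Omega F n sigma (fun x => grad_sq (s t) x / s t x) (s t) &
      green Omega F n sigma (cst 1) (grad_sq (s t))].
Proof. by case: v_adequate => _ _ H _; exact: H. Qed.

Lemma adequate_root_gi (t : R) : 0 < t ->
  [/\ gi (hess_sq (s t)), gi (fun x => quad (hess F x) (grad (s t) x)) &
      gi (fun x => grad_sq (s t) x ^+ 2 / s t x ^+ 2)].
Proof. by case: v_adequate => _ _ _ H; exact: H. Qed.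

(** One integration by parts turns the right side into the integral of [s_t Delta_g s]; the equation
    splits it into [(Delta_g s)^2], treated by Bochner's formula, and the term in [|Ds|^2 / s],
    treated by one more integration by parts. *)
Lemma root_laplacian_lower (t : R) : 0 < t ->
  gi (fun x => dot (grad (dt s t) x) (grad (s t) x)) /\
  rint (fun x => (2 - 2 / p) * hess_sq (s t) x + quad (hess F x) (grad (s t) x)) <=
  - rint (fun x => dot (grad (dt s t) x) (grad (s t) x)).
Proof.
move=> t0; have s3 := root_C3 (p := p) Omega_open v_sol t0; have s2 := Ck_bar_pred s3.
have s1 := Ck_bar_pred s2; have sn := root_neumann (p := p) Omega_open v_sol t0.
have s0 x : Omega x -> 0 < s t x := root_gt0 (p := p) Omega_open v_sol t0.
have [G1 G2 G3 G4] := adequate_root_green t0; have [I1 I2 I3] := adequate_root_gi t0.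
have Lc : continuous_bar Omega (laplacian_g F (s t)).
  by apply: (@Ck_bar0 _ _ _ 1); apply: (Ck_bar_laplacian Omega_open F_C2 s3).
have Sc : continuous_bar Omega (fun x => grad_sq (s t) x / s t x).
  apply: (@Ck_bar0 _ _ _ 1).
  apply: (@Ck_bar_ext _ _ _ Omega_open 1 (fun x => grad_sq (s t) x * s t x `^ (- 1))).
    by move=> x Ox; rewrite powR_inv1// (ltW (s0 x Ox)).
  apply: (Ck_barM Omega_open).
    by apply: (Ck_bar_dot_grad Omega_open s2 s2).
  exact: (Ck_bar_pow Omega_open (-1) s1 (root_pos Omega_open v_sol t0)).
have bn g : continuous_bar Omega g -> forall x, boundary Omega x -> boundary_flux Omega F n g (s t) x = 0.
  by move=> cg x; exact: boundary_flux_neumann.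
have [J1 K1 E1] := green_flux0 Omega_open G1 (bn _ (Ck_bar0 (root_dt_C1 (p := p) Omega_open v_sol t0))).
have [J2 K2 E2] := green_flux0 Omega_open G2 (bn _ Lc).
have [J3 K3 E3] := green_flux0 Omega_open G3 (bn _ Sc).
have E4 := green_flux_le0 Omega_open G4
  (fun x bx => boundary_flux_grad_sq_le0 Omega_open Omega_convex Omega_C1 F0 s2 sn bx).
have J4 : gi (fun x => cst 1 x * laplacian_g F (grad_sq (s t)) x) by case: G4.
split; first exact: K1.
rewrite -E1.
have -> : rint (fun x => dt s t x * laplacian_g F (s t) x) =
    rint (fun x => laplacian_g F (s t) x * laplacian_g F (s t) x) +
    (2 / p - 1) * rint (fun x => grad_sq (s t) x / s t x * laplacian_g F (s t) x).
  rewrite -(rintZ mO)// -(rintD mO)//; last exact: (giZ mO).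
  by apply: rint_ext => x Ox; rewrite (root_equation Omega_open v_sol p_gt0 t0 Ox) mulrDl mulrA.
(* The integral of [Delta_g |Ds|^2] is a boundary flux, hence nonpositive. In Bochner's formula the
   integral of [D (Delta_g s) . Ds] is minus that of [(Delta_g s)^2], which gives the bound. *)
have L : rint (hess_sq (s t)) + rint (fun x => quad (hess F x) (grad (s t) x)) <=
    rint (fun x => laplacian_g F (s t) x * laplacian_g F (s t) x).
  rewrite E2 lerNr -subr_le0 opprK; apply: le_trans (_ : _ <= 2^-1 * 0) _; last by rewrite mulr0.
  rewrite -ler_pdivrMl ?invr_gt0// invrK -(rintD mO)// -(rintD mO)//; last exact: (giD mO).
  rewrite -(rintZ mO); last by apply: (giD mO) => //; exact: (giD mO).
  rewrite (rint_ext (g := fun x => cst 1 x * laplacian_g F (grad_sq (s t)) x)).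
    apply: le_trans E4 _; rewrite (rint_ext (g := fun=> 0)) ?rint0 ?oppr0// => x _.
    by rewrite dot_gradE big1// => i _; rewrite /pd derive_cst mul0r.
  by move=> x Ox; rewrite /= mul1r (bochner Omega_open F_C2 s3 Ox); rewrite addrA [X in 2 * (X + _)]addrC.
(* This pointwise comparison is where the nonlinear term is absorbed by part of the Hessian. *)
have M : rint (fun x => (2 - 2 / p) * hess_sq (s t) x + quad (hess F x) (grad (s t) x)) <=
  rint (fun x => hess_sq (s t) x + quad (hess F x) (grad (s t) x) -
    (2 / p - 1) * dot (grad (fun y => grad_sq (s t) y / s t y) x) (grad (s t) x)).
  apply: (rint_le mO).
  - by apply: (giD mO) => //; apply: (giZ mO).
  - by apply: (giB mO); [apply: (giD mO)|apply: (giZ mO)].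
  - move=> x Ox; have sx := lt0r_neq0 (s0 x Ox).
    rewrite (dot_grad_quotient s2 s1 Ox sx) -/(grad_sq (s t) x) -expr2.
    have a0 : 0 <= 2 / p - 1 by rewrite subr_ge0 ler_pdivlMr// mul1r; case/andP: hp.
    exact: (hess_defect_scaled _ a0 (hess_defect_ge0 (s t) x sx)).
apply: le_trans M _; rewrite (rintB mO); last 2 first.
- exact: (giD mO).
- exact: (giZ mO).
by rewrite (rintD mO)// (rintZ mO)// E3 mulrN lerD2r.
Qed.

Lemma root_energy_derive (t : R) : (lam%:E <= lambda1 Omega F p)%E -> 0 < t ->
  exists2 D, is_derive t 1 root_energy D & D <= - (2 * lam * root_energy t).
Proof.
move=> lam_le t0; have [_ /(_ t t0)[I1 I2 D] _ _] := v_adequate.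
have [I3 I4 _] := adequate_root_gi t0.
have s3 := root_C3 (p := p) Omega_open v_sol t0.
have [K L] := root_laplacian_lower t0.
eexists; first exact: D.
rewrite -[leLHS]/(rint (dt (fun t => grad_sq (s t)) t)).
rewrite (rint_ext (g := fun x => 2 * dot (grad (dt s t) x) (grad (s t) x))) => [|x Ox]; last first.
  exact: (root_dt_grad_sq Omega_open v_sol).
rewrite (rintZ mO)// -mulrA -mulrN ler_wpM2l// lerNr.
apply: le_trans L.
exact: (lambda_bound hd Omega_open F_C2 sigma_surface lty_compact hp lam_le s3 I1 I3 I4).
Qed.

Lemma root_energy_decay : (lam%:E <= lambda1 Omega F p)%E -> forall (r t : R), 0 < r -> r <= t ->
  root_energy t * expR (2 * lam * t) <= root_energy r * expR (2 * lam * r).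
Proof. by move=> lam_le; apply: exp_decay => t; exact: root_energy_derive. Qed.

End fisher_dissipation.

(** * Entropy densities *)

Section real_functions.
Context {R : realType}.
Implicit Types (f : R -> R) (r M : R).

Lemma mean_value_pos f f1 (a b : R) : (forall r : R, 0 < r -> is_derive r 1 f (f1 r)) ->
  0 < a -> a <= b -> exists2 c, a <= c <= b & f b - f a = f1 c * (b - a).
Proof.
move=> D a0 ab.
have [] := @MVT_segment _ f f1 a b ab.
- by move=> x; rewrite in_itv/= => /andP[ax _]; apply: D; exact: lt_trans ax.
- apply: derivable_within_continuous => x; rewrite in_itv/= => /andP[ax _].
  by have [] := D x (lt_le_trans a0 ax).
by move=> c; rewrite in_itv/= => cab E; exists c.
Qed.

Lemma nondecreasing_pos f f1 : (forall r : R, 0 < r -> is_derive r 1 f (f1 r)) ->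
  (forall r : R, 0 < r -> 0 <= f1 r) -> forall a b : R, 0 < a -> a <= b -> f a <= f b.
Proof.
move=> D P a b a0 ab; have [c /andP[ac _] E] := mean_value_pos D a0 ab.
by rewrite -subr_ge0 E mulr_ge0 ?subr_ge0// P// (lt_le_trans a0).
Qed.

(** A convex function lies above its tangent at [a], here the zero line. It serves with [a = 1] for
    [psi], for [tail M] and for their difference. *)
Lemma convex_ge0 f f1 f2 (a : R) : 0 < a ->
  (forall r : R, 0 < r -> is_derive r 1 f (f1 r)) -> (forall r : R, 0 < r -> is_derive r 1 f1 (f2 r)) ->
  (forall r : R, 0 < r -> 0 <= f2 r) -> f a = 0 -> f1 a = 0 -> forall r : R, 0 < r -> 0 <= f r.
Proof.
move=> a0 D1 D2 P fa f1a r r0; have mono := nondecreasing_pos D2 P.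
have [ar|/ltW ra] := leP a r.
  have [c /andP[ac _] E] := mean_value_pos D1 a0 ar.
  have -> : f r = f1 c * (r - a) by rewrite -E fa subr0.
  by rewrite mulr_ge0 ?subr_ge0// -f1a mono.
have [c /andP[rc ca] E] := mean_value_pos D1 r0 ra.
have -> : f r = - (f1 c * (a - r)) by rewrite -E fa sub0r opprK.
by rewrite oppr_ge0 mulr_le0_ge0 ?subr_ge0// -f1a mono// (lt_le_trans r0).
Qed.

(** At the junction both one-sided quotients tend to 0, because [f] vanishes at [M] together with
    its derivative. *)
Lemma is_derive_glue f f1 M : (forall r : R, 0 < r -> is_derive r 1 f (f1 r)) ->
  f M = 0 -> f1 M = 0 -> forall r : R, 0 < r ->
  is_derive r 1 (fun r => if r <= M then 0 else f r) (if r <= M then 0 else f1 r).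
Proof.
move=> D fM f1M r r0; have [rM|Mr|rM] := ltgtP r M.
- have H0 : is_derive r 1 (fun=> 0 : R) 0 by exact: is_derive_cst.
  apply: (is_derive_near _ H0).
  by have : \forall y \near r, y < M by [exact: lt_nbhsl]; apply: filterS => y /ltW ->.
- apply: (is_derive_near _ (D r r0)).
  by have : \forall y \near r, M < y by [exact: lt_nbhsr]; apply: filterS => y; rewrite leNgt => ->.
rewrite rM; rewrite rM in r0; apply: is_derive_cvg => e e0.
have [D1 D2] := D M r0; rewrite f1M in D2.
have C : (fun h : R => h^-1 *: ((f \o shift M) (h *: (1 : R)) - f M)) @ 0^' --> (0 : R).
  by rewrite -[X in _ --> X]D2; exact: D1.
have K : \forall h \near (0 : R), h != 0 -> `|0 - h^-1 *: (f (h *: (1 : R) + M) - f M)| <= e.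
  by move/cvgrPdist_le: C => /(_ e e0).
apply: filterS K => h Hh.
rewrite lexx mulr0 !subr0; have [_|hM] := leP (h *: (1 : R) + M) M.
  by rewrite normr0 mulr_ge0// ltW.
have [h0|h0] := eqVneq h 0; first by move: hM; rewrite h0 scale0r add0r ltxx.
move: (Hh h0); rewrite fM sub0r subr0 normrN /GRing.scale/= normrM normfV ler_pdivrMl ?normr_gt0//.
by rewrite [`|h| * e]mulrC.
Qed.

End real_functions.

Section densities.
Context {R : realType} {p : R}.
Hypothesis hp : 1 <= p <= 2.
Implicit Types (r M : R).

Let p_gt0 : 0 < p. Proof. by case/andP: hp => p1 _; apply: lt_le_trans p1. Qed.

(** The same class as [subordinate_density], with the two derivatives as data: explicit formulas on
    the positive half-line take the place of [derive1]. *)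
Definition density (phi phi1 phi2 : R -> R) :=
  [/\ (forall r : R, 0 < r -> is_derive r 1 phi (phi1 r)),
      (forall r : R, 0 < r -> is_derive r 1 phi1 (phi2 r)),
      (forall r : R, 0 < r -> {for r, continuous phi2}) &
      exists C : R, forall r : R, 0 < r -> `|phi2 r| <= C * r `^ (p - 2)].

Lemma density_derive1 (phi phi1 : R -> R) r : (forall r : R, 0 < r -> is_derive r 1 phi (phi1 r)) ->
  0 < r -> derive1 phi r = phi1 r.
Proof. by move=> D r0; rewrite derive1E; case: (D r r0). Qed.

Lemma pos_near r : 0 < r -> \forall y \near r, 0 < y.
Proof. exact: lt_nbhsr. Qed.

Lemma density_derive2 (phi phi1 phi2 : R -> R) r : density phi phi1 phi2 -> 0 < r ->
  is_derive r 1 (derive1 phi) (phi2 r).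
Proof.
move=> [D1 D2 _ _] r0; apply: (@is_derive_near _ _ phi1); last exact: D2.
by have := pos_near r0; apply: filterS => y y0; rewrite (density_derive1 D1).
Qed.

Lemma density_subordinate (phi phi1 phi2 : R -> R) : density phi phi1 phi2 ->
  subordinate_density p phi.
Proof.
move=> H; have [D1 D2 c2 [C HC]] := H.
have E r : 0 < r -> derive1 (derive1 phi) r = phi2 r.
  by move=> r0; rewrite derive1E; case: (density_derive2 H r0).
split.
- by move=> r r0; case: (D1 r r0).
- by move=> r r0; case: (density_derive2 H r0).
- move=> r r0; apply: (@near_continuous _ _ phi2); last exact: c2.
  by have := pos_near r0; apply: filterS => y y0; rewrite E.
- by exists C => r r0; rewrite E// HC.
Qed.

Lemma density_id : density id (cst 1) (cst 0).
Proof.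
split.
- by move=> r _; exact: is_derive_id.
- by move=> r _; exact: is_derive_cst.
- by move=> r _; exact: cst_continuous.
- by exists 0 => r _; rewrite normr0 mul0r.
Qed.

Definition psi (r : R) : R :=
  if p == 1 then r * ln r - (r - 1) else (p - 1)^-1 * (r `^ p - 1 - p * (r - 1)).
Definition psi1 (r : R) : R := if p == 1 then ln r else (p - 1)^-1 * (p * r `^ (p - 1) - p).
Definition psi2 (r : R) : R := p * r `^ (p - 2).

Lemma psi_derive r : 0 < r -> is_derive r 1 psi (psi1 r).
Proof.
move=> r0; rewrite /psi1; have [p1|p1] := eqVneq p 1.
  rewrite (_ : psi = fun r => r * ln r - (r - 1)); last by apply/funext => y; rewrite /psi p1 eqxx.
  have H := is_deriveB (is_deriveM (is_derive_id r 1) (is_derive1_ln r0))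
    (is_deriveB (is_derive_id r (1 : R)) (is_derive_cst (1 : R) r 1)).
  apply: (is_derive_eq H); rewrite /GRing.scale/= divff ?gt_eqF//; ring.
rewrite (_ : psi = fun r => (p - 1)^-1 * (r `^ p - 1 - p * (r - 1))); last first.
  by apply/funext => y; rewrite /psi (negbTE p1).
have H := is_deriveZ (p - 1)^-1 (is_deriveB
  (is_deriveB (is_derive1_powR p r0) (is_derive_cst (1 : R) r 1))
  (is_deriveZ p (is_deriveB (is_derive_id r (1 : R)) (is_derive_cst (1 : R) r 1)))).
by apply: (is_derive_eq H); rewrite /GRing.scale/= !subr0 mulr1.
Qed.

Lemma psi1_derive r : 0 < r -> is_derive r 1 psi1 (psi2 r).
Proof.
move=> r0; rewrite /psi2; have [p1|p1] := eqVneq p 1.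
  rewrite (_ : psi1 = @ln R); last by apply/funext => y; rewrite /psi1 p1 eqxx.
  apply: (is_derive_eq (is_derive1_ln r0)).
  by rewrite p1 mul1r (_ : 1 - 2 = - 1 :> R) ?powR_inv1 ?(ltW r0)//; ring.
rewrite (_ : psi1 = fun r => (p - 1)^-1 * (p * r `^ (p - 1) - p)); last first.
  by apply/funext => y; rewrite /psi1 (negbTE p1).
have H := is_deriveZ (p - 1)^-1 (is_deriveB (is_deriveZ p (is_derive1_powR (p - 1) r0))
  (is_derive_cst p r 1)).
apply: (is_derive_eq H); rewrite /GRing.scale/= subr0 (_ : p - 1 - 1 = p - 2); last by ring.
by field; rewrite subr_eq0.
Qed.

Lemma psi2_ge0 r : 0 <= psi2 r.
Proof. by rewrite mulr_ge0 ?powR_ge0// ltW. Qed.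

Lemma psi2_continuous r : 0 < r -> {for r, continuous psi2}.
Proof.
move=> r0; apply: for_continuousM; first exact: cst_continuous.
by apply: differentiable_continuous; apply/derivable1_diffP; case: (is_derive1_powR (p - 2) r0).
Qed.

Lemma density_psi : density psi psi1 psi2.
Proof.
split; [exact: psi_derive|exact: psi1_derive|exact: psi2_continuous|].
by exists p => r _; rewrite ger0_norm ?psi2_ge0.
Qed.

Lemma psi_at1 : psi 1 = 0.
Proof. by rewrite /psi ln1 powR1; case: eqP => _; ring. Qed.

Lemma psi1_at1 : psi1 1 = 0.
Proof. by rewrite /psi1 ln1 powR1; case: eqP => _ //; ring. Qed.

Lemma psi_ge0 r : 0 < r -> 0 <= psi r.
Proof.
apply: (convex_ge0 ltr01 psi_derive psi1_derive) => [? _||]; [exact: psi2_ge0|exact: psi_at1|exact: psi1_at1].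
Qed.

(* The density of [p = 1] is the smallest one, and Young's inequality
   [A r <= r ln r - r + e^A] applies to it. *)
Lemma psi_superlinear (A : R) r : 0 < r -> A * r <= psi r + expR A.
Proof.
move=> r0.
have young : A * r <= r * ln r - (r - 1) + expR A.
  have := @expR_ge1Dx _ (A - ln r); rewrite expRB lnK ?posrE// ler_pdivlMr//; nra.
apply: le_trans young _; rewrite lerD2r /psi; have [//|p1] := eqVneq p 1.
have p1' : 0 < p - 1 by rewrite subr_gt0 lt_neqAle eq_sym p1; case/andP: hp.
rewrite ler_pdivlMl// (_ : r `^ p = r * r `^ (p - 1)); last first.
  by rewrite -{2}(powRr1 (ltW r0)) -powRD ?(gt_eqF r0) ?implybT//; congr (_ `^ _); ring.
have := @expR_ge1Dx _ ((p - 1) * ln r); rewrite /powR (gt_eqF r0); nra.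
Qed.

(* The factor [1 - (M/r)^3] vanishes at [M], and the antiderivatives of
   [r^(p-2) (M/r)^3] are powers for every p in [[1, 2]]. *)
Definition cut (M r : R) : R := M ^+ 3 * p / ((p - 4) * (p - 3)) * r `^ (p - 3).
Definition cut1 (M r : R) : R := M ^+ 3 * p / (p - 4) * r `^ (p - 4).
Definition cut2 (M r : R) : R := M ^+ 3 * p * r `^ (p - 5).

(** The function [psi'' (1 - (M/r)^3)] integrated twice from [M] and continued by 0 below [M]. The
    vanishing factor makes the junction of class [C^2], as required of a density. *)
Definition tail M r : R := if r <= M then 0 else
  psi r - cut M r - (psi M - cut M M) - (psi1 M - cut1 M M) * (r - M).
Definition tail1 M r : R := if r <= M then 0 else psi1 r - cut1 M r - (psi1 M - cut1 M M).
Definition tail2 M r : R := if r <= M then 0 else psi2 r - cut2 M r.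

Lemma cut_derive M r : 0 < r -> is_derive r 1 (cut M) (cut1 M r).
Proof.
move=> r0; have H := is_deriveZ (M ^+ 3 * p / ((p - 4) * (p - 3))) (is_derive1_powR (p - 3) r0).
apply: (is_derive_eq H); rewrite /GRing.scale/= (_ : p - 3 - 1 = p - 4); last by ring.
rewrite /cut1; field; case/andP: hp => p1 p2; apply/andP; split; apply/eqP; lra.
Qed.

Lemma cut1_derive M r : 0 < r -> is_derive r 1 (cut1 M) (cut2 M r).
Proof.
move=> r0; have H := is_deriveZ (M ^+ 3 * p / (p - 4)) (is_derive1_powR (p - 4) r0).
apply: (is_derive_eq H); rewrite /GRing.scale/= (_ : p - 4 - 1 = p - 5); last by ring.
rewrite /cut2; field; case/andP: hp => p1 p2; apply/eqP; lra.
Qed.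

Lemma cut2E M r : 0 < r -> cut2 M r = psi2 r * (M / r) ^+ 3.
Proof.
move=> r0; rewrite /cut2 /psi2 (_ : p - 5 = p - 2 - 3); last by ring.
rewrite powRB ?(gt_eqF r0) ?implybT// (_ : r `^ 3 = r ^+ 3); last by rewrite -powR_mulrn ?(ltW r0).
by field; exact: lt0r_neq0.
Qed.

(** The lower bound is convexity, which makes the integrals of [tail M] nonincreasing in time; the
    upper one gives the growth condition of a density and the comparison with [psi]. *)
Lemma tail2_bounds M r : 0 < M -> 0 < r -> 0 <= tail2 M r <= psi2 r.
Proof.
move=> M0 r0; rewrite /tail2; have [_|Mr] := leP r M; first by rewrite lexx psi2_ge0.
have P := psi2_ge0 r.
have q0 : 0 <= (M / r) ^+ 3 by rewrite exprn_ge0// divr_ge0// ltW.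
have q1 : (M / r) ^+ 3 <= 1 by rewrite exprn_ile1// ?divr_ge0 ?(ltW M0) ?(ltW r0)// ler_pdivrMr// mul1r ltW.
rewrite cut2E//; apply/andP; split; nra.
Qed.

Lemma tail_derive M r : 0 < M -> 0 < r -> is_derive r 1 (tail M) (tail1 M r).
Proof.
move=> M0; apply: (@is_derive_glue _
  (fun r => psi r - cut M r - (psi M - cut M M) - (psi1 M - cut1 M M) * (r - M))
  (fun r => psi1 r - cut1 M r - (psi1 M - cut1 M M))) => [y y0||]; [|by ring..].
have H := is_deriveB (is_deriveB (is_deriveB (psi_derive y0) (cut_derive M y0))
    (is_derive_cst (psi M - cut M M) y 1))
  (is_deriveZ (psi1 M - cut1 M M) (is_deriveB (is_derive_id y (1 : R)) (is_derive_cst M y 1))).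
by apply: (is_derive_eq H); rewrite /GRing.scale/= !subr0 mulr1.
Qed.

Lemma tail1_derive M r : 0 < M -> 0 < r -> is_derive r 1 (tail1 M) (tail2 M r).
Proof.
move=> M0; apply: (@is_derive_glue _ (fun r => psi1 r - cut1 M r - (psi1 M - cut1 M M))
  (fun r => psi2 r - cut2 M r)) => [y y0||].
- have H := is_deriveB (is_deriveB (psi1_derive y0) (cut1_derive M y0))
    (is_derive_cst (psi1 M - cut1 M M) y 1).
  by apply: (is_derive_eq H); rewrite subr0.
- by ring.
- by rewrite cut2E// divff ?gt_eqF// expr1n mulr1 subrr.
Qed.

Lemma density_tail M : 0 < M -> density (tail M) (tail1 M) (tail2 M).
Proof.
move=> M0; split.
- by move=> r; exact: tail_derive.
- by move=> r; exact: tail1_derive.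
- move=> r r0; pose G y := psi2 y - cut2 M y.
  have GM : G M = 0 by rewrite /G cut2E// divff ?gt_eqF// expr1n mulr1 subrr.
  (* As [G M = 0], the definition by cases is a composition of continuous functions. *)
  rewrite (_ : tail2 M = fun y => G (Num.max y M)); last first.
    by apply/funext => y; rewrite /tail2 /G maxEle; case: ifP => // _; rewrite -/(G M) GM.
  have mx0 : 0 < Num.max r M by rewrite lt_max r0.
  apply: (@continuous_comp _ _ _ (fun y => Num.max y M) G).
    by apply: continuous_max; [exact: cvg_id|exact: cst_continuous].
  apply: for_continuousD; first exact: psi2_continuous.
  apply: (@continuousN _ _ _ (cut2 M)).
  apply: for_continuousM; first exact: cst_continuous.
  by apply: differentiable_continuous; apply/derivable1_diffP; case: (is_derive1_powR (p - 5) mx0).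
- exists p => r r0; have /andP[t0 t1] := tail2_bounds M0 r0.
  by rewrite ger0_norm.
Qed.

Lemma tail_ge0 M r : 1 <= M -> 0 < r -> 0 <= tail M r.
Proof.
move=> M1; have M0 := lt_le_trans ltr01 M1.
apply: (convex_ge0 ltr01 (fun r => @tail_derive M r M0) (fun r => @tail1_derive M r M0)).
- by move=> y y0; have /andP[] := tail2_bounds M0 y0.
- by rewrite /tail M1.
- by rewrite /tail1 M1.
Qed.

Lemma psi_tail_derive M r : 0 < M -> 0 < r ->
  is_derive r 1 (fun r => psi r - tail M r) (psi1 r - tail1 M r).
Proof. by move=> M0 r0; have H := is_deriveB (psi_derive r0) (tail_derive M0 r0); exact: H. Qed.

Lemma psi_tail1_derive M r : 0 < M -> 0 < r ->
  is_derive r 1 (fun r => psi1 r - tail1 M r) (psi2 r - tail2 M r).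
Proof. by move=> M0 r0; have H := is_deriveB (psi1_derive r0) (tail1_derive M0 r0); exact: H. Qed.

Lemma tail_le_psi M r : 1 <= M -> 0 < r -> tail M r <= psi r.
Proof.
move=> M1 r0; have M0 := lt_le_trans ltr01 M1; rewrite -subr_ge0; move: r r0.
apply: (convex_ge0 ltr01 (fun r => @psi_tail_derive M r M0) (fun r => @psi_tail1_derive M r M0)).
- by move=> y y0; have /andP[] := tail2_bounds M0 y0; rewrite subr_ge0.
- by rewrite /tail M1 psi_at1 subrr.
- by rewrite /tail1 M1 psi1_at1 subrr.
Qed.

(** The difference [psi - tail M] grows at most linearly. Below 1, [psi r <= 1 - r]; above 1, its
    slope is at most [psi1 M - cut1 M M], because [psi1] increases and [cut1] is nonpositive. So
    convergence in [L^1] controls the part of the entropy that the tail leaves out. *)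
Lemma psi_le_tail M : 1 <= M -> exists2 C : R, 0 <= C & forall r : R, 0 < r -> psi r <= tail M r + C * `|r - 1|.
Proof.
move=> M1; have M0 := lt_le_trans ltr01 M1.
have c1_le0 r : 0 < r -> cut1 M r <= 0.
  move=> r0; rewrite /cut1 mulr_le0_ge0 ?powR_ge0// mulr_ge0_le0 ?mulr_ge0 ?exprn_ge0 ?(ltW M0) ?(ltW p_gt0)//.
  by rewrite invr_le0; case/andP: hp => _ p2; lra.
have mono := nondecreasing_pos psi1_derive (fun r _ => psi2_ge0 r).
pose C := psi1 M - cut1 M M.
have P0 : 0 <= psi1 M by rewrite -psi1_at1; exact: mono.
have C0 : 0 <= C by rewrite subr_ge0; apply: le_trans P0; exact: c1_le0.
exists (1 + C) => [|r r0]; first by rewrite addr_ge0.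
have [r1|r1] := leP r 1.
  rewrite ler0_norm ?subr_le0// opprB.
  have T0 := tail_ge0 M1 r0.
  suff : psi r <= 1 - r by nra.
  rewrite /psi; case: eqP => [_|/eqP p1].
    have := ln_le0 r1; nra.
  have p1' : 0 < p - 1 by rewrite subr_gt0 lt_neqAle eq_sym p1; case/andP: hp.
  rewrite ler_pdivrMl//.
  have : r `^ p <= r.
    rewrite -{2}(powRr1 (ltW r0)) ger_powR ?r0//; lra.
  lra.
rewrite ger0_norm ?subr_ge0 ?(ltW r1)//.
have [c /andP[c1 cr] E] := mean_value_pos (fun r => @psi_tail_derive M r M0) ltr01 (ltW r1).
have c0 : 0 < c by apply: lt_le_trans c1.
suff : psi1 c - tail1 M c <= C.
  move: E; rewrite psi_at1 {2}/tail M1 subr0 subr0 => E.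
  move=> H; rewrite -lerBlDl E ler_wpM2r ?subr_ge0 ?(ltW r1)//; lra.
rewrite /tail1; have [cM|Mc] := leP c M.
  rewrite subr0; apply: (le_trans (mono _ _ c0 cM)).
  by have := c1_le0 _ M0; rewrite /C; lra.
by have := c1_le0 _ c0; rewrite /C; lra.
Qed.

End densities.

(** * Dissipation of the entropy *)

Section entropy_dissipation.
Context {R : realType} {d : nat} {Omega : set 'rV[R]_d} {F : 'rV[R]_d -> R}.
Context {n : 'rV[R]_d -> 'rV[R]_d} {sigma : {measure set 'rV[R]_d -> \bar R}}.
Hypothesis Omega_open : open Omega.
Hypothesis F_C2 : Ck_bar 2 Omega F.
Context {p : R} {v : R -> 'rV[R]_d -> R}.
Hypothesis hp : 1 <= p <= 2.
Hypothesis v_sol : smooth_positive_solution Omega F n v.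
Hypothesis v_adequate : adequate Omega F n sigma p v.
Local Notation gi := (gintegrable Omega F).
Local Notation rint := (gint_fin Omega F).
Local Notation s := (@root_var R d v p).

Let mO : measurable Omega := measurable_open Omega_open.
Let p_gt0 : 0 < p. Proof. by case/andP: hp => p1 _; apply: lt_le_trans p1. Qed.
Let F0 : continuous_bar Omega F := Ck_bar0 F_C2.

(** Differentiating under the integral gives [phi'(v) Delta_g v], and the Neumann condition removes
    the flux in Green's formula. Mass, entropy and tails are all instances. *)
Lemma density_dissipation (phi phi1 phi2 : R -> R) (t : R) : density (p := p) phi phi1 phi2 -> 0 < t ->
  [/\ gi (fun x => phi (v t x)), gi (fun x => phi2 (v t x) * grad_sq (v t) x) &
      is_derive t 1 (fun tau => rint (fun x => phi (v tau x)))
        (- rint (fun x => phi2 (v t x) * grad_sq (v t) x))].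
Proof.
move=> H t0; have [D1 D2 C2 _] := H.
have [v_adq _ _ _] := v_adequate.
have [/(_ t t0)[I1 I2 D] /(_ t t0) G] := v_adq _ (density_subordinate H).
have v3 := sol_C3 v_sol t0; have v1 := Ck_bar_le (isT : 1 <= 3)%N v3.
have v0 x : Omega x -> 0 < v t x := sol_gt0 v_sol t0.
have flux x : boundary Omega x -> boundary_flux Omega F n (fun x => derive1 phi (v t x)) (v t) x = 0.
  apply: boundary_flux_neumann => //; last exact: (sol_neumann v_sol t0).
  move=> y cy; apply/cvg_ex; exists (derive1 phi (trace Omega (v t) y)).
  apply: cvg_trace_comp; first exact: (Ck_bar0 v3 cy).
  have tr0 := bar_pos_trace Omega_open (Ck_bar0 v3) (sol_pos v_sol t0) cy.
  by apply: differentiable_continuous; apply/derivable1_diffP; case: (density_derive2 H tr0).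
have [J1 J2 E] := green_flux0 Omega_open G flux.
have E2 x : Omega x -> dot (grad (fun x => derive1 phi (v t x)) x) (grad (v t) x) =
    phi2 (v t x) * grad_sq (v t) x.
  move=> Ox; rewrite /grad_sq !dot_gradE mulr_sumr; apply: eq_bigr => i _.
  rewrite (is_derive_pdE (is_derive_comp_real (Ck_bar_derive i v3 Ox) (density_derive2 H (v0 x Ox)))).
  by rewrite mulrA.
split; [exact: I1|exact: gi_ext J2|].
rewrite -(rint_ext E2) -E; apply: (is_derive_eq D).
apply: (rint_ext (F := F)) => x Ox; rewrite -(sol_eq v_sol t0 Ox) (density_derive1 D1 (v0 x Ox)).
rewrite /dt [LHS]derive1E.
by have [_] := is_derive_comp_real (sol_is_derive v_sol t0 Ox) (D1 _ (v0 x Ox)).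
Qed.

Lemma sol_gi (t : R) : 0 < t -> gi (v t).
Proof. by move=> t0; have [] := density_dissipation (@density_id R p) t0. Qed.

Definition entropy_value (t : R) : R := rint (fun x => psi (p := p) (v t x)).

Lemma entropy_gi (t : R) : 0 < t -> gi (fun x => psi (p := p) (v t x)).
Proof. by move=> t0; have [] := density_dissipation (density_psi hp) t0. Qed.

Lemma entropyE w : entropy Omega F p w = gint Omega F (fun x => psi (p := p) (w x)).
Proof. by rewrite /entropy /psi; case: eqP. Qed.

Lemma entropy_valueE (t : R) : 0 < t -> entropy Omega F p (v t) = (entropy_value t)%:E.
Proof. by move=> t0; rewrite entropyE gintE//; exact: entropy_gi. Qed.

Lemma entropy_value_ge0 (t : R) : 0 < t -> 0 <= entropy_value t.
Proof. by move=> t0; apply: rint_ge0 => x Ox; rewrite psi_ge0// (sol_gt0 v_sol). Qed.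

(** From [Ds = (p/2) v^(p/2 - 1) Dv] follows [psi2 v |Dv|^2 = (4/p) |Ds|^2]. *)
Lemma entropy_derive (t : R) : 0 < t -> is_derive t 1 entropy_value (- (4 / p * root_energy (Omega := Omega) (F := F) (p := p) (v := v) t)).
Proof.
move=> t0; have [_ _ D] := density_dissipation (density_psi hp) t0.
apply: (is_derive_eq D); congr (- _); rewrite /root_energy -(rintZ mO); last first.
  exact: (root_energy_gi v_adequate).
apply: rint_ext => x Ox; rewrite !grad_sq_sum !mulr_sumr; apply: eq_bigr => i _.
rewrite (root_pd v_sol i t0 Ox) /psi2 !exprMn.
have -> : v t x `^ (p - 2) = (v t x `^ (p / 2 - 1)) ^+ 2.
  by rewrite -powR_mulrn ?powR_ge0// -powRrM; congr (_ `^ _); field.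
by field; exact: lt0r_neq0.
Qed.

Lemma density_nonincreasing (phi phi1 phi2 : R -> R) : density (p := p) phi phi1 phi2 ->
  (forall r, 0 < r -> 0 <= phi2 r) -> forall r t : R, 0 < r -> r <= t ->
  rint (fun x => phi (v t x)) <= rint (fun x => phi (v r x)).
Proof.
move=> H P; have main := @nonincreasing_derive R (fun t => rint (fun x => phi (v t x)))
  (fun t => - rint (fun x => phi2 (v t x) * grad_sq (v t) x)) 0.
apply: main => t t0; first by have [] := density_dissipation H t0.
rewrite oppr_le0; apply: rint_ge0 => x Ox; rewrite mulr_ge0 ?P ?(sol_gt0 v_sol)//; exact: dot_ge0.
Qed.

(** Both [r] and [- r] are convex densities, so the mass is nonincreasing and nondecreasing. *)
Lemma mass_constant (r t : R) : 0 < r -> r <= t -> rint (v t) = rint (v r).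
Proof.
move=> r0 rt; apply/eqP; rewrite eq_le; apply/andP; split.
  by apply: (density_nonincreasing (@density_id R p)).
have t0 := lt_le_trans r0 rt.
rewrite -lerN2 -!(rintN mO); [|exact: sol_gi..].
have dN : density (p := p) (fun r => - r) (cst (-1)) (cst 0).
  split.
  - by move=> y _; have H := is_deriveN (is_derive_id y (1 : R)); exact: H.
  - by move=> y _; exact: is_derive_cst.
  - by move=> y _; exact: cst_continuous.
  - by exists 0 => y _; rewrite normr0 mul0r.
exact: (density_nonincreasing dN).
Qed.

End entropy_dissipation.

(** * A local L^1 Poincare inequality *)

Section translations.
Context {R : realType} {d : nat}.
Local Open Scope ereal_scope.

Lemma measurable_rV_add : measurable_fun [set: 'rV[R]_d * 'rV[R]_d] (fun z => z.1 + z.2)%R.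
Proof.
apply: measurable_fun_mx => i j; rewrite (_ : (fun z => _) = (fun z : 'rV[R]_d * 'rV[R]_d => (z.1 i j + z.2 i j)%R)).
  by apply: measurable_funD; (apply: (measurableT_comp (measurable_mx_coord _ _)));
    [exact: measurable_fst|exact: measurable_snd].
by apply/funext => z; rewrite mxE.
Qed.

Lemma measurable_rV_line (h : 'rV[R]_d) :
  measurable_fun [set: 'rV[R]_d * measurableTypeR R] (fun z => (z.2 : R) *: h + z.1)%R.
Proof.
apply: measurable_fun_mx => i j.
rewrite (_ : (fun z => _) = (fun z : 'rV[R]_d * measurableTypeR R => ((z.2 : R) * h i j + z.1 i j)%R)).
  apply: measurable_funD; first by apply: measurable_funM => //; exact: measurable_snd.
  by apply: (measurableT_comp (measurable_mx_coord _ _)); exact: measurable_fst.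
by apply/funext => z; rewrite !mxE.
Qed.

End translations.

(** The [l^1] norm of the gradient, dual to the sup norm of row vectors: it bounds [|Dw . h|] by
    [slope w] times [|h|]. *)
Definition slope {R : realType} {d : nat} (w : 'rV[R]_d -> R) (y : 'rV[R]_d) : R := \sum_i `|pd i w y|.

(** The oscillation between two points of [K], extended by zero so that Tonelli's theorem and
    translations apply on the whole space. *)
Definition spread {R : realType} {d : nat} (K : set 'rV[R]_d) (w : 'rV[R]_d -> R) (x y : 'rV[R]_d) : R :=
  `|(w \_ K) y - (w \_ K) x| * \1_K x * \1_K y.

Lemma slope_ge0 {R : realType} {d : nat} (w : 'rV[R]_d -> R) y : 0 <= slope w y.
Proof. exact: sumr_ge0. Qed.

Lemma spread_ge0 {R : realType} {d : nat} (K : set 'rV[R]_d) (w : 'rV[R]_d -> R) (x y : 'rV[R]_d) : 0 <= spread K w x y.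
Proof. by rewrite /spread !mulr_ge0// indicE ler0n. Qed.

Section poincare.
Context {R : realType} {d : nat} {Omega K : set 'rV[R]_d}.
Hypotheses (Omega_open : open Omega) (cK : compact K) (KO : K `<=` Omega) (K_convex : convex_set K).
Context {w : 'rV[R]_d -> R}.
Hypothesis w1 : C1_on Omega w.
Implicit Types (x y h : 'rV[R]_d).

Let mK : measurable K := measurable_closed (compact_closed_rV cK).
Let cw x : Omega x -> {for x, continuous w}.
Proof. by move=> Ox; exact: (C1_on_continuous Omega_open w1 Ox). Qed.

Lemma slope_continuous x : Omega x -> {for x, continuous (slope w)}.
Proof.
move=> Ox; apply: (@cvg_sumr _ _ (nbhs x) _ _ (fun i y => `|pd i w y|) (fun i => `|pd i w x|)) => i.
by apply: cvg_norm; have [_] := w1 i Ox.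
Qed.

Local Notation W := (slope w \_ K).

Let W_ge0 y : 0 <= W y.
Proof. by rewrite patchE; case: ifP => _; [exact: slope_ge0|exact: lexx]. Qed.

Let mW : measurable_fun setT W.
Proof.
apply: (measurable_restrictT (slope w) mK).1.
exact: measurable_funS (measurable_open Omega_open) KO (continuous_open_measurable Omega_open slope_continuous).
Qed.

(** The fundamental theorem of calculus along the segment, which convexity keeps in [K], where the
    extension by zero [W] agrees with the slope. *)
Lemma segment_slope x h : K x -> K (x + h) ->
  (`|w (x + h) - w x|%:E <= \int[@lebesgue_measure R]_(q in `[0%R, 1%R]) (`|h| * W (q *: h + x))%:E)%E.
Proof.
move=> Kx Kxh.
have Kq (q : R) : 0 <= q <= 1 -> K (q *: h + x).
  move=> q01; have -> : q *: h + x = q *: (x + h) + (1 - q) *: x.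
    by apply/rowP => i; rewrite !mxE; ring.
  exact: convex_comb.
pose phi (q : R) := w (q *: h + x); pose dphi (q : R) := dot (grad w (q *: h + x)) h.
have D (q : R) : 0 <= q <= 1 -> is_derive q 1 phi (dphi q).
  move=> /Kq Kx'; have H : is_derive (q *: h + x) h w (dphi q) := C1_on_dir h Omega_open w1 (KO Kx').
  exact: (is_derive_line _ _ _ _ _).1 H.
have lc (q : R) : {for q, continuous (fun q : R => q *: h + x)}.
  apply: cvgD; last exact: cvg_cst.
  by apply: cvgZr_tmp; exact: cvg_id.
have cphi (q : R) : 0 <= q <= 1 -> {for q, continuous phi}.
  by move=> /D[H _]; apply: differentiable_continuous; exact/derivable1_diffP.
have cdphi (q : R) : 0 <= q <= 1 -> {for q, continuous dphi}.
  move=> q01; apply: (@cvg_sumr _ _ (nbhs q) _ _ (fun i q => grad w (q *: h + x) 0 i * h 0 i)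
    (fun i => grad w (q *: h + x) 0 i * h 0 i)) => i.
  apply: cvgM; last exact: cvg_cst.
  rewrite mxE; apply: (@cvg_trans _ ((fun q => pd i w (q *: h + x)) @ q)).
    by apply: near_eq_cvg; near=> y; rewrite mxE.
  have [_ c] := w1 i (KO (Kq q q01)).
  exact: (@continuous_comp _ _ _ (fun q : R => q *: h + x) (pd i w) q (lc q) c).
have cin (f : R -> R) : (forall q : R, 0 <= q <= 1 -> {for q, continuous f}) -> {within `[0, 1], continuous f}.
  by move=> H; apply: continuous_in_subspaceT => q; rewrite inE/= in_itv/= => /H.
have E := @continuous_FTC2 R dphi phi 0 1 ltr01 (cin _ cdphi).
have {E} E : (\int[@lebesgue_measure R]_(q in `[0%R, 1%R]) (dphi q)%:E = (phi 1)%:E - (phi 0)%:E)%E.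
  apply: E.
  - split.
    + by move=> q; rewrite in_itv/= => /andP[/ltW q0 /ltW q1]; have [] := D q; rewrite ?q0.
    + by apply: cvg_at_right_filter; apply: cphi; rewrite lexx ler01.
    + by apply: cvg_at_left_filter; apply: cphi; rewrite lexx ler01.
  - move=> q; rewrite in_itv/= => /andP[/ltW q0 /ltW q1]; rewrite derive1E.
    by have [|_ ->] := D q; rewrite ?q0 ?q1.
have m01 : measurable (`[0, 1]%classic : set (measurableTypeR R)) by exact: measurable_itv.
have md : measurable_fun (`[0, 1]%classic : set (measurableTypeR R)) (dphi : measurableTypeR R -> R).
  by apply: subspace_continuous_measurable_fun => //; exact: cin.
have -> : `|w (x + h) - w x|%:E = `|\int[@lebesgue_measure R]_(q in `[0%R, 1%R]) (dphi q)%:E|%E.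
  have p1 : phi 1 = w (x + h) by rewrite /phi scale1r addrC.
  by rewrite E p1 /phi scale0r add0r.
apply: le_trans (le_abse_integral _ m01 _) _; first exact/measurable_EFinP.
apply: ge0_le_integral => //.
- by apply: measurableT_comp => //; exact/measurable_EFinP.
- apply/measurable_EFinP; apply: measurable_funM => //.
  apply: measurable_funTS; apply: (measurableT_comp mW).
  exact: (measurable_fun_pair2 (x : 'rV[R]_d) (measurable_rV_line h)).
- move=> q; rewrite /= in_itv/= => q01; rewrite lee_fin patchE ifT; last first.
    by rewrite inE; exact: Kq.
  apply: le_trans (norm_dot_le _ _) _; rewrite mulrC /slope.
  by under eq_bigr do rewrite mxE.
Unshelve. all: by end_near. Qed.


Local Notation w' := (w \_ K).

Let mw' : measurable_fun setT w'.
Proof.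
apply: (measurable_restrictT w mK).1.
exact: measurable_funS (measurable_open Omega_open) KO (continuous_open_measurable Omega_open cw).
Qed.

Local Notation D := (spread K w).

Let D_ge0 x y : 0 <= D x y := spread_ge0 K w x y.

Lemma measurable_spread d' (T : measurableType d') (a b : T -> 'rV[R]_d) : measurable_fun setT a -> measurable_fun setT b ->
  measurable_fun setT (fun z => D (a z) (b z)).
Proof.
move=> ma mb; have mi : measurable_fun setT (\1_K : 'rV[R]_d -> R) by exact: measurable_indic.
apply: measurable_funM; last exact: (measurableT_comp mi mb).
apply: measurable_funM; last exact: (measurableT_comp mi ma).
apply: (measurableT_comp (@normr_measurable R setT)).
by apply: measurable_funB; [exact: (measurableT_comp mw' mb)|exact: (measurableT_comp mw' ma)].
Qed.

Let mDt : measurable_fun setT (fun z : 'rV[R]_d * 'rV[R]_d => D z.1 (z.2 + z.1)).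
Proof.
apply: measurable_spread; first exact: measurable_fst.
rewrite (_ : (fun z => _) = (fun z : 'rV[R]_d * 'rV[R]_d => z.1 + z.2)); first exact: measurable_rV_add.
by apply/funext => z; exact: addrC.
Qed.

(** Integrate [segment_slope] in [x] and exchange the integrals: for each [q] the translation by
    [q h] leaves the integral of [W] unchanged. *)
Lemma translation_slope h : (\int[lebesgue_rV R d]_x (D x (h + x))%:E <=
  `|h|%:E * \int[lebesgue_rV R d]_x (W x)%:E)%E.
Proof.
pose f (z : 'rV[R]_d * measurableTypeR R) : \bar R :=
  (`|h| * W ((z.2 : R) *: h + z.1) * \1_(`[0, 1]%classic : set R) (z.2 : R))%:E.
have m01 : measurable (`[0, 1]%classic : set (measurableTypeR R)) by exact: measurable_itv.
have mf : measurable_fun setT f.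
  apply/measurable_EFinP; apply: measurable_funM.
    apply: measurable_funM => //; exact: (measurableT_comp mW (measurable_rV_line h)).
  have mi : measurable_fun setT (\1_(`[0, 1]%classic : set (measurableTypeR R)) : measurableTypeR R -> R).
    exact: measurable_indic.
  exact: (measurableT_comp mi measurable_snd).
have f0 z : (0 <= f z)%E by rewrite /f lee_fin !mulr_ge0// indicE ler0n.
apply: (@le_trans _ _ (\int[lebesgue_rV R d]_x \int[@lebesgue_measure R]_q f (x, q))%E).
  apply: ge0_le_integral => //.
  - by move=> x _; rewrite lee_fin.
  - apply/measurable_EFinP.
    exact: (measurable_fun_pair1 h mDt).
  - exact: measurable_fun_fubini_tonelli_F.
  - move=> x _; have [Kx|nKx] := pselect (K x); last first.
      rewrite /spread [\1_K x]indicE memNset// mulr0 mul0r; exact: integral_ge0.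
    have [Kxh|nKx] := pselect (K (h + x)); last first.
      by rewrite /spread [\1_K (h + x)]indicE memNset// mulr0; exact: integral_ge0.
    rewrite /spread !indicE !mem_set// !mulr1 !patchE !mem_set//.
    have := @segment_slope x h Kx; rewrite addrC => /(_ Kxh) H; apply: le_trans H _.
    rewrite integral_mkcond le_eqVlt; apply/orP; left; apply/eqP.
    apply: eq_integral => q _; rewrite patchE /f/= indicE; case: ifP => _; first by rewrite mulr1.
    by rewrite mulr0.
rewrite fubini_tonelli//.
rewrite (eq_integral (fun q : measurableTypeR R => (`|h| * \1_(`[0, 1]%classic : set R) (q : R))%:E * \int[lebesgue_rV R d]_x (W x)%:E)%E); last first.
  move=> q _; rewrite -(ge0_integral_translation (q *: h) (f := fun x => (W x)%:E))//; last exact/measurable_EFinP.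
  have mWt : measurable_fun setT (fun x : 'rV[R]_d => (W (x + q *: h))%:E).
    apply/measurable_EFinP; apply: (measurableT_comp mW).
    rewrite (_ : (fun x => _) = (fun x : 'rV[R]_d => (q : R) *: h + x)); last by apply/funext => x; rewrite addrC.
    exact: (measurable_fun_pair1 (q : measurableTypeR R) (measurable_rV_line h)).
  have i0 : 0 <= (\1_(`[0, 1]%classic : set R) (q : R) : R) by rewrite indicE ler0n.
  rewrite -ge0_integralZl//; last by move=> x _; rewrite lee_fin.
  apply: eq_integral => x _; rewrite /f/= -EFinM addrC; congr EFin; ring.
have mi : measurable_fun setT (fun q : measurableTypeR R => (\1_(`[0, 1]%classic : set R) (q : R) : R)%:E).
  by apply/measurable_EFinP; exact: measurable_indic.
have i0 (q : measurableTypeR R) : (0 <= (\1_(`[0, 1]%classic : set R) (q : R))%:E :> \bar R)%E.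
  by rewrite lee_fin indicE ler0n.
have IW0 : (0 <= \int[lebesgue_rV R d]_x (W x)%:E)%E by apply: integral_ge0 => x _; rewrite lee_fin.
under eq_integral do rewrite EFinM.
rewrite (ge0_integralZr _ measurableT)//; last exact: measurable_funeM.
rewrite (ge0_integralZl _ measurableT)//.
rewrite [X in (_ * X * _)%E](_ : _ = 1%E) ?mule1//.
rewrite (integral_indic _ measurableT m01) setIT.
have := @lebesgue_measure_itv R `[0, 1]; rewrite /= lte_fin ltr01 sube0; exact.
Qed.

(* Substitute [y = x + h] and exchange the integrals in [x] and [h]. *)
Lemma double_slope (r : R) : 0 <= r -> (forall x, K x -> `|x| <= r) ->
  (\int[lebesgue_rV R d]_x \int[lebesgue_rV R d]_y (D x y)%:E <=
  (2 * r)%:E * lebesgue_rV R d (closed_cube 0 (2 * r)) * \int[lebesgue_rV R d]_x (W x)%:E)%E.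
Proof.
move=> r0 Kr.
have mB : measurable (closed_cube (0 : 'rV[R]_d) (2 * r)) by exact: measurable_closed_cube.
have mB1 : measurable_fun setT (fun h : 'rV[R]_d =>
    (2 * r)%:E * (\1_(closed_cube (0 : 'rV[R]_d) (2 * r)) h)%:E * \int[lebesgue_rV R d]_x (W x)%:E)%E.
  rewrite (_ : (fun h => _) = (fun h : 'rV[R]_d => (\int[lebesgue_rV R d]_x (W x)%:E) * ((2 * r)%:E * (\1_(closed_cube (0 : 'rV[R]_d) (2 * r)) h)%:E)))%E.
    by do 2 apply: measurable_funeM; apply/measurable_EFinP; exact: measurable_indic.
  by apply/funext => h; rewrite muleC.
(* Two points of [K] differ by at most [2 r], so only the [h] of a fixed cube contribute. *)
have Dfar h x : 2 * r < `|h| -> D x (h + x) = 0.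
  move=> hr; have [Kx|nKx] := pselect (K x); last by rewrite /spread [\1_K x]indicE memNset// mulr0 mul0r.
  have [Kxh|nKx] := pselect (K (h + x)); last by rewrite /spread [\1_K (h + x)]indicE memNset// mulr0.
  have := le_trans (ler_normB (h + x) x) (lerD (Kr _ Kxh) (Kr _ Kx)).
  by rewrite addrK -mulr2n -mulr_natl leNgt hr.
have IW0 : (0 <= \int[lebesgue_rV R d]_x (W x)%:E)%E by apply: integral_ge0 => x _; rewrite lee_fin.
have -> : (\int[lebesgue_rV R d]_x \int[lebesgue_rV R d]_y (D x y)%:E =
    \int[lebesgue_rV R d]_x \int[lebesgue_rV R d]_h (D x (h + x))%:E)%E.
  apply: eq_integral => x _; symmetry.
  apply: (ge0_integral_translation x (f := fun y => (D x y)%:E)) => [|y]; last by rewrite lee_fin.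
  by apply/measurable_EFinP; by apply: measurable_spread => //; exact: measurable_cst.
rewrite (fubini_tonelli (fun z : 'rV[R]_d * 'rV[R]_d => (D z.1 (z.2 + z.1))%:E))/=; last 2 first.
- exact/measurable_EFinP.
- by move=> z; rewrite lee_fin.
apply: (@le_trans _ _ (\int[lebesgue_rV R d]_h
  ((2 * r)%:E * (\1_(closed_cube (0 : 'rV[R]_d) (2 * r)) h)%:E * \int[lebesgue_rV R d]_x (W x)%:E))%E).
  apply: ge0_le_integral => //.
  - by move=> h _; apply: integral_ge0 => x _; rewrite lee_fin.
  - apply: (measurable_fun_fubini_tonelli_G (fun z : 'rV[R]_d * 'rV[R]_d => (D z.1 (z.2 + z.1))%:E)).
    + exact/measurable_EFinP.
    + by move=> z; rewrite lee_fin.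
  - move=> h _; rewrite indicE; have [hB|hB] := boolP (h \in _).
      rewrite mule1.
      have [h0|h0] := leP `|h| (2 * r).
        by apply: le_trans (translation_slope h) _; apply: lee_wpmul2r => //; rewrite lee_fin.
      rewrite integral0_eq => [|x _]; first by rewrite mule_ge0// lee_fin mulr_ge0.
      by rewrite Dfar.
    rewrite mule0 mul0e integral0_eq// => x _; rewrite Dfar// ltNge; apply: contra hB => hr.
    by rewrite inE => i; rewrite mxE subr0; apply: le_trans (norm_coord_le _ _) hr.
rewrite ge0_integralZr//; last 2 first.
- by apply: measurable_funeM; apply/measurable_EFinP; exact: measurable_indic.
- by move=> h _; rewrite mule_ge0// lee_fin ?mulr_ge0// indicE ler0n.
rewrite ge0_integralZl//; last 2 first.
- by apply/measurable_EFinP; exact: measurable_indic.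
- by rewrite lee_fin mulr_ge0.
by rewrite integral_indic// setIT.
Qed.

End poincare.

Section weighted_poincare.
Context {R : realType} {d : nat} {Omega K : set 'rV[R]_d} {F : 'rV[R]_d -> R}.
Hypotheses (Omega_open : open Omega) (cK : compact K) (KO : K `<=` Omega) (K_convex : convex_set K).
Hypothesis cF : forall x, Omega x -> {for x, continuous F}.
Hypothesis lty_compact : forall K, compact K -> K `<=` Omega -> (lebesgue_rV R d K < +oo)%E.
Implicit Types (f w : 'rV[R]_d -> R).
Local Notation gi := (gintegrable Omega F).
Local Notation rint := (gint_fin Omega F).

Let mO : measurable Omega := measurable_open Omega_open.
Let mK : measurable K := measurable_closed (compact_closed_rV cK).

Let cexp (c : R) x : Omega x -> {for x, continuous (fun x => expR (c * F x))}.
Proof.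
move=> Ox; apply: (@continuous_comp _ _ _ (fun x => c * F x) expR); last exact: continuous_expR.
by apply: for_continuousM; [exact: cst_continuous|exact: cF].
Qed.

Lemma gi_indic f : (forall x, Omega x -> {for x, continuous f}) -> gi (fun x => \1_K x * f x).
Proof.
move=> cf; have H : (lebesgue_rV R d).-integrable K (EFin \o (fun x => f x * expR (-1 * F x))).
  apply: (integrable_on_compact Omega_open lty_compact cK KO) => x Ox.
  by apply: for_continuousM; [exact: cf|exact: cexp].
have {}H := (integrable_mkcond _ mK).1 H.
have := integrableS measurableT mO (@subsetT _ _) H; apply: eq_integrable => // x _.
rewrite patchE indicE; case: ifP => _ /=; first by rewrite mul1r mulN1r.
by rewrite !mul0r.
Qed.

Lemma gi_indic1 : gi (\1_K).
Proof.
have H : gi (fun x => \1_K x * cst 1 x) by apply: gi_indic => x _; exact: cst_continuous.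
by apply: (gi_ext mO _ H) => x _; rewrite /= mulr1.
Qed.

(** The constant depends on [K] and [F] but not on [w], hence it is the same for all times. The
    comparison of [w] with its mean is multiplied by the mass of [K], which spares a division by a
    mass that could vanish. *)
Lemma local_poincare : exists2 C : R, 0 <= C & forall w, C1_on Omega w ->
  rint (fun x => \1_K x * `|rint (\1_K) * w x - rint (fun y => \1_K y * w y)|) <=
  C * rint (fun x => \1_K x * slope w x).
Proof.
have [M HM] := compact_bound cK (fun x Kx => @cexp (-1) x (KO Kx)).
have [N HN] := compact_bound cK (fun x Kx => @cexp 1 x (KO Kx)).
have [r0 Hr] : exists r : R, forall x, K x -> `|x| <= r.
  by have [A [_ HA]] := compact_bounded cK; exists (A + 1); apply: HA; rewrite ltrDl.
pose r := Num.max 0 r0; have r_ge0 : 0 <= r by rewrite le_max lexx.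
have {}Hr x : K x -> `|x| <= r by move=> /Hr H; rewrite le_max H orbT.
pose c := fine (lebesgue_rV R d (closed_cube 0 (2 * r))).
have c_fin : lebesgue_rV R d (closed_cube 0 (2 * r)) = c%:E.
  by rewrite fineK// ge0_fin_numE// lebesgue_rV_cube// mulr_ge0.
have c0 : 0 <= c by rewrite fine_ge0.
(* Each of the two integrations on the left costs a bound [M] of the weight on [K]; a bound [N] of
   the inverse weight restores gamma on the right, and [2 r c] is the constant of [double_slope]. *)
exists (`|M| * `|M| * (2 * r * c) * `|N|) => [|w w1]; first by rewrite !mulr_ge0.
have cw x : Omega x -> {for x, continuous w} by move=> Ox; exact: (C1_on_continuous Omega_open w1 Ox).
have cs := slope_continuous w1.
have g1 := gi_indic1.
have gw := gi_indic cw.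
set k := rint (\1_K); set a := rint (fun y => \1_K y * w y).
have D0 := spread_ge0 K w.
have := double_slope Omega_open cK KO K_convex w1 r_ge0 Hr => /= double.
have bM x : K x -> expR (- F x) <= `|M|.
  by move=> Kx; have := HM x Kx; rewrite mulN1r => /(le_trans (ler_norm _))/le_trans; apply; exact: ler_norm.
have inner x : K x -> (`|k * w x - a|%:E <= `|M|%:E * \int[lebesgue_rV R d]_y (spread K w x y)%:E)%E.
  move=> Kx; have E : k * w x - a = rint (fun y => w x * \1_K y - \1_K y * w y).
    by rewrite (rintB mO)// ?(rintZ mO)//; [rewrite mulrC|exact: (giZ mO)].
  have gf : gi (fun y => w x * \1_K y - \1_K y * w y) by apply: (giB mO) => //; exact: (giZ mO).
  have mS : measurable_fun setT (fun y => (spread K w x y)%:E).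
    by apply/measurable_EFinP; apply: (measurable_spread Omega_open cK KO w1) => //; exact: measurable_cst.
  have [mf _] := integrableP _ _ _ gf.
  rewrite E -abse_EFin -(gintE mO gf); apply: le_trans (le_abse_integral _ mO mf) _.
  rewrite -ge0_integralZl//; last by move=> y _; rewrite lee_fin.
  apply: (@le_trans _ _ (\int[lebesgue_rV R d]_(y in Omega) (`|M|%:E * (spread K w x y)%:E))%E); last first.
    apply: ge0_subset_integral => //; first exact: measurable_funeM.
    by move=> y _; rewrite mule_ge0// lee_fin.
  apply: ge0_le_integral => //.
  - exact: measurableT_comp.
  - by apply: measurable_funTS; exact: measurable_funeM.
  - move=> y Oy; rewrite -EFinM lee_fin /spread !patchE !indicE (mem_set Kx) !mulr1.
    case: (boolP (y \in K)) => [yK|_]; last by rewrite mulr0 mul0r subr0 mul0r normr0 !mulr0.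
    rewrite mul1r !mulr1 normrM distrC [X in _ * X]ger0_norm ?expR_ge0// mulrC ler_wpM2r//.
    by apply: bM; rewrite inE in yK.
have mH : measurable_fun setT (fun x => \int[lebesgue_rV R d]_y (spread K w x y)%:E)%E.
  apply: (measurable_fun_fubini_tonelli_F (fun z : 'rV[R]_d * 'rV[R]_d => (spread K w z.1 z.2)%:E)).
    apply/measurable_EFinP; apply: (measurable_spread Omega_open cK KO w1).
      exact: measurable_fst.
    exact: measurable_snd.
  by move=> z; rewrite lee_fin.
have H0 x : (0 <= \int[lebesgue_rV R d]_y (spread K w x y)%:E)%E.
  by apply: integral_ge0 => y _; rewrite lee_fin.
have outer : ((rint (fun x => \1_K x * `|k * w x - a|))%:E <=
    (`|M| * `|M|)%:E * \int[lebesgue_rV R d]_x \int[lebesgue_rV R d]_y (spread K w x y)%:E)%E.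
  have go : gi (fun x => \1_K x * `|k * w x - a|).
    apply: (gi_indic (f := fun x => `|k * w x - a|)) => x Ox.
    apply: (@cvg_norm _ _ _ (nbhs x) _ (fun x => k * w x - a)).
    apply: cvgB; last exact: cvg_cst.
    by apply: cvgM; [exact: cvg_cst|exact: cw].
  rewrite -(gintE mO go) -ge0_integralZl//.
  apply: (@le_trans _ _ (\int[lebesgue_rV R d]_(x in Omega)
      ((`|M| * `|M|)%:E * \int[lebesgue_rV R d]_y (spread K w x y)%:E))%E); last first.
    apply: ge0_subset_integral => //; first exact: measurable_funeM.
    by move=> x _; rewrite mule_ge0// lee_fin mulr_ge0.
  apply: ge0_le_integral => //.
  - by case/integrableP: go.
  - by apply: measurable_funTS; exact: measurable_funeM.
  - move=> x Ox; rewrite indicE; case: (boolP (x \in K)) => [xK|_]; last first.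
      by rewrite !mul0r mule_ge0// lee_fin mulr_ge0.
    rewrite inE in xK; rewrite mul1r mulrC EFinM [in leRHS]EFinM -muleA.
    by apply: lee_pmul => //; rewrite ?lee_fin ?expR_ge0//; [exact: bM|exact: inner].
have W_le : (\int[lebesgue_rV R d]_x ((slope w \_ K) x)%:E <=
    `|N|%:E * (rint (fun x => \1_K x * slope w x))%:E)%E.
  have gs := gi_indic cs; have [ms _] := integrableP _ _ _ gs.
  have s0 x : (0 <= (\1_K x * slope w x * expR (- F x))%:E)%E.
    by rewrite lee_fin !mulr_ge0 ?expR_ge0 ?slope_ge0// indicE ler0n.
  rewrite -(gintE mO gs) -ge0_integralZl//.
  rewrite [leRHS]integral_mkcond; apply: ge0_le_integral => //.
  - by move=> x _; rewrite lee_fin patchE; case: ifP => _; [exact: slope_ge0|].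
  - apply/measurable_EFinP; apply: (measurable_restrictT (slope w) mK).1.
    exact: measurable_funS mO KO (continuous_open_measurable Omega_open cs).
  - by apply/(measurable_restrictT _ mO); exact: measurable_funeM.
  - move=> x _; rewrite !patchE; case: (boolP (x \in K)) => [xK|_]; last first.
      by case: ifP => _ //; rewrite mule_ge0.
    rewrite inE in xK; rewrite mem_set; last exact: KO.
    rewrite indicE mem_set// mul1r -EFinM lee_fin mulrCA ler_peMr ?slope_ge0//.
    have := le_trans (ler_norm _) (le_trans (HN x xK) (ler_norm N)); rewrite mul1r => H.
    by rewrite expRN ler_pdivlMr ?expR_gt0// mul1r.
rewrite -lee_fin; apply: le_trans outer _.
apply: (@le_trans _ _ ((`|M| * `|M|)%:E * ((2 * r * c)%:E * (`|N|%:E * (rint (fun x => \1_K x * slope w x))%:E)))%E).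
  apply: lee_wpmul2l; first by rewrite lee_fin mulr_ge0.
  apply: (le_trans double); rewrite c_fin -EFinM.
  by apply: lee_wpmul2l => //; rewrite lee_fin !mulr_ge0.
by rewrite -!EFinM !mulrA.
Qed.

End weighted_poincare.

(** * Convergence of the entropy to zero *)

Section exhaustion.
Context {R : realType} {d : nat} {Omega : set 'rV[R]_d}.
Hypotheses (Omega_open : open Omega) (Omega_convex : convex_set Omega).

(** The points of norm at most [j] around which a ball of radius [1/(j+1)] fits in Omega.
    Quantifying over the ball avoids a distance to the boundary, which may be empty, and makes
    convexity immediate. *)
Definition exhaustion (j : nat) : set 'rV[R]_d :=
  [set x | `|x| <= j%:R /\ forall u : 'rV[R]_d, `|u| < j.+1%:R^-1 -> Omega (x + u)].

Lemma exhaustion_sub j : exhaustion j `<=` Omega.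
Proof. by move=> x [_ /(_ 0)]; rewrite addr0 normr0 invr_gt0 ltr0n; apply. Qed.

Lemma exhaustion_convex j : convex_set (exhaustion j).
Proof.
move=> x y l; rewrite !inE => -[x1 x2] [y1 y2].
have l0 : 0 <= l%:num by []. have l1 : l%:num <= 1 by [].
change (exhaustion j (l%:num *: x + (1 - l%:num) *: y)); move: l0 l1; move: (l%:num) => q q0 q1.
split.
  apply: le_trans (ler_normD _ _) _; rewrite !normrZ !ger0_norm ?subr_ge0//.
  have -> : (j%:R : R) = q * j%:R + (1 - q) * j%:R by ring.
  by rewrite lerD// ler_wpM2l// subr_ge0.
move=> u u1; have -> : q *: x + (1 - q) *: y + u = q *: (x + u) + (1 - q) *: (y + u).
  by apply/rowP => i; rewrite !mxE; ring.
by apply: (convex_comb Omega_convex); [exact: x2|exact: y2|rewrite q0].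
Qed.

Lemma exhaustion_closed j : closed (exhaustion j).
Proof.
move=> x cx; split.
  apply/ler_addgt0Pr => e e0.
  have [y [[y1 _] /= xy]] := cx (ball x e) (nbhsx_ballx x e e0).
  rewrite -ball_normE/= in xy; rewrite -(subrK y x) addrC.
  by apply: le_trans (ler_normD _ _) _; rewrite lerD// ltW.
move=> u u1; have e0 : 0 < j.+1%:R^-1 - `|u| by rewrite subr_gt0.
have [y [[_ y2] /= xy]] := cx (ball x _) (nbhsx_ballx x _ e0).
rewrite -ball_normE/= in xy; have -> : x + u = y + (u + (x - y)) by rewrite addrCA addrC [y + _]addrC subrK.
by apply: y2; apply: le_lt_trans (ler_normD _ _) _; rewrite -ltrBrDl.
Qed.

Lemma exhaustion_compact j : compact (exhaustion j).
Proof.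
apply: bounded_closed_compact; last exact: exhaustion_closed.
exists j%:R; split; first exact: num_real.
by move=> M jM x [x1 _]; apply: le_trans x1 (ltW jM).
Qed.

Lemma exhaustion_cover x : Omega x -> \forall j \near \oo, exhaustion j x.
Proof.
move=> Ox; have [r r0 Hr] := open_ball Omega_open Ox.
near=> j; split.
  near: j; exact: nbhs_infty_ger.
move=> u uj; apply: Hr; rewrite addrAC subrr add0r; apply: lt_trans uj _.
near: j; exact: (near_infty_natSinv_lt (PosNum r0)).
Unshelve. all: by end_near. Qed.

End exhaustion.

(** With [b] a partial derivative of [s], the left side is [|pd i v|]. Since [0 <= 2 - p <= 1], the
    square of [r^(1 - p/2)] is at most [1 + r], and the arithmetic-geometric inequality with
    parameter [th] separates it from [b]. *)
Lemma slope_amgm {R : realType} (p th r b : R) : 1 <= p <= 2 -> 0 < th -> 0 < r ->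
  `|2 / p * r `^ (1 - p / 2) * b| <= th * (1 + r) + th^-1 * b ^+ 2.
Proof.
move=> /andP[p1 p2] th0 r0; have p_gt0 := lt_le_trans ltr01 p1.
set a := r `^ (1 - p / 2); have a0 : 0 <= a by exact: powR_ge0.
have a2 : a ^+ 2 <= 1 + r.
  have -> : a ^+ 2 = r `^ (2 - p) by rewrite -powR_mulrn// -powRrM; congr (_ `^ _); field.
  have [r1|r1] := leP r 1.
    have : r `^ (2 - p) <= r `^ 0 by rewrite ger_powR ?r0// subr_ge0.
    by rewrite powRr0; move=> /le_trans; apply; rewrite lerDl ltW.
  have : r `^ (2 - p) <= r `^ 1 by rewrite ler_powR ?(ltW r1)//; lra.
  by rewrite powRr1 ?(ltW r0)// => /le_trans; apply; rewrite lerDr.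
have q0 : 0 <= 2 / p by rewrite divr_ge0 ?(ltW p_gt0).
have q2 : 2 / p <= 2 by rewrite ler_pdivrMr//; lra.
rewrite (normrM _ b) (normrM _ a) (ger0_norm a0) (ger0_norm q0).
apply: (@le_trans _ _ (2 * (a * `|b|))).
  by rewrite -mulrA ler_wpM2r ?mulr_ge0.
apply: (@le_trans _ _ (th * a ^+ 2 + th^-1 * b ^+ 2)); last by rewrite lerD2r ler_wpM2l// ltW.
rewrite -subr_ge0 -(real_normK (num_real b)).
have -> : th * a ^+ 2 + th^-1 * `|b| ^+ 2 - 2 * (a * `|b|) = th * (a - th^-1 * `|b|) ^+ 2.
  by field; exact: lt0r_neq0.
by rewrite mulr_ge0 ?sqr_ge0// ltW.
Qed.

Section entropy_limit.
Context {R : realType} {d : nat} {Omega : set 'rV[R]_d} {F : 'rV[R]_d -> R}.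
Context {n : 'rV[R]_d -> 'rV[R]_d} {sigma : {measure set 'rV[R]_d -> \bar R}}.
Hypotheses (Omega_open : open Omega) (Omega_convex : convex_set Omega).
Hypothesis F_C2 : Ck_bar 2 Omega F.
Hypothesis g_L1 : (lebesgue_rV R d).-integrable Omega (fun x => (expR (- F x))%:E).
Context {p : R} {v : R -> 'rV[R]_d -> R}.
Hypothesis hp : 1 <= p <= 2.
Hypothesis v_sol : smooth_positive_solution Omega F n v.
Hypothesis v_adequate : adequate Omega F n sigma p v.
Local Notation gi := (gintegrable Omega F).
Local Notation rint := (gint_fin Omega F).
Local Notation s := (@root_var R d v p).
Local Notation J := (root_energy (Omega := Omega) (F := F) (p := p) (v := v)).
Local Notation E := (entropy_value (Omega := Omega) (F := F) (p := p) (v := v)).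
Local Notation m := (rint (cst 1)).

Hypothesis v_mass : forall t : R, 0 < t -> rint (v t) = m.
Hypothesis J_lim : forall e : R, 0 < e -> exists2 T : R, 1 <= T & forall t, T <= t -> J t <= e.

Let mO : measurable Omega := measurable_open Omega_open.
Let p_gt0 : 0 < p. Proof. by case/andP: hp => p1 _; apply: lt_le_trans p1. Qed.
Let cF x : Omega x -> {for x, continuous F}.
Proof. exact: (Ck_bar_continuous Omega_open F_C2). Qed.
Let mF : measurable_fun Omega F.
Proof. exact: continuous_open_measurable. Qed.
Let lty_compact := weight_lty_compact Omega_open cF g_L1.

Lemma gi1 : gi (cst 1).
Proof. by have := g_L1; apply: eq_integrable => // x _; rewrite mul1r. Qed.

Let m0 : 0 <= m.
Proof. exact: rint_ge0. Qed.


Lemma gi_abs f : gi f -> gi (fun x => `|f x|).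
Proof.
move=> Hf; have := integrable_abse Hf; apply: eq_integrable => // x _.
by rewrite /= normrM [`|expR _|]ger0_norm// expR_ge0.
Qed.

Lemma gi_outside (K : set 'rV[R]_d) f : measurable K -> gi f -> gi (fun x => (1 - \1_K x) * f x).
Proof.
move=> mK Hf; apply: (gi_le mO mF _ _ (gi_abs Hf)).
  apply: measurable_funM; last exact: (gi_measurable mF Hf).
  by apply: measurable_funB => //; exact: measurable_indic.
move=> x _; rewrite normrM ler_piMl// indicE; case: (x \in K); first by rewrite subrr normr0.
by rewrite subr0 normr1.
Qed.

Lemma outside_ge0 (K : set 'rV[R]_d) x : 0 <= 1 - \1_K x :> R.
Proof. by rewrite indicE subr_ge0; case: (x \in K). Qed.

Lemma outside_le1 (K : set 'rV[R]_d) x : 1 - \1_K x <= 1 :> R.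
Proof. by rewrite gerBl indicE ler0n. Qed.

Let mexh j : measurable (exhaustion (Omega := Omega) j).
Proof. exact: measurable_closed (@exhaustion_closed _ _ _ j). Qed.

Lemma outside_cvg : rint (fun x => 1 - \1_(exhaustion (Omega := Omega) j) x) @[j --> \oo] --> (0 : R).
Proof.
rewrite -(rint0 (Omega := Omega) (F := F)).
apply: (rint_dominated mO mF (f_ := fun j x => 1 - \1_(exhaustion (Omega := Omega) j) x) (g := cst 1)).
- by move=> j; apply: measurable_funB => //; exact: measurable_indic.
- exact: measurable_cst.
- exact: gi1.
- move=> x Ox; apply: cvg_near_cst; have := exhaustion_cover Omega_open Ox.
  by apply: filterS => j Kj; rewrite indicE mem_set// subrr.
- by move=> j x _; rewrite ger0_norm ?outside_ge0// outside_le1.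
Qed.

(** De la Vallee Poussin's argument: the entropy is bounded by its value at time 1 and its density
    is superlinear, so a set of small gamma-measure carries little mass, uniformly in time. *)
Lemma sol_tight (e : R) : 0 < e -> exists j, forall t : R, 1 <= t ->
  rint (fun x => 1 - \1_(exhaustion (Omega := Omega) j) x) <= e /\
  rint (fun x => (1 - \1_(exhaustion (Omega := Omega) j) x) * v t x) <= e.
Proof.
move=> e0; have E0 : 0 <= E 1 by exact: (entropy_value_ge0 hp v_sol).
(* Outside [K], [A v <= psi v + e^A]. This [A] makes [E 1] at most [A e / 2], and the second
   argument of the minimum in [c] does the same for the integral of [e^A]. *)
pose A := 2 * E 1 / e + 1.
have A0 : 0 < A by rewrite ltr_wpDl// divr_ge0 ?mulr_ge0// ltW.
pose c := Num.min e (A * e / 2 / expR A).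
have c0 : 0 < c by rewrite lt_min e0 !divr_gt0 ?expR_gt0// mulr_gt0.
have [j Hj] : exists j, rint (fun x => 1 - \1_(exhaustion (Omega := Omega) j) x) <= c.
  have /cvgrPdist_le /(_ c c0) [N _ HN] := outside_cvg.
  by exists N; have := HN N (leqnn N); rewrite /= sub0r normrN; apply: le_trans; exact: ler_norm.
exists j => t t1; have t0 := lt_le_trans ltr01 t1; set K := exhaustion j.
have gv := sol_gi Omega_open F_C2 v_sol v_adequate t0.
have gE := entropy_gi Omega_open F_C2 hp v_sol v_adequate t0.
have gK : gi (fun x => 1 - \1_K x).
  by apply: (gi_ext mO _ (gi_outside (mexh j) gi1)) => x _; rewrite /= mulr1.
split; first by apply: le_trans Hj _; rewrite ge_min lexx.
rewrite -(ler_pM2l A0) -(rintZ mO); last exact: (gi_outside (mexh j) gv).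
apply: (@le_trans _ _ (rint (fun x => psi (p := p) (v t x) + expR A * (1 - \1_K x)))).
  apply: (rint_le mO).
  - by apply: (giZ mO); exact: (gi_outside (mexh j) gv).
  - by apply: (giD mO) => //; exact: (giZ mO).
  - move=> x Ox; have v0 := sol_gt0 v_sol t0 Ox.
    have := psi_superlinear hp A v0; have := psi_ge0 hp v0.
    have := outside_ge0 K x; have := outside_le1 K x.
    by move: (1 - _) (psi _) (expR A) => k q a; nra.
rewrite (rintD mO)//; last exact: (giZ mO).
rewrite (rintZ mO)//.
have E1 : rint (fun x => psi (p := p) (v t x)) <= E 1.
  apply: (density_nonincreasing Omega_open F_C2 v_sol v_adequate (density_psi hp)) => //.
  by move=> r r0; exact: psi2_ge0.
have H1 : expR A * rint (fun x => 1 - \1_K x) <= A * e / 2.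
  by rewrite mulrC -ler_pdivlMr ?expR_gt0//; apply: le_trans Hj _; rewrite ge_min lexx orbT.
have H2 : A * e = 2 * E 1 + e by rewrite /A; field; exact: lt0r_neq0.
lra.
Qed.

Lemma slope_bound (th t : R) x : 0 < th -> 0 < t -> Omega x ->
  slope (v t) x <= th * d%:R * (1 + v t x) + th^-1 * grad_sq (s t) x.
Proof.
move=> th0 t0 Ox; have v0 := sol_gt0 v_sol t0 Ox.
rewrite grad_sq_sum mulr_sumr.
have -> : th * d%:R * (1 + v t x) = \sum_(i < d) th * (1 + v t x).
  by rewrite sumr_const card_ord -[RHS]mulr_natr; ring.
rewrite -big_split/=; apply: ler_sum => i _.
have -> : pd i (v t) x = 2 / p * v t x `^ (1 - p / 2) * pd i (s t) x.
  rewrite (root_pd v_sol i t0 Ox).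
  have H : v t x `^ (1 - p / 2) * v t x `^ (p / 2 - 1) = 1.
    rewrite -powRD ?(gt_eqF v0) ?implybT// (_ : 1 - p / 2 + (p / 2 - 1) = 0) ?powRr0//; ring.
  rewrite -[LHS]mul1r -{1}H; field; exact: lt0r_neq0.
exact: slope_amgm.
Qed.

(* On [K], [v] is compared with its mean [a / k]; tightness and the conservation of mass do the rest. *)
Lemma sol_L1_cvg (e : R) : 0 < e -> exists2 T : R, 1 <= T &
  forall t, T <= t -> m * rint (fun x => `|v t x - 1|) <= e.
Proof.
move=> e0; pose e1 := e / (16 * m + 1).
have m1 : 0 < 16 * m + 1 by rewrite ltr_wpDl// mulr_ge0.
(* The losses outside [K] enter the final sum with total weight at most [6 m], hence they cost less
   than [e / 2]. *)
have [j Hj] := sol_tight (divr_gt0 e0 m1); set K := exhaustion j in Hj.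
have cK : compact K by exact: exhaustion_compact.
have KO : K `<=` Omega by exact: exhaustion_sub.
have [C C0 HC] := local_poincare Omega_open cK KO (@exhaustion_convex _ _ _ Omega_convex j) cF lty_compact.
pose c := 4 * C * d%:R * m + 1.
have c0 : 0 < c by rewrite ltr_wpDl// !mulr_ge0.
(* The set [K] fixes [C]; then [th] makes the term in [1 + v] at most [e / 4]; only then is [T]
   chosen, so that the term in [J t / th] is at most [e / 4]. *)
pose th := e / (2 * c); have th0 : 0 < th by rewrite divr_gt0// mulr_gt0.
have C4 : 0 < 4 * C + 1 by rewrite ltr_wpDl// mulr_ge0.
have [T T1 HT] := J_lim (divr_gt0 (mulr_gt0 th0 e0) C4).
exists T => // t Tt; have t1 := le_trans T1 Tt; have t0 := lt_le_trans ltr01 t1.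
have [Kd Kt] := Hj t t1; have {}HT := HT t Tt.
have gv := sol_gi Omega_open F_C2 v_sol v_adequate t0.
have gJ := root_energy_gi v_adequate t0.
have v3 := sol_C3 v_sol t0.
have w1 : C1_on Omega (v t) by exact: (Ck_bar_C1 Omega_open v3).
have gK := gi_indic1 Omega_open cK KO cF lty_compact.
have cv x : Omega x -> {for x, continuous (v t)} by exact: (Ck_bar_continuous Omega_open v3).
have gKv := gi_indic Omega_open cK KO cF lty_compact cv.
have {}HC := HC _ w1.
set k := rint (\1_K) in HC; set a := rint (fun y => \1_K y * v t y) in HC.
set P := rint (fun x => \1_K x * `|k * v t x - a|) in HC.
have gKs : gi (fun x => \1_K x * slope (v t) x).
  exact: (gi_indic Omega_open cK KO cF lty_compact (slope_continuous w1)).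
have gP : gi (fun x => \1_K x * `|k * v t x - a|).
  apply: (gi_indic Omega_open cK KO cF lty_compact (f := fun x => `|k * v t x - a|)) => x Ox.
  apply: (@cvg_norm _ _ _ (nbhs x) _ (fun x => k * v t x - a)).
  apply: cvgB; last exact: cvg_cst.
  by apply: cvgM; [exact: cvg_cst|exact: cv].
have gl : gi (fun x => `|v t x - 1|) by apply: gi_abs; apply: (giB mO) => //; exact: gi1.
have gOv := gi_outside (mexh j) gv.
have gO : gi (fun x => 1 - \1_K x) by apply: (giB mO) => //; exact: gi1.
set tau := rint (fun x => (1 - \1_K x) * v t x) in Kt.
set delta := rint (fun x => 1 - \1_K x) in Kd.
set X := rint (fun x => `|v t x - 1|).
have Ek : delta = m - k by rewrite -(rintB mO)//; exact: gi1.
have Ea : tau = m - a.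
  rewrite -(v_mass t0) -(rintB mO)//; apply: rint_ext => x _; ring.
have tau0 : 0 <= tau by apply: rint_ge0 => x Ox; rewrite mulr_ge0 ?outside_ge0// ltW// (sol_gt0 v_sol).
have delta0 : 0 <= delta by apply: rint_ge0 => x Ox; exact: outside_ge0.
have k0 : 0 <= k by apply: rint_ge0 => x Ox; rewrite indicE ler0n.
have X0 : 0 <= X by exact: rint_ge0.
have X2 : X <= 2 * m.
  apply: (@le_trans _ _ (rint (fun x => v t x + 1))).
    apply: (rint_le mO) => //; first by apply: (giD mO) => //; exact: gi1.
    move=> x Ox; apply: le_trans (ler_normB _ _) _; rewrite normr1 ger0_norm// ltW//.
    exact: (sol_gt0 v_sol t0 Ox).
  by rewrite (rintD mO)//; [rewrite v_mass// mulr2n mulrDl !mul1r|exact: gi1].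
have kX : k * X <= P + (`|a - k| * k + (k * tau + k * delta)).
  rewrite /X -(rintZ mO)// -(rintZ mO (_ : R) gOv) -(rintZ mO (_ : R) gO) -(rintZ mO (_ : R) gK).
  rewrite -(rintD mO); [|exact: (giZ mO)..].
  rewrite -(rintD mO); [|exact: (giZ mO)|by apply: (giD mO); exact: (giZ mO)].
  rewrite -(rintD mO)//; last by apply: (giD mO); [exact: (giZ mO)|apply: (giD mO); exact: (giZ mO)].
  apply: (rint_le mO); first exact: (giZ mO).
    by apply: (giD mO) => //; apply: (giD mO); [exact: (giZ mO)|apply: (giD mO); exact: (giZ mO)].
  move=> x Ox; have v0 := sol_gt0 v_sol t0 Ox; rewrite indicE; case: (x \in K) => /=.
    rewrite subrr mul1r !mulr1 mul0r !mulr0 !addr0 -(ger0_norm k0) -normrM (ger0_norm k0).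
    by rewrite (_ : k * (v t x - 1) = k * v t x - a + (a - k)); [exact: ler_normD|ring].
  rewrite !mul0r !mulr0 !subr0 !mul1r !add0r -mulrDr ler_wpM2l//.
  by apply: le_trans (ler_normB _ _) _; rewrite normr1 ger0_norm// ltW.
have ak : `|a - k| <= tau + delta by rewrite ler_norml; apply/andP; split; lra.
have S_le : rint (fun x => \1_K x * slope (v t) x) <= th * d%:R * (2 * m) + th^-1 * J t.
  apply: (@le_trans _ _ (rint (fun x => th * d%:R * (1 + v t x) + th^-1 * grad_sq (s t) x))).
    have g1v : gi (fun x => 1 + v t x) by apply: (giD mO) => //; exact: gi1.
    apply: (rint_le mO) => //; first by apply: (giD mO); exact: (giZ mO).
    move=> x Ox; apply: le_trans (slope_bound th0 t0 Ox).
    by rewrite ler_piMl ?slope_ge0// indicE; case: (x \in K).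
  rewrite (rintD mO); [|apply: (giZ mO); apply: (giD mO) => //; exact: gi1|exact: (giZ mO)].
  rewrite (rintZ mO (_ : R) gJ) (rintZ mO); last by apply: (giD mO) => //; exact: gi1.
  rewrite (rintD mO)//; last exact: gi1.
  by rewrite v_mass// mulr2n mulrDl !mul1r.
have J_le : C * (th^-1 * J t) <= e / 4.
  have : th^-1 * J t <= e / (4 * C + 1).
    by rewrite ler_pdivrMl// mulrA.
  move=> /(ler_wpM2l C0)/le_trans; apply.
  by rewrite mulrA ler_pdivrMr//; nra.
have th_le : C * (th * d%:R * (2 * m)) <= e / 4.
  rewrite /th (_ : C * _ = e * (C * d%:R * m) / c); last by field; exact: lt0r_neq0.
  have q0 : 0 <= C * d%:R * m by rewrite !mulr_ge0.
  rewrite ler_pdivrMr// /c; nra.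
have P_le : P <= e / 2.
  apply: le_trans HC _; apply: (le_trans (ler_wpM2l C0 S_le)); rewrite mulrDr; lra.
have m_le : m * (e / (16 * m + 1)) <= e / 16.
  by rewrite mulrA ler_pdivrMr//; nra.
(* Splitting [m] into the masses of [K] and of its complement replaces a division by [k]. *)
have -> : m * X = k * X + delta * X by rewrite Ek; ring.
have km : k <= m by lra.
have A1 : `|a - k| * k <= (tau + delta) * m by exact: ler_pM.
have A2 : k * tau <= m * tau by exact: ler_wpM2r.
have A3 : k * delta <= m * delta by exact: ler_wpM2r.
have A4 : delta * X <= delta * (2 * m) by exact: ler_wpM2l.
have A5 := ler_wpM2l m0 Kt; have A6 := ler_wpM2l m0 Kd.
lra.
Qed.

(** The level of the tail is fixed once and for all at time 1, where the tails are dominated by the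
    integrable [psi (v 1)]. Monotonicity in time keeps the tail small, and [psi_le_tail] leaves a
    multiple of the [L^1] distance to 1. *)
Lemma entropy_limit : 0 < m -> forall e : R, 0 < e -> exists2 T : R, 1 <= T & forall t, T <= t -> E t <= e.
Proof.
move=> mp e e0; have g1 := entropy_gi Omega_open F_C2 hp v_sol v_adequate ltr01.
have gtail (M t : R) : 0 < M -> 0 < t -> gi (fun x => tail (p := p) M (v t x)).
  by move=> M0 t0; have [] := density_dissipation Omega_open F_C2 v_sol v_adequate (density_tail hp M0) t0.
have v10 x : Omega x -> 0 < v 1 x by move=> Ox; exact: (sol_gt0 v_sol ltr01 Ox).
have [k Hk] : exists k : nat, rint (fun x => tail (p := p) k.+1%:R (v 1 x)) <= e / 2.
  have : rint (fun x => tail (p := p) k.+1%:R (v 1 x)) @[k --> \oo] --> rint (fun=> 0 : R).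
    apply: (rint_dominated mO mF (f_ := fun k x => tail (p := p) k.+1%:R (v 1 x)) (g := fun x => psi (p := p) (v 1 x))) => //.
    - by move=> k; apply: (gi_measurable mF); exact: gtail.
    - move=> x Ox; apply: cvg_near_cst; near=> k; rewrite /tail ifT//.
      by apply: (@le_trans _ _ k%:R); [near: k; exact: nbhs_infty_ger|rewrite ler_nat].
    - by move=> k x Ox; rewrite ger0_norm ?tail_ge0 ?tail_le_psi ?v10// ler1n.
  rewrite rint0 => /cvgrPdist_le /(_ _ (divr_gt0 e0 (ltr0Sn R 1))) [N _ HN].
  by exists N; have := HN N (leqnn N); rewrite /= sub0r normrN; apply: le_trans; exact: ler_norm.
have M1 : 1 <= k.+1%:R :> R by rewrite ler1n.
have M0 : 0 < k.+1%:R :> R by rewrite ltr0n.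
have [C C0 HC] := psi_le_tail hp M1.
have C1 : 0 < 2 * (C + 1) by rewrite mulr_gt0// ltr_wpDl.
have [T T1 HT] := sol_L1_cvg (divr_gt0 (mulr_gt0 e0 mp) C1).
exists T => // t Tt; have t1 := le_trans T1 Tt; have t0 := lt_le_trans ltr01 t1.
have {}HT := HT t Tt; have gv := sol_gi Omega_open F_C2 v_sol v_adequate t0.
have gl : gi (fun x => `|v t x - 1|) by apply: gi_abs; apply: (giB mO) => //; exact: gi1.
apply: (@le_trans _ _ (rint (fun x => tail (p := p) k.+1%:R (v t x) + C * `|v t x - 1|))).
  apply: (rint_le mO).
  - exact: (entropy_gi Omega_open F_C2 hp v_sol v_adequate t0).
  - by apply: (giD mO); [exact: gtail|exact: (giZ mO)].
  - by move=> x Ox; apply: HC; exact: (sol_gt0 v_sol t0 Ox).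
rewrite (rintD mO); [|exact: gtail|exact: (giZ mO)].
rewrite (rintZ mO)//.
have Ht : rint (fun x => tail (p := p) k.+1%:R (v t x)) <= e / 2.
  apply: le_trans Hk; apply: (density_nonincreasing Omega_open F_C2 v_sol v_adequate (density_tail hp M0)) => //.
  by move=> r r0; have /andP[] := tail2_bounds hp M0 r0.
have Hl : C * rint (fun x => `|v t x - 1|) <= e / 2.
  have : rint (fun x => `|v t x - 1|) <= e / (2 * (C + 1)).
    by rewrite -(ler_pM2l mp); apply: le_trans HT _; rewrite mulrAC mulrC.
  have L0 : 0 <= rint (fun x => `|v t x - 1|) by exact: rint_ge0.
  by rewrite ler_pdivlMr//; nra.
lra.
Unshelve. all: by end_near. Qed.

End entropy_limit.

(** The decay from [r] to [t] is read as a lower bound on [a r], and [r] tends to [0+]. Extended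
    reals allow [L] to be infinite. *)
Lemma initial_decay {R : realType} (f : R -> \bar R) (a : R -> R) (L : \bar R) (k : R) :
  (forall t : R, 0 < t -> f t = (a t)%:E) -> f t @[t --> 0^'+] --> L ->
  (forall r t : R, 0 < r -> r <= t -> a t * expR (k * t) <= a r * expR (k * r)) ->
  forall t : R, 0 < t -> (f t <= L * (expR (- k * t))%:E)%E.
Proof.
move=> fa fL decay t t0; pose c := a t * expR (k * t).
pose u (r : R) := c * expR (- k * r).
have uc : (u r)%:E @[r --> 0^'+] --> c%:E.
  apply: cvg_EFin; first by apply: nearW.
  rewrite (_ : c = u 0); last by rewrite /u mulr0 expR0 mulr1.
  apply: cvg_at_right_filter; apply: cvgM; first exact: cvg_cst.
  apply: (@continuous_comp _ _ _ (fun r => - k * r) expR); last exact: continuous_expR.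
  by apply: cvgM; [exact: cvg_cst|exact: cvg_id].
have cL : (c%:E <= L)%E.
  rewrite -(cvg_lim _ uc)// -(cvg_lim _ fL)//; apply: lee_lim.
  - by apply/cvg_ex; exists c%:E.
  - by apply/cvg_ex; exists L.
  - near=> r; have r0 : 0 < r by near: r; exact: nbhs_right_gt.
    have rt : r <= t by near: r; exact: nbhs_right_le.
    rewrite fa// lee_fin /u mulNr expRN ler_pdivrMr ?expR_gt0//; exact: decay.
rewrite fa//; apply: (@le_trans _ _ (c%:E * (expR (- k * t))%:E)%E).
  by rewrite -EFinM lee_fin /c mulNr expRN mulfK// gt_eqF// expR_gt0.
by apply: lee_wpmul2r => //; rewrite lee_fin expR_ge0.
Unshelve. all: by end_near. Qed.

(** * Decay estimates from the initial time *)

Section conclusion.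
Context {R : realType} {d : nat} (hd : (0 < d)%N) {Omega : set 'rV[R]_d} {F : 'rV[R]_d -> R}.
Context {n : 'rV[R]_d -> 'rV[R]_d} {sigma : {measure set 'rV[R]_d -> \bar R}}.
Hypotheses (Omega_open : open Omega) (Omega_convex : convex_set Omega).
Hypothesis Omega_C1 : C1_boundary_normal Omega n.
Hypothesis sigma_surface : surface_measure Omega n sigma.
Hypothesis F_C2 : Ck_bar 2 Omega F.
Hypothesis g_L1 : (lebesgue_rV R d).-integrable Omega (fun x => (expR (- F x))%:E).
Context {p lam : R} {v : R -> 'rV[R]_d -> R} {v0 : 'rV[R]_d -> R}.
Hypothesis hp : 1 <= p <= 2.
Hypothesis v_sol : smooth_positive_solution Omega F n v.
Hypothesis v_adequate : adequate Omega F n sigma p v.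
Hypothesis v0_L1 : L1_plus Omega F v0.
Hypothesis v_initial : initial_datum Omega F p v v0.
Hypotheses (lam_ge0 : 0 <= lam) (lam_le : (lam%:E <= lambda1 Omega F p)%E).
Hypothesis lam_fin : 0 < lam -> (lambda1 Omega F p < +oo)%E.
Local Notation gi := (gintegrable Omega F).
Local Notation rint := (gint_fin Omega F).
Local Notation J := (root_energy (Omega := Omega) (F := F) (p := p) (v := v)).
Local Notation E := (entropy_value (Omega := Omega) (F := F) (p := p) (v := v)).
Local Notation m := (rint (cst 1)).

Let mO : measurable Omega := measurable_open Omega_open.
Let p_gt0 : 0 < p. Proof. by case/andP: hp => p1 _; apply: lt_le_trans p1. Qed.
Let cF x : Omega x -> {for x, continuous F}.
Proof. exact: (Ck_bar_continuous Omega_open F_C2). Qed.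
Let mF : measurable_fun Omega F.
Proof. exact: continuous_open_measurable. Qed.
Let lty_compact := weight_lty_compact Omega_open cF g_L1.
Let gone : gi (cst 1) := gi1 Omega_open g_L1.

Let J_derive (t : R) : 0 < t -> exists2 D, is_derive t 1 J D & D <= - (2 * lam * J t).
Proof.
exact: (root_energy_derive hd Omega_open Omega_convex Omega_C1 sigma_surface F_C2 lty_compact hp v_sol v_adequate lam_le).
Qed.
Let J_decay (r t : R) : 0 < r -> r <= t -> J t * expR (2 * lam * t) <= J r * expR (2 * lam * r).
Proof.
exact: (root_energy_decay hd Omega_open Omega_convex Omega_C1 sigma_surface F_C2 lty_compact hp v_sol v_adequate lam_le).
Qed.
Let J_ge0 (t : R) : 0 <= J t.
Proof. by apply: rint_ge0 => x _; exact: dot_ge0. Qed.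

Lemma fisher_decay (t : R) : 0 < t ->
  (fisher Omega F p (v t) <= fisher Omega F p v0 * (expR (- (2 * lam) * t))%:E)%E.
Proof.
have [_ _ _ fL] := v_initial.
apply: (initial_decay (f := fun t => fisher Omega F p (v t)) (a := fun t => 4 / p * J t)) => //.
  by move=> r r0; exact: (fisher_root Omega_open sigma_surface F_C2 lty_compact hp v_sol v_adequate r0).
move=> r q r0 rq; have c0 : 0 <= 4 / p by rewrite divr_ge0// ltW.
have := J_decay r0 rq; move: (J r) (J q) => a b H.
by rewrite -!(mulrA (4 / p)); apply: ler_wpM2l H.
Qed.

(** The mass is constant at positive times, and [L^1] convergence at [0+] identifies it with that of
    [v0]. *)
Lemma mass_initial (t : R) : gint Omega F v0 = gint Omega F (cst 1) -> 0 < t -> rint (v t) = m.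
Proof.
move=> v0m t0; have [_ L1 _ _] := v_initial; have [_ g0] := v0_L1.
have gv (r : R) : 0 < r -> gi (v r) by move=> r0; exact: (sol_gi Omega_open F_C2 v_sol v_adequate r0).
have <- : rint v0 = m by rewrite /gint_fin v0m.
apply/eqP; rewrite -subr_eq0 -normr_le0 -lee_fin; apply: cvge_to_ge L1 _.
near=> r; have r0 : 0 < r by near: r; exact: nbhs_right_gt.
have rt : r <= t by near: r; exact: nbhs_right_le.
have gd : gi (fun x => v r x - v0 x) by apply: (giB mO) => //; exact: gv.
rewrite (mass_constant Omega_open F_C2 v_sol v_adequate r0 rt) (gintE mO (gi_abs Omega_open gd)) lee_fin.
rewrite -(rintB mO)//; last exact: gv.
rewrite ler_norml; apply/andP; split; last by apply: (rint_le mO) => // [|x _]; [exact: gi_abs|exact: ler_norm].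
rewrite -(rintN mO); last exact: gi_abs.
apply: (rint_le mO) => //; first by apply: (giN mO); exact: gi_abs.
by move=> x _; rewrite lerNl -normrN; exact: ler_norm.
Unshelve. all: by end_near. Qed.

(** A finite infimum has a competitor of nonzero norm, which cannot exist if gamma vanishes. *)
Lemma mass_gt0 : (lambda1 Omega F p < +oo)%E -> 0 < m.
Proof.
move=> /ereal_inf_lt[_ [w [G [[_ gw2 _] D0 _ _]]] _].
rewrite lt_neqAle rint_ge0 ?andbT//; apply: contra D0 => /eqP m0.
have N0 : ae_eq (lebesgue_rV R d) Omega (fun x => (cst 1 x * expR (- F x))%:E) (cst 0%E).
  apply/ae_eq_integral_abs => //; first by case/integrableP: gone.
  transitivity (gint Omega F (cst 1)); last by rewrite (gintE mO gone) -m0.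
  by apply: eq_integral => x _; rewrite gee0_abs// lee_fin mulr_ge0 ?expR_ge0.
rewrite /gint (ae_eq_integral (cst 0%E))// ?integral0//; first by case/integrableP: gw2.
apply: filterS N0 => x /[apply] -[] /eqP; rewrite mul1r.
by rewrite (gt_eqF (expR_gt0 _)).
Qed.

Lemma energy_limit : 0 < lam -> forall e : R, 0 < e -> exists2 T : R, 1 <= T & forall t, T <= t -> J t <= e.
Proof.
move=> l0 e e0; pose C := J 1 * expR (2 * lam * 1).
have C0 : 0 <= C by rewrite mulr_ge0 ?expR_ge0.
have k0 : 0 < 2 * lam * e by rewrite !mulr_gt0.
(* From [e^x >= 1 + x], [J t] is at most [C / (2 lam t)]; the summand 1 secures [T >= 1]. *)
exists (1 + C / (2 * lam * e)) => [|t Tt]; first by rewrite lerDl divr_ge0// ltW.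
have q0 : 0 <= C / (2 * lam * e) by rewrite divr_ge0// ltW.
have t1 : 1 <= t by apply: le_trans Tt; rewrite lerDl.
have Ct : C <= 2 * lam * e * t.
  by rewrite mulrC -ler_pdivrMr//; apply: le_trans Tt; rewrite lerDr.
have D : J t * expR (2 * lam * t) <= C := J_decay ltr01 t1.
have X := expR_ge1Dx (2 * lam * t).
rewrite -(ler_pM2r (expR_gt0 (2 * lam * t))); apply: (le_trans D); apply: (le_trans Ct).
by rewrite mulrAC mulrC ler_wpM2l ?(ltW e0)//; lra.
Qed.

Lemma entropy_fisher : gint Omega F v0 = gint Omega F (cst 1) -> forall t : R, 0 < t ->
  2 * lam * E t <= 4 / p * J t.
Proof.
move=> v0m t t0; have c0 : 0 <= 4 / p by rewrite divr_ge0// ltW.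
have [l0|l0] := eqVneq lam 0; first by rewrite l0 mulr0 mul0r mulr_ge0.
have lp : 0 < lam by rewrite lt_neqAle eq_sym l0.
have mass (r : R) : 0 < r -> rint (v r) = m by exact: mass_initial.
have lim := entropy_limit Omega_open Omega_convex F_C2 g_L1 hp v_sol v_adequate mass (energy_limit lp) (mass_gt0 (lam_fin lp)).
(* Rate 0: the derivative of [4/p J - 2 lam E] is at most [- 2 lam I + 2 lam I = 0]. At a late time
   [r] the function exceeds [- e], since [J >= 0] and [E r <= e / (2 lam)]. *)
have mono := @exp_decay R (fun t => 4 / p * J t - 2 * lam * E t) 0.
rewrite -subr_ge0; apply/ler_addgt0Pr => e e0.
have [T T1 HT] := lim (e / (2 * lam)) (divr_gt0 e0 (mulr_gt0 (ltr0Sn R 1) lp)).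
pose r := Num.max t T.
have tr : t <= r by rewrite le_max lexx.
have Tr : T <= r by rewrite le_max lexx orbT.
have : 4 / p * J r - 2 * lam * E r <= 4 / p * J t - 2 * lam * E t.
  have := mono _ t r t0 tr; rewrite !mul0r expR0 !mulr1; apply => q q0.
  have [D DJ DD] := J_derive q0.
  have DE := entropy_derive Omega_open F_C2 hp v_sol v_adequate q0.
  have H := is_deriveB (is_deriveZ (4 / p) DJ) (is_deriveZ (2 * lam) DE).
  exists (4 / p * D - 2 * lam * - (4 / p * J q)); first exact: H.
  rewrite mul0r oppr0.
  have := ler_wpM2l c0 DD; lra.
have := HT r Tr; rewrite ler_pdivlMr ?mulr_gt0// => HE.
have := mulr_ge0 c0 (J_ge0 r); move: HE; move: (J r) (J t) (E r) (E t) => a b x y; lra.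
Qed.

Lemma entropy_decay (t : R) : gint Omega F v0 = gint Omega F (cst 1) -> 0 < t ->
  (entropy Omega F p (v t) <= entropy Omega F p v0 * (expR (- (2 * lam) * t))%:E)%E.
Proof.
move=> v0m; have [_ _ EL _] := v_initial.
apply: (initial_decay (f := fun t => entropy Omega F p (v t)) (a := E)) => //.
  by move=> r r0; exact: (entropy_valueE Omega_open F_C2 hp v_sol v_adequate r0).
apply: exp_decay => q q0; exists (- (4 / p * J q)).
  exact: (entropy_derive Omega_open F_C2 hp v_sol v_adequate q0).
by rewrite lerN2; exact: entropy_fisher.
Qed.

End conclusion.

(** The entropy estimate is conditional on [v0] having the same mass as the constant 1. Mass is
    conserved, and a constant solution different from 1 has a positive entropy that does not
    decay. *)
Theorem theorem1p2 (R : realType) (d : nat) (hd : (0 < d)%N)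
  (Omega : set 'rV[R]_d)
  (Omega_open : open Omega) (Omega_ne : Omega !=set0)
  (Omega_convex : convex_set Omega)
  (n : 'rV[R]_d -> 'rV[R]_d) (Omega_C1 : C1_boundary_normal Omega n)
  (sigma : {measure set 'rV[R]_d -> \bar R})
  (sigma_surface : surface_measure Omega n sigma)
  (F : 'rV[R]_d -> R) (F_C2 : Ck_bar 2 Omega F)
  (g_L1 : (lebesgue_rV R d).-integrable Omega (fun x => (expR (- F x))%:E))
  (p : R) (hp : 1 <= p <= 2)
  (v : R -> 'rV[R]_d -> R) (v0 : 'rV[R]_d -> R)
  (v_sol : smooth_positive_solution Omega F n v)
  (v_adequate : adequate Omega F n sigma p v)
  (v0_L1 : L1_plus Omega F v0)
  (v_initial : initial_datum Omega F p v v0)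
  (E0_finite : (entropy Omega F p v0 < +oo)%E)
  (lambda1_gt0 : (0 < lambda1 Omega F p)%E) (t : R) (ht : 0 <= t) :
  (fisher Omega F p (v t) <=
     fisher Omega F p v0 * (expR (- 2 * fine (lambda1 Omega F p) * t))%:E)%E /\
  (gint Omega F v0 = gint Omega F (cst 1) ->
   (entropy Omega F p (v t) <=
     entropy Omega F p v0 * (expR (- 2 * fine (lambda1 Omega F p) * t))%:E)%E).
Proof.
have [<-|t0] := eqVneq 0 t.
  by have [-> _ _ _] := v_initial; rewrite mulr0 expR0 !mule1; split => [|_]; exact: lexx.
have {}t0 : 0 < t by rewrite lt_neqAle t0.
set lam := fine (lambda1 Omega F p).
have l0 : 0 <= lam by rewrite fine_ge0// ltW.
(* If [lambda1] is [+oo], then [fine] returns 0: the estimates reduce to monotonicity, and [lam > 0]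
   implies that [lambda1] is finite. *)
have [ll lf] : (lam%:E <= lambda1 Omega F p)%E /\ (0 < lam -> (lambda1 Omega F p < +oo)%E).
  rewrite /lam; case: (lambda1 Omega F p) lambda1_gt0 => [r _|_|//] /=.
    by split=> // _; exact: ltry.
  by split; [rewrite leey|move=> H; rewrite ltxx in H].
rewrite mulNr; split; first exact: (@fisher_decay R d hd Omega F n sigma).
by move=> v0m; exact: (@entropy_decay R d hd Omega F n sigma).
Qed.
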